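(* Suppose $\Omega \subset \mathbb{C}^d$ is a bounded generic analytic polyhedron with a set of generic defining functions $f_1,\dots,f_N$. If $\xi \in \mathcal{L}(\Omega)$, then $\Omega$ is biholomorphic to $\Delta^{r(\xi)} \times \mathcal{F}(\xi)$.
   Context: $\Delta = \{z \in \mathbb{C} : |z|<1\}$. A domain is a non-empty connected open set. For a complex manifold $X$ (in particular for a domain), $\mathrm{Aut}(X)$ is the group of biholomorphisms $X \to X$ with the compact-open topology. For a holomorphic function $f$ near $z\in\mathbb{C}^d$, $\nabla f(z) \in \mathbb{C}^d$ is defined by $d(f)_z(v) = \langle v, \nabla f(z)\rangle$ for all $v \in \mathbb{C}^d$, where $\langle\cdot,\cdot\rangle$ is the standard Hermitian inner product. A domain $\Omega \subset \mathbb{C}^d$ is an analytic polyhedron if there exist a neighborhood $U$ of $\overline{\Omega}$ and holomorphic functions $f_1, \dots, f_N : U \to \mathbb{C}$ such that $\Omega = \{ z \in U : |f_i(z)| < 1 \text{ for } i = 1, \dots, N\}$. It is generic if such functions can be chosen so that whenever $\xi \in \partial\Omega$ and $|f_{i_1}(\xi)| = \dots = |f_{i_r}(\xi)| = 1$ (with $i_1,\dots,i_r$ distinct), the vectors $\nabla f_{i_1}(\xi), \dots, \nabla f_{i_r}(\xi)$ are $\mathbb{C}$-linearly independent; then $f_1,\dots,f_N$ is called a set of generic defining functions for $\Omega$. The limit set $\mathcal{L}(\Omega) \subset \partial\Omega$ of $\mathrm{Aut}(\Omega)$ is the set of $\xi \in \partial\Omega$ for which there exist a sequence $\varphi_n \in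 \mathrm{Aut}(\Omega)$ and a point $x \in \Omega$ with $\varphi_n(x) \to \xi$. For $\xi\in\partial\Omega$: $\mathcal{I}(\xi) = \{ i : |f_i(\xi)| = 1\}$, $r(\xi) = \#\mathcal{I}(\xi)$, and $\mathcal{F}(\xi) \subset \partial\Omega$ is the connected component containing $\xi$ of $$\{ \eta \in \partial\Omega : f_i(\eta) = f_i(\xi) \text{ if } i \in \mathcal{I}(\xi) \text{ and } |f_i(\eta)| < 1 \text{ if } i \notin \mathcal{I}(\xi)\}.$$ By genericity $\mathcal{F}(\xi)$ is a complex submanifold (locally closed) of $\mathbb{C}^d$ of dimension $d - r(\xi)$, and is regarded as a complex manifold in this way. *)

(* Defs.v *)
From HB Require Import structures.
From mathcomp Require Import all_boot all_order all_algebra complex.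
From mathcomp Require Import all_classical all_reals all_analysis.
Set Implicit Arguments.
Unset Strict Implicit.
Unset Printing Implicit Defensive.
Import Order.TTheory GRing.Theory Num.Theory.
Import numFieldNormedType.Exports.

Local Open Scope classical_set_scope.
Local Open Scope ring_scope.

(* MathComp-Analysis puts a topology on an abstract [numFieldType], but the
   instance is not found on the concrete type [R[i]]. *)
#[warnings="-redundant-canonical-projection,-HB.no-new-instance"]
HB.instance Definition _ (R : rcfType) := NormedModule.copy R[i] R[i]^o.

(* C^n is ['rV[R[i]]_n].  Its norm in MathComp-Analysis is the sup norm, which
   is equivalent to the Euclidean one.  As the scalar field is [R[i]],
   [differentiable] means complex (Frechet) differentiable. *)

Section Domains.
Variable R : realType.

(* Meant for open [U]; the values of [f] outside [U] are irrelevant. *)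
Definition holomorphic_on (V W : normedModType R[i]) (U : set V) (f : V -> W) :=
  forall z, U z -> differentiable f z.

Definition biholomorphism (V W : normedModType R[i]) (A : set V) (B : set W)
    (f : V -> W) (g : W -> V) :=
  [/\ open A /\ open B,
      holomorphic_on A f /\ holomorphic_on B g,
      (forall z, A z -> B (f z)) /\ (forall w, B w -> A (g w)) &
      (forall z, A z -> g (f z) = z) /\ (forall w, B w -> f (g w) = w)].

Definition domain (V : normedModType R[i]) (Omega : set V) :=
  [/\ Omega !=set0, open Omega & connected Omega].

Definition boundary (V : normedModType R[i]) (A : set V) : set V :=
  closure A `\` interior A.

Definition Aut (V : normedModType R[i]) (Omega : set V) : set (V -> V) :=
  [set phi | exists psi, biholomorphism Omega Omega phi psi].

Definition limit_set (V : normedModType R[i]) (Omega : set V) : set V :=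
  [set xi | boundary Omega xi /\
    exists (phi : nat -> V -> V) (x : V),
      [/\ forall n, Aut Omega (phi n), Omega x &
          (fun n => phi n x) @ \oo --> xi]].

End Domains.

Section Polyhedra.
Variables (R : realType) (d : nat).

Definition hermitian_product (v w : 'rV[R[i]]_d) : R[i] :=
  \sum_j v 0 j * Num.conj (w 0 j).

Definition gradient (f : 'rV[R[i]]_d -> R[i]) (z : 'rV[R[i]]_d) :
    'rV[R[i]]_d :=
  \row_j Num.conj ('d f z (delta_mx 0 j)).

Lemma gradientP (f : 'rV[R[i]]_d -> R[i]) (z v : 'rV[R[i]]_d) :
  'd f z v = hermitian_product v (gradient f z).
Proof.
rewrite {1}(row_sum_delta v) linear_sum; apply: eq_bigr => j _.
by rewrite linearZ /= mxE conjCK.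
Qed.

Lemma gradient_unique (f : 'rV[R[i]]_d -> R[i]) (z w : 'rV[R[i]]_d) :
  (forall v, 'd f z v = hermitian_product v w) -> w = gradient f z.
Proof.
move=> fw; apply/rowP => j; rewrite mxE fw /hermitian_product.
rewrite (bigD1 j) //= big1 ?addr0; last first.
  by move=> i /negbTE ij; rewrite mxE eqxx ij mul0r.
by rewrite mxE !eqxx mul1r conjCK.
Qed.

Variable N : nat.
Implicit Types (Omega U : set 'rV[R[i]]_d) (f : 'I_N -> 'rV[R[i]]_d -> R[i]).

Definition defining_functions Omega f :=
  exists U, [/\ open U, closure Omega `<=` U,
    forall i, holomorphic_on U (f i) &
    Omega = [set z | U z /\ forall i, `|f i z| < 1]].

Definition generic_defining_functions Omega f :=
  defining_functions Omega f /\
  forall xi, boundary Omega xi ->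
  forall s : seq 'I_N, uniq s -> (forall i, i \in s -> `|f i xi| = 1) ->
    free [seq gradient (f i) xi | i <- s].

(* This is I(xi); r(xi) is its cardinality. *)
Definition active f (xi : 'rV[R[i]]_d) : {set 'I_N} :=
  finset (fun i => `|f i xi| == 1).

Definition face Omega f (xi : 'rV[R[i]]_d) : set 'rV[R[i]]_d :=
  connected_component
    [set eta | [/\ boundary Omega eta,
       forall i, i \in active f xi -> f i eta = f i xi &
       forall i, i \notin active f xi -> `|f i eta| < 1]] xi.

End Polyhedra.

Definition polydisc (R : realType) (r : nat) : set 'rV[R[i]]_r :=
  [set z | forall j, `|z 0 j| < 1].

Arguments polydisc : clear implicits.

Section Submanifolds.
Variable R : realType.

(* A complex submanifold [M] of dimension [k] carries the atlas of its slice
   charts: ambient biholomorphisms from an open set onto an open subset of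
   C^k * C^codim which map [M] to C^k * {0}. *)
Record slice_chart (V : normedModType R[i]) (k : nat) (M : set V) := SliceChart {
  chart_codim : nat;
  chart_dom : set V;
  chart_cod : set ('rV[R[i]]_k * 'rV[R[i]]_chart_codim)%type;
  chart_map : V -> ('rV[R[i]]_k * 'rV[R[i]]_chart_codim)%type;
  chart_inv : ('rV[R[i]]_k * 'rV[R[i]]_chart_codim)%type -> V;
  chart_biholomorphism :
    biholomorphism chart_dom chart_cod chart_map chart_inv;
  chart_flat : forall z, chart_dom z -> (M z <-> (chart_map z).2 = 0) }.

Arguments chart_cod {V k M} s _.
Arguments chart_map {V k M} s _.
Arguments chart_inv {V k M} s _.

Section Chart.
Variables (V : normedModType R[i]) (k : nat) (M : set V) (a : slice_chart k M).

Definition chart_coord (z : V) : 'rV[R[i]]_k := (chart_map a z).1.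

Definition chart_range : set 'rV[R[i]]_k := [set x | chart_cod a (x, 0)].

Definition chart_param (x : 'rV[R[i]]_k) : V := chart_inv a (x, 0).

End Chart.

(* Holomorphy of a map between submanifolds of dimensions [k] and [l], in
   charts; it entails that [M] is covered by slice charts of dimension [k].
   The inclusion between chart domains gives continuity. *)
Definition holomorphic_map (V W : normedModType R[i]) (k l : nat)
    (M : set V) (N : set W) (g : V -> W) :=
  (forall p, M p -> N (g p)) /\
  forall p, M p -> exists (a : slice_chart k M) (b : slice_chart l N),
    [/\ chart_dom a p,
        forall z, M z -> chart_dom a z -> chart_dom b (g z) &
        holomorphic_on (chart_range a)
          (fun x => chart_coord b (g (chart_param a x)))].

Definition biholomorphic (V W : normedModType R[i]) (k l : nat)
    (M : set V) (N : set W) :=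
  exists (g : V -> W) (h : W -> V),
    [/\ holomorphic_map k l M N g, holomorphic_map l k N M h,
        forall p, M p -> h (g p) = p & forall q, N q -> g (h q) = q].

End Submanifolds.

(* Main.v *)
(* Let [phi_n] be automorphisms with [phi_n x --> xi].  Along an ultrafilter on
   [nat] every bounded sequence converges, so [phi_n] has a pointwise limit [Phi],
   which is holomorphic and, by the maximum principle, maps [Omega] into the face
   of [xi].  For each active [f_i] compose [f_i \o phi_n] with the disc
   automorphism that sends [f_i (phi_n x)] to [0]; the limits form a map [F] from
   [Omega] to the polydisc.  Near a point of the face, the active [f_i] and
   complementary linear coordinates [y] are local coordinates; in them the inverse
   of [z |-> (rescaled f (phi_n z), y (phi_n z))] is explicit, is defined on larger
   and larger subsets of polydisc * face, and takes values in the bounded set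
   [Omega].  Its limit [G] is therefore holomorphic, and it inverts [(F, Phi)] at
   the points with [G p] in [Omega].  By the maximum principle for [f_i \o G], on
   each chart [G] has either all or none of its values in [Omega]; since the face
   is connected and [G] takes the value [x], all of them are.

   The function theory is derived from one estimate, [|f'(0)| <= 8 M / r] for
   [|f| <= M] on the disc of radius [r].  It comes from Goursat's argument for
   midpoint sums over squares, which needs no integral. *)
Require Import Defs.
From HB Require Import structures.
From mathcomp Require Import all_boot all_order all_algebra complex.
From mathcomp Require Import all_classical all_reals all_analysis.
From mathcomp Require Import ring lra.
Set Implicit Arguments.
Unset Strict Implicit.
Unset Printing Implicit Defensive.
Import Order.TTheory GRing.Theory Num.Theory.
Import numFieldNormedType.Exports.
Local Open Scope classical_set_scope.
Local Open Scope ring_scope.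
Local Open Scope complex_scope.

(** The limit [Phi] loses [r] dimensions, as its values lie in a face of dimension [d - r]; [F] is a
    blow-up that recovers them. Disc automorphisms suffice for it because, in the local coordinates
    near the face, [Omega] is a product: pieces of unit discs next to the active values, times a
    piece of the face. They preserve each disc and stretch such a piece over larger and larger parts
    of it. The obstacle is surjectivity: a limit of inverses may fall into the boundary of [Omega],
    where [F] and [Phi] say nothing. The maps [G] exist only chart by chart, but as left inverses of
    [(F, Phi)] they give injectivity at once and agree with any global inverse, so they need not be
    glued. Holomorphy is differentiability at each point, so regularity of derivatives has to be
    earned; and ultralimits are pointwise, so every estimate has to depend on a radius and a bound
    alone. *)

(* The norms of normed modules over [R[i]] take their values in [R[i]]; [nr] is the
   real number behind them, to which [lra] applies. *)
Definition nr {R : realType} {V : normedModType R[i]} (x : V) : R := complex.Re `|x|.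

(** * Real-valued norms *)

Section Norm.
Context {R : realType} {V : normedModType R[i]}.
Implicit Types x y : V.

Lemma nrE x : `|x| = (nr x)%:C.
Proof.
have := normr_ge0 x; rewrite /nr; case: (`|x|) => a b.
by rewrite lecE /= => /andP[/eqP -> _].
Qed.

Lemma nr_ge0 x : 0 <= nr x.
Proof. by have := normr_ge0 x; rewrite nrE ler0c. Qed.

Lemma ler_nrD x y : nr (x + y) <= nr x + nr y.
Proof. by have := ler_normD x y; rewrite !nrE -rmorphD lecR. Qed.

Lemma nrN x : nr (- x) = nr x.
Proof. by rewrite /nr normrN. Qed.

Lemma nrB x y : nr (x - y) = nr (y - x).
Proof. by rewrite /nr distrC. Qed.

Lemma nr0 : nr (0 : V) = 0.
Proof. by rewrite /nr normr0. Qed.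

Lemma nr_eq0 x : (nr x == 0) = (x == 0).
Proof.
apply/eqP/eqP => [x0|->]; last exact: nr0.
by apply: normr0_eq0; rewrite nrE x0.
Qed.

Lemma nrZ (a : R[i]) x : nr (a *: x) = nr a * nr x.
Proof. by have := normrZ a x; rewrite !nrE -rmorphM => /complexI. Qed.

Lemma ler_nrB x y : nr (x - y) <= nr x + nr y.
Proof. by rewrite -(nrN y) ler_nrD. Qed.

Lemma ler_nr_tri x y z : nr (x - z) <= nr (x - y) + nr (y - z).
Proof. by rewrite -[x - z](subrKA y) ler_nrD. Qed.

Lemma nr_sum I (s : seq I) (P : pred I) (F : I -> V) :
  nr (\sum_(i <- s | P i) F i) <= \sum_(i <- s | P i) nr (F i).
Proof.
elim/big_ind2 : _ => [|x a y b xa yb|//]; first by rewrite nr0.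
by rewrite (le_trans (ler_nrD _ _)) ?lerD.
Qed.

Lemma nbhs_nr x (P : set V) :
  nbhs x P <-> exists2 e : R, 0 < e & forall y, nr (y - x) < e -> P y.
Proof.
rewrite -nbhs_nbhs_norm; split=> [[e /= e0 eP]|[e e0 eP]].
- have eE : e = (complex.Re e)%:C.
    by move: e0; rewrite ltcE; case: (e) => a b /= /andP[/eqP -> _].
  exists (complex.Re e); first by rewrite -ltcR -eE.
  by move=> y yx; apply: eP => /=; rewrite distrC nrE eE ltcR.
- exists e%:C; first by rewrite /= ltcR.
  by move=> y /=; rewrite distrC nrE ltcR; exact: eP.
Qed.

Lemma openP_nr (U : set V) :
  open U <-> forall x, U x -> exists2 e : R, 0 < e & forall y, nr (y - x) < e -> U y.
Proof.
rewrite openE; split=> h x Ux.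
- by have /nbhs_nr := h _ Ux.
- by apply/nbhs_nr/h.
Qed.

Lemma closureP_nr (A : set V) x :
  closure A x <-> forall e : R, 0 < e -> exists2 y, A y & nr (y - x) < e.
Proof.
split=> [cA e e0|h B /nbhs_nr[e e0 eB]].
- have /cA[y [Ay yx]] : nbhs x [set y | nr (y - x) < e].
    by apply/nbhs_nr; exists e.
  by exists y.
- by have [y Ay yx] := h _ e0; exists y; split => //; apply: eB.
Qed.

Lemma cvg_nr (T : Type) (F : set_system T) {FF : Filter F} (u : T -> V) (l : V) :
  u @ F --> l <-> forall e : R, 0 < e -> F [set t | nr (u t - l) < e].
Proof.
split=> [ul e e0|h A /nbhs_nr[e e0 eA]].
- apply: (ul [set y | nr (y - l) < e]).
  by apply/nbhs_nr; exists e.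
- by apply: filterS (h _ e0) => t; apply: eA.
Qed.

End Norm.

Section NormC.
Context {R : realType}.
Implicit Types x y : R[i].

Lemma nrM x y : nr (x * y) = nr x * nr y.
Proof. exact: nrZ. Qed.

Lemma nr1 : nr (1 : R[i]) = 1.
Proof. by rewrite /nr normr1. Qed.

Lemma nrV x : nr x^-1 = (nr x)^-1.
Proof. by apply: complexI; rewrite fmorphV -!nrE normfV. Qed.

Lemma nrX x n : nr (x ^+ n) = nr x ^+ n.
Proof. by elim: n => [|n ih]; rewrite ?nr1// !exprS nrM ih. Qed.

Lemma nr_real (a : R) : nr a%:C = `|a|.
Proof. by apply: complexI; rewrite -nrE normc_def /= expr0n addr0 sqrtr_sqr. Qed.

Lemma nr_conj x : nr (Num.conj x) = nr x.
Proof. by rewrite /nr norm_conjC. Qed.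

Lemma nrMconj x : x * Num.conj x = (nr x ^+ 2)%:C.
Proof. by rewrite rmorphXn /= -nrE normCK. Qed.

Lemma Re_le_nr x : `|complex.Re x| <= nr x.
Proof. by have := normc_ge_Re x; rewrite nrE lecR. Qed.

Lemma Im_le_nr x : `|complex.Im x| <= nr x.
Proof.
have := Re_le_nr (- 'i * x).
by rewrite nrM nrN {1}/nr normCi mul1r; case: x => a b /=; rewrite /= !(mul0r, oppr0,
  sub0r,mulN1r, opprK, add0r).
Qed.

Lemma nr_le_ReIm x : nr x <= `|complex.Re x| + `|complex.Im x|.
Proof.
case: x => a b /=.
have -> : a +i* b = a%:C + 'i * b%:C by simpc.
by rewrite (le_trans (ler_nrD _ _))// nrM !nr_real {1}/nr normCi mul1r.
Qed.

End NormC.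

(** * Contour sums and the Cauchy estimate *)

Section Contour.
Context {R : realType}.
Local Notation C := R[i].
Implicit Types (g h : C -> C) (p v z a : C).

(* The midpoint rule with [m] nodes on the segment from [p] to [p + v]. *)
Definition seg_sum g p v (m : nat) : C :=
  \sum_(0 <= k < m) g (p + v * ((k%:R + 2^-1) / m%:R)) * (v / m%:R).

Definition square_sum g p v m : C :=
  seg_sum g p v m + seg_sum g (p + v) ('i * v) m
  + seg_sum g (p + v + 'i * v) (- v) m + seg_sum g (p + 'i * v) (- ('i * v)) m.

(** A shift of the index by [m] moves a node by exactly one third of the segment, so the [3 * m]
    nodes are those of the three thirds and no error term appears. *)
Lemma seg_sum_split g p v m :
  seg_sum g p v (3 * m) = seg_sum g p (v / 3) m + seg_sum g (p + v / 3) (v / 3) m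
    + seg_sum g (p + v / 3 + v / 3) (v / 3) m.
Proof.
have [->|m0] := posnP m; first by rewrite /seg_sum !big_geq// !addr0.
have mU : m%:R != 0 :> C by rewrite pnatr_eq0 -lt0n.
have m3 : (3 * m = m + (m + m))%N by rewrite !mulSn addn0.
have le1 : (m <= 3 * m)%N by rewrite m3 leq_addr.
have le2 : (m + m <= 3 * m)%N by rewrite m3 addnA leq_addr.
rewrite /seg_sum (natrM C) (big_cat_nat (n := m)) //= [X in _ + X](big_cat_nat (n := m + m))
  ?leq_addr//=.
rewrite -addrA; congr (_ + (_ + _)).
- by apply: eq_bigr => k _; congr (g _ * _); field.
- rewrite -{1}[m]add0n big_addn addnK; apply: eq_bigr => k _.
  by rewrite (natrD C); congr (g _ * _); field.
- rewrite -{1}[(m + m)%N]add0n big_addn m3 addnA addKn; apply: eq_bigr => k _.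
  by rewrite !(natrD C); congr (g _ * _); field.
Qed.

(** The reflection [k |-> m - 1 - k] permutes the midpoints; this is what the offset [2^-1] is for,
    as left-end sums would change their nodes. *)
Lemma seg_sum_rev g p v m : seg_sum g (p + v) (- v) m = - seg_sum g p v m.
Proof.
have [->|m0] := posnP m; first by rewrite /seg_sum !big_geq// oppr0.
have mU : m%:R != 0 :> C by rewrite pnatr_eq0 -lt0n.
rewrite /seg_sum big_nat_rev -sumrN /=; apply: eq_big_nat => k /andP[_ km].
rewrite add0n natrB // -natr1 -mulrN -mulNr; congr (g _ * _).
by field.
Qed.

Lemma square_sumE g p v m : square_sum g p v m =
  seg_sum g p v m + seg_sum g (p + v) ('i * v) m
  - seg_sum g (p + 'i * v) v m - seg_sum g p ('i * v) m.
Proof. by rewrite /square_sum (addrAC p v) !seg_sum_rev. Qed.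

Definition subsquare p v (a b : 'I_3) : C := p + (a%:R + 'i * b%:R) * (v / 3).

(* The nine subsquares share their inner edges with opposite orientations. *)
Lemma square_sum_split g p v m : square_sum g p v (3 * m) =
  \sum_(a < 3) \sum_(b < 3) square_sum g (subsquare p v a b) (v / 3) m.
Proof.
have E (a b : 'I_3) : square_sum g (subsquare p v a b) (v / 3) m =
   seg_sum g (p + (a%:R + 'i * b%:R) * (v / 3)) (v / 3) m
   + seg_sum g (p + ((a.+1)%:R + 'i * b%:R) * (v / 3)) ('i * v / 3) m
   - seg_sum g (p + (a%:R + 'i * (b.+1)%:R) * (v / 3)) (v / 3) m
   - seg_sum g (p + (a%:R + 'i * b%:R) * (v / 3)) ('i * v / 3) m.
  rewrite square_sumE /subsquare; congr (_ + seg_sum _ _ _ _ - seg_sum _ _ _ _ - seg_sum _ _ _ _);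
    rewrite -?natr1; by field.
under eq_bigr do under eq_bigr do rewrite E.
rewrite !big_ord_recl !big_ord0 /= /bump /= !addr0 !add1n.
rewrite square_sumE !seg_sum_split.
(* All base points are rewritten as grid points [p + (a + 'i * b) * (v / 3)], so that the two sums
   over a shared edge become syntactically equal and cancel by [ring]. *)
have H1 (a b : nat) u q : q = p + (a%:R + 'i * b%:R) * (v / 3) ->
  seg_sum g q u m = seg_sum g (p + (a%:R + 'i * b%:R) * (v / 3)) u m by move=> ->.
rewrite (H1 0%N 0%N (v / 3) p); last by ring.
rewrite (H1 0%N 0%N ('i * v / 3) p); last by ring.
rewrite (H1 1%N 0%N _ (p + v / 3)); last by ring.
rewrite (H1 2%N 0%N _ (p + v / 3 + v / 3)); last by ring.
rewrite (H1 3%N 0%N _ (p + v)); last by field.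
rewrite (H1 3%N 1%N _ (p + v + _)); last by field.
rewrite (H1 3%N 2%N _ (p + v + _ + _)); last by field.
rewrite (H1 0%N 3%N _ (p + 'i * v)); last by field.
rewrite (H1 1%N 3%N _ (p + 'i * v + _)); last by field.
rewrite (H1 2%N 3%N _ (p + 'i * v + _ + _)); last by field.
rewrite (H1 0%N 1%N _ (p + 'i * v / 3)); last by field.
rewrite (H1 0%N 2%N _ (p + 'i * v / 3 + 'i * v / 3)); last by field.
by ring.
Qed.

Lemma seg_sum_affine (al be : C) p v m : (0 < m)%N ->
  seg_sum (fun z => al + be * z) p v m = v * (al + be * (p + v / 2)).
Proof.
move=> m0; have mU : m%:R != 0 :> C by rewrite pnatr_eq0 -lt0n.
have S n : \sum_(0 <= k < n) (al + be * (p + v * ((k%:R + 2^-1) / m%:R))) * (v / m%:R)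
   = n%:R * (al + be * p) * (v / m%:R) + be * v * v / m%:R ^+ 2 * (n%:R ^+ 2 / 2).
  elim: n => [|n ih]; first by rewrite big_geq//; ring.
  by rewrite big_nat_recr //= ih -natr1; field.
by rewrite /seg_sum S; field.
Qed.

Lemma square_sum_affine (al be : C) p v m : (0 < m)%N ->
  square_sum (fun z => al + be * z) p v m = 0.
Proof.
move=> m0; rewrite /square_sum !seg_sum_affine//.
by field.
Qed.

Lemma seg_sumB g h p v m :
  seg_sum (fun z => g z - h z) p v m = seg_sum g p v m - seg_sum h p v m.
Proof. by rewrite /seg_sum -sumrB; apply: eq_bigr => k _; rewrite mulrBl. Qed.

Lemma square_sumB g h p v m :
  square_sum (fun z => g z - h z) p v m = square_sum g p v m - square_sum h p v m.
Proof. by rewrite /square_sum !seg_sumB; ring. Qed.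

Lemma seg_sumZ a h p v m :
  seg_sum (fun z => a * h z) p v m = a * seg_sum h p v m.
Proof. by rewrite /seg_sum mulr_sumr; apply: eq_bigr => k _; rewrite [RHS]mulrA. Qed.

Lemma square_sumZ a h p v m :
  square_sum (fun z => a * h z) p v m = a * square_sum h p v m.
Proof. by rewrite /square_sum !seg_sumZ; ring. Qed.

Lemma seg_sum_le g p v m (M : R) : 0 <= M ->
  (forall t : R, 0 <= t <= 1 -> nr (g (p + v * t%:C)) <= M) ->
  nr (seg_sum g p v m) <= M * nr v.
Proof.
have [->|m0] := posnP m.
  by rewrite /seg_sum big_geq// nr0 => M0 _; rewrite mulr_ge0 ?nr_ge0.
move=> M0 gM; have mU : m%:R != 0 :> R by rewrite pnatr_eq0 -lt0n.
have mU0 : 0 < m%:R :> R by rewrite ltr0n.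
apply: (le_trans (nr_sum _ _ _)).
have -> : M * nr v = \sum_(0 <= k < m) (M * (nr v / m%:R)).
  by rewrite big_const_nat subn0 iter_addr addr0 -mulr_natr; field.
apply: ler_sum_nat => k /andP[_ km].
have mC : (m%:R : C)= (m%:R : R)%:C by rewrite rmorph_nat.
rewrite nrM nrM nrV mC nr_real (ger0_norm (ltW mU0)).
apply: ler_wpM2r; first by rewrite divr_ge0 ?nr_ge0// ltW.
have -> : (k%:R + 2^-1) / (m%:R : R)%:C = ((k%:R + 2^-1) / (m%:R : R))%:C :> C.
  by rewrite rmorphM rmorphD !fmorphV !rmorph_nat.
apply: gM; rewrite divr_ge0 ?(ltW mU0) ?addr_ge0//= ler_pdivrMr// mul1r.
have : (k.+1%:R <= m%:R :> R) by rewrite ler_nat.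
by rewrite -natr1; lra.
Qed.

Lemma square_sum_le g p v m (M : R) : 0 <= M ->
  (forall t : R, 0 <= t <= 1 -> [/\ nr (g (p + v * t%:C)) <= M,
    nr (g (p + v + 'i * v * t%:C)) <= M,
    nr (g (p + 'i * v + v * t%:C)) <= M & nr (g (p + 'i * v * t%:C)) <= M]) ->
  nr (square_sum g p v m) <= 4 * M * nr v.
Proof.
move=> M0 gM; rewrite square_sumE.
have iv : nr ('i * v) = nr v by rewrite nrM {1}/nr normCi mul1r.
have h1 : nr (seg_sum g p v m) <= M * nr v by apply: seg_sum_le => // t /gM[].
have h2 : nr (seg_sum g (p + v) ('i * v) m) <= M * nr v.
  by rewrite -iv; apply: seg_sum_le => // t /gM[].
have h3 : nr (seg_sum g (p + 'i * v) v m) <= M * nr v by apply: seg_sum_le => // t /gM[].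
have h4 : nr (seg_sum g p ('i * v) m) <= M * nr v.
  by rewrite -iv; apply: seg_sum_le => // t /gM[].
apply: le_trans (ler_nrB _ _) _; apply: le_trans (lerD (ler_nrB _ _) (lexx _)) _.
apply: le_trans (lerD (lerD (ler_nrD _ _) (lexx _)) (lexx _)) _.
lra.
Qed.

End Contour.

Lemma rect_complex {R : realType} (x y : R) : x%:C + 'i * y%:C = x +i* y.
Proof. by rewrite -complexiE; simpc. Qed.

Lemma nested_intervals {R : realType} (x l : nat -> R) :
  (forall k, 0 <= l k) -> (forall k, x k <= x k.+1) ->
  (forall k, x k.+1 + l k.+1 <= x k + l k) ->
  exists t, forall k, x k <= t <= x k + l k.
Proof.
move=> l0 xi xd.
have xm m n : (m <= n)%N -> x m <= x n.
  by elim: n => [|n ih]; rewrite leq_eqVlt => /orP[/eqP->//|] // /ih /le_trans; apply.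
have xdm m n : (m <= n)%N -> x n + l n <= x m + l m.
  elim: n => [|n ih]; rewrite leq_eqVlt => /orP[/eqP->//|] // /ih; exact: le_trans.
have ub k n : x n <= x k + l k.
  have [nk|/ltnW kn] := leqP n k.
    by rewrite (le_trans (xm _ _ nk))// lerDl.
  by rewrite (le_trans _ (xdm _ _ kn))// lerDl.
exists (sup (range x)) => k; apply/andP; split.
- by apply: ub_le_sup; [exists (x 0%N + l 0%N) => _ [n _ <-]|exists k].
- by apply: ge_sup; [exists (x 0%N), 0%N|move=> _ [n _ <-]].
Qed.

Lemma exists_div_exp3_lt {R : realType} (x d : R) : 0 < d -> exists k, x / 3 ^+ k < d.
Proof.
move=> d0; exists (Num.bound (x / d)).
have := upper_nthrootP (leqnn (Num.bound (x / d))).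
set n := Num.bound _ => xd; rewrite ltr_pdivrMr ?exprn_gt0//.
have : x < d * 2 ^+ n by rewrite -ltr_pdivrMl// mulrC.
move/lt_le_trans; apply; rewrite ler_pM2l// lerXn2r ?nnegrE//.
by rewrite ler_nat.
Qed.

(** * Goursat's lemma for midpoint sums *)

Section Goursat.
Context {R : realType}.
Local Notation C := R[i].
Implicit Types (g h f : C -> C) (p v z a w : C).

Definition has_deriv g z a := forall e : R, 0 < e -> exists2 d : R, 0 < d &
  forall w, nr (w - z) < d -> nr (g w - g z - a * (w - z)) <= e * nr (w - z).

Definition square_pt p v (x y : R) : C := p + v * x%:C + 'i * v * y%:C.

Lemma nr_square_pt v (x y : R) : nr (square_pt 0 v x y) <= nr v * (`|x| + `|y|).
Proof.
rewrite /square_pt add0r (le_trans (ler_nrD _ _))// !nrM !nr_real {2}/nr normCi mul1r.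
by rewrite mulrDr.
Qed.

Lemma square_sum_le_square g p v m (M : R) : 0 <= M ->
  (forall x y : R, 0 <= x <= 1 -> 0 <= y <= 1 -> nr (g (square_pt p v x y)) <= M) ->
  nr (square_sum g p v m) <= 4 * M * nr v.
Proof.
move=> M0 gM; apply: square_sum_le => // t t01.
have o01 : 0 <= (1 : R) <= 1 by rewrite ler01 lexx.
have z01 : 0 <= (0 : R) <= 1 by rewrite ler01 lexx.
split.
- by have := gM t 0 t01 z01; rewrite /square_pt mulr0 addr0.
- by have := gM 1 t o01 t01; rewrite /square_pt mulr1.
- by have := gM t 1 t01 o01; rewrite /square_pt mulr1 addrAC.
- by have := gM 0 t z01 t01; rewrite /square_pt mulr0 addr0.
Qed.

Lemma subsquare_pt p v (x y : R) k (a b : 'I_3) :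
  subsquare (square_pt p v x y) (v / 3 ^+ k) a b =
  square_pt p v (x + a%:R / 3 ^+ k.+1) (y + b%:R / 3 ^+ k.+1).
Proof.
rewrite /subsquare /square_pt !(rmorphD, rmorphM, fmorphV, rmorphXn, rmorph_nat) /= ?rmorph_nat.
by rewrite exprS; field; rewrite expf_neq0// pnatr_eq0.
Qed.

Lemma square_pt_pt p v (x y : R) (s t l : R) :
  square_pt (square_pt p v x y) (v * l%:C) s t = square_pt p v (x + l * s) (y + l * t).
Proof. by rewrite /square_pt !(rmorphD, rmorphM) /=; ring. Qed.

Lemma square_ptB p v (x y x' y' : R) :
  square_pt p v x y - square_pt p v x' y' = square_pt 0 v (x - x') (y - y').
Proof. by rewrite /square_pt !(rmorphB) /=; ring. Qed.

(* Midpoint sums are exactly additive under subdivision and vanish on affine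
   functions, so the bisection argument applies to them directly.  Squares are cut
   in nine rather than four so that [0] stays the centre of the central piece. *)
Lemma goursat g p v (e : R) : 0 < e ->
  (forall x y : R, 0 <= x <= 1 -> 0 <= y <= 1 ->
     exists a, has_deriv g (square_pt p v x y) a) ->
  exists n0, forall n, (n0 <= n)%N ->
    nr (square_sum g p v (3 ^ n)) <= e * nr v ^+ 2.
Proof.
move=> e0 dg.
pose good q w := exists n0, forall n, (n0 <= n)%N ->
    nr (square_sum g q w (3 ^ n)) <= e * nr w ^+ 2.
have good_split q w : (forall a b : 'I_3, good (subsquare q w a b) (w / 3)) -> good q w.
  move=> gd; have [N NP] := choice (fun ab : 'I_3 * 'I_3 => gd ab.1 ab.2).
  (* One factor [3] of the number of nodes is spent on the subdivision, hence the successor. The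
     areas of the nine pieces add up, hence the square in the bound. *)
  exists (\max_ab N ab).+1 => -[//|n] nN.
  rewrite expnS square_sum_split (le_trans (nr_sum _ _ _))//.
  have -> : e * nr w ^+ 2 = \sum_(a < 3) \sum_(b < 3) e * nr (w / 3) ^+ 2.
    rewrite !big_ord_recl !big_ord0 !addr0 nrM nrV.
    have -> : nr (3 : C) = 3 by rewrite -(rmorph_nat (real_complex R)) nr_real ger0_norm.
    by field.
  apply: ler_sum => a _; rewrite (le_trans (nr_sum _ _ _))//; apply: ler_sum => b _.
  apply: (NP (a, b)); rewrite ltnS in nN; apply: leq_trans nN.
  exact: (leq_bigmax (a, b)).
apply: contrapT => badp.
pose bad k (s : R * R) := ~ good (square_pt p v s.1 s.2) (v / 3 ^+ k).
have step (ks : nat * (R * R)) : exists ab : 'I_3 * 'I_3, bad ks.1 ks.2 ->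
    bad ks.1.+1 (ks.2.1 + ab.1%:R / 3 ^+ ks.1.+1, ks.2.2 + ab.2%:R / 3 ^+ ks.1.+1).
  case: ks => k [x y] /=; apply: contrapT => nab.
  have bxy : bad k (x, y).
    by apply: contrapT => nb; apply: nab; exists (ord0, ord0) => /nb.
  apply: bxy => /=; apply: good_split => a b; rewrite subsquare_pt.
  apply: contrapT => bab; apply: nab; exists (a, b) => _; rewrite /bad /=.
  have -> : v / 3 ^+ k.+1 = v / 3 ^+ k / 3 by rewrite exprSr invfM mulrA.
  exact: bab.
have [F FP] := choice step.
pose S := fix S k : R * R := if k is k'.+1 then
  let s := S k' in (s.1 + (F (k', s)).1%:R / 3 ^+ k, s.2 + (F (k', s)).2%:R / 3 ^+ k)
  else (0, 0).
have badS k : bad k (S k).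
  elim: k => [|k /(FP (k, S k))//]; rewrite /bad /= /square_pt !mulr0 !addr0 expr0 divr1.
  exact: badp.
have [l0 l3] : (forall k, 0 <= (3 ^+ k)^-1 :> R) /\
    (forall k, (3 ^+ k)^-1 = (3 ^+ k.+1)^-1 *+ 3 :> R).
  split=> k; first by rewrite invr_ge0 exprn_ge0.
  by rewrite exprS -mulr_natr; field; rewrite expf_neq0.
have le2 (a : 'I_3) : a%:R <= 2 :> R by rewrite ler_nat -ltnS.
have ge0 (a : 'I_3) : 0 <= a%:R :> R by [].
have [x xP] : exists t, forall k, (S k).1 <= t <= (S k).1 + (3 ^+ k)^-1.
  apply: nested_intervals => // k.
    by rewrite /= lerDl divr_ge0// exprn_ge0.
  rewrite [leLHS]/= (l3 k) -addrA lerD2l (mulrSr (3 ^- k.+1) 2) lerD2r.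
  by rewrite -(mulr_natl (3 ^- k.+1)) ler_wpM2r.
have [y yP] : exists t, forall k, (S k).2 <= t <= (S k).2 + (3 ^+ k)^-1.
  apply: nested_intervals => // k.
    by rewrite /= lerDl divr_ge0// exprn_ge0.
  rewrite [leLHS]/= (l3 k) -addrA lerD2l (mulrSr (3 ^- k.+1) 2) lerD2r.
  by rewrite -(mulr_natl (3 ^- k.+1)) ler_wpM2r.
have [] := dg x y.
- by have := xP 0%N; rewrite /= add0r expr0 invr1.
- by have := yP 0%N; rewrite /= add0r expr0 invr1.
(* On a square of side [w] containing the limit point all distances to it are at most [2 * nr w],
   and the perimeter is [4 * nr w]; [e / 8] compensates both factors. *)
move=> a /(_ (e / 8)) []; first by rewrite divr_gt0.
set z0 := square_pt p v x y => d d0 dP.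
have [k kd] := exists_div_exp3_lt (2 * nr v) d0.
have nrk : nr (v / 3 ^+ k) = nr v / 3 ^+ k.
  have -> : 3 ^+ k = (3 ^+ k)%:C :> C by rewrite rmorphXn /= rmorph_nat.
  by rewrite nrM nrV nr_real ger0_norm// exprn_ge0.
apply: (badS k); exists 0%N => n _.
have m0 : (0 < 3 ^ n)%N by rewrite expn_gt0.
set q := square_pt _ _ _ _; set w := v / _.
have -> : square_sum g q w (3 ^ n) =
    square_sum (fun z => g z - (g z0 - a * z0 + a * z)) q w (3 ^ n).
  by rewrite square_sumB square_sum_affine// subr0.
have -> : e * nr w ^+ 2 = 4 * (e / 8 * (2 * nr w)) * nr w by field.
apply: square_sum_le_square => [|s t /andP[s0 s1] /andP[t0 t1]].
  by rewrite !mulr_ge0 ?nr_ge0 ?invr_ge0 ?ler0n// ltW.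
set z := square_pt q w s t.
have zz0 : nr (z - z0) <= 2 * nr w.
  rewrite /z /q /w /z0.
  have -> : v / 3 ^+ k = v * ((3 ^+ k)^-1)%:C by rewrite fmorphV rmorphXn /= rmorph_nat.
  rewrite square_pt_pt square_ptB (le_trans (nr_square_pt _ _ _))//.
  have /andP[x1 x2] := xP k; have /andP[y1 y2] := yP k.
  have := nrk; rewrite {1}(_ : v / 3 ^+ k = v * ((3 ^+ k)^-1)%:C) ?fmorphV ?rmorphXn /=
    ?rmorph_nat// => ->.
  rewrite mulrCA; apply: ler_wpM2l; first exact: nr_ge0.
  have lk := l0 k; set l := (3 ^+ k)^-1 in lk x2 y2 *.
  have ls : 0 <= l * s <= l by rewrite mulr_ge0//= ler_piMr.
  have lt : 0 <= l * t <= l by rewrite mulr_ge0//= ler_piMr.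
  have : `|(S k).1 + l * s - x| <= l by rewrite ler_norml; lra.
  have : `|(S k).2 + l * t - y| <= l by rewrite ler_norml; lra.
  lra.
have -> : g z - (g z0 - a * z0 + a * z) = g z - g z0 - a * (z - z0) by ring.
have /dP /le_trans : nr (z - z0) < d by rewrite (le_lt_trans zz0)// nrk mulrA.
by apply; rewrite ler_wpM2l// divr_ge0// ltW.
Qed.

End Goursat.

(** * An isolated singularity at the centre of the square *)

Section Cauchy.
Context {R : realType}.
Local Notation C := R[i].
Implicit Types (g h f : C -> C) (p v z a w : C).

Lemma nr_rect (x y : R) : Num.max `|x| `|y| <= nr (x%:C + 'i * y%:C).
Proof. by rewrite rect_complex ge_max (Re_le_nr (x +i* y)) (Im_le_nr (x +i* y)). Qed.

Lemma has_deriv_subaffine f z a (c b : C) : has_deriv f z a ->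
  has_deriv (fun w => f w - c - b * w) z (a - b).
Proof.
move=> df e /df[d d0 dP]; exists d => // w /dP; congr (nr _ <= _); ring.
Qed.

Lemma has_deriv_div f z a : z != 0 -> has_deriv f z a ->
  has_deriv (fun w => f w / w) z (a / z - f z / z ^+ 2).
Proof.
move=> z0 df e e0.
have nz0 : 0 < nr z by rewrite lt_def nr_eq0 z0 nr_ge0.
have [d d0 dP] := df (e * nr z / 4) (divr_gt0 (mulr_gt0 e0 nz0) (ltr0n _ 4)).
set B := f z / z ^+ 2 - a / z.
have B0 : 0 <= nr B by exact: nr_ge0.
have B1 : 0 < 4 * nr B + 1 by lra.
(* The bound [nr z / 2] keeps [w] away from [0]. The last one makes the quadratic term
   [(w - z) ^+ 2 * B] small; its [+ 1] avoids a zero denominator when [B = 0]. *)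
exists (Num.min d (Num.min (nr z / 2) (e * nr z / (4 * nr B + 1)))).
  by rewrite !lt_min d0 !divr_gt0// mulr_gt0.
move=> w; rewrite !lt_min => /and3P[wd w2 wB].
have zw : nr z / 2 <= nr w.
  have := ler_nr_tri z w 0; rewrite !subr0 nrB; lra.
have w0 : w != 0 by rewrite -nr_eq0; apply/eqP => ww; lra.
have -> : f w / w - f z / z - (a / z - f z / z ^+ 2) * (w - z) =
    ((f w - f z - a * (w - z)) + (w - z) ^+ 2 * B) / w.
  by rewrite /B; field; rewrite w0 z0.
rewrite nrM nrV ler_pdivrMr; last by lra.
rewrite (le_trans (ler_nrD _ _))// nrM nrX.
have := dP w wd; set h := nr (w - z); rewrite -/h in wB.
have h0 : 0 <= h by exact: nr_ge0.
have hB : h * nr B <= e * nr z / 4.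
  move: wB; rewrite ltr_pdivlMr// => wB.
  have : h * (4 * nr B) <= h * (4 * nr B + 1) by rewrite ler_wpM2l//; lra.
  lra.
have : h ^+ 2 * nr B <= h * (e * nr z / 4) by rewrite expr2 -mulrA ler_wpM2l.
have : e * h * (nr z / 2) <= e * h * nr w by rewrite ler_wpM2l// mulr_ge0// ltW.
lra.
Qed.

(* Lower left corner of the square of centre [0] and side [v]. *)
Definition centered v : C := - (1 + 'i) / 2 * v.

Lemma centered_pt v (x y : R) : square_pt (centered v) v x y =
  square_pt 0 v (x - 2^-1) (y - 2^-1).
Proof.
by rewrite /square_pt /centered !(rmorphB, fmorphV) /= rmorph_nat; field.
Qed.

(** The boundary of the square stays between its inradius, half a side, and its half diagonal, which
    is at most a side. *)
Lemma square_sum_centered_le g v m (M : R) : 0 <= M ->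
  (forall z, nr v / 2 <= nr z -> nr z <= nr v -> nr (g z) <= M) ->
  nr (square_sum g (centered v) v m) <= 4 * M * nr v.
Proof.
move=> M0 gM.
have side (s t : R) : -2^-1 <= s <= 2^-1 -> -2^-1 <= t <= 2^-1 ->
    2^-1 <= Num.max `|s| `|t| -> nr (g (square_pt 0 v s t)) <= M.
  move=> s1 t1 st; apply: gM.
    have -> : square_pt 0 v s t = v * (s%:C + 'i * t%:C) by rewrite /square_pt; ring.
    by rewrite nrM ler_wpM2l ?nr_ge0// (le_trans st)//; exact: nr_rect.
  apply: le_trans (nr_square_pt _ _ _) _; rewrite ler_piMr ?nr_ge0//.
  have : `|s| <= 2^-1 by rewrite ler_norml.
  have : `|t| <= 2^-1 by rewrite ler_norml.
  lra.
apply: square_sum_le => // t /andP[t0 t1].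
have t01 : - 2^-1 <= t - 2^-1 <= 2^-1 by lra.
have h0 : 2^-1 <= `|0 - 2^-1 : R| by rewrite sub0r normrN ger0_norm// invr_ge0.
have h1 : 2^-1 <= `|1 - 2^-1 : R| by rewrite ler_normr; apply/orP; left; lra.
split.
- have -> : centered v + v * t%:C = square_pt (centered v) v t 0 by rewrite /square_pt rmorph0
  mulr0 addr0.
  rewrite centered_pt.
  by apply: side => //; [lra|rewrite le_max h0 orbT].
- have -> : centered v + v + 'i * v * t%:C = square_pt (centered v) v 1 t by rewrite /square_pt
  rmorph1 mulr1.
  rewrite centered_pt.
  by apply: side => //; [lra|rewrite le_max h1].
- have -> : centered v + 'i * v + v * t%:C = square_pt (centered v) v t 1 by rewrite /square_pt
  rmorph1 mulr1 addrAC.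
  rewrite centered_pt.
  by apply: side => //; [lra|rewrite le_max h1 orbT].
- have -> : centered v + 'i * v * t%:C = square_pt (centered v) v 0 t by rewrite /square_pt
  rmorph0 mulr0 addr0.
  rewrite centered_pt.
  by apply: side => //; [lra|rewrite le_max h0].
Qed.

Lemma subsquare_centered v : subsquare (centered v) v 1 1 = centered (v / 3).
Proof.
rewrite /subsquare /centered (_ : nat_of_ord 1 = 1%N)//.
by field.
Qed.

(** The eight outer pieces of the subdivision avoid [0], so [goursat] makes each of their sums at
    most [e / 8]; only the central piece remains. *)
Lemma goursat_center_step g v : v != 0 ->
  (forall z, z != 0 -> nr z <= nr v -> exists a, has_deriv g z a) ->
  forall e : R, 0 < e -> exists n0, forall n, (n0 <= n)%N ->
    nr (square_sum g (centered v) v (3 * 3 ^ n)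
        - square_sum g (centered (v / 3)) (v / 3) (3 ^ n)) <= e.
Proof.
move=> v0 dg e e0.
have nv0 : 0 < nr v by rewrite lt_def nr_eq0 v0 nr_ge0.
have n3 : nr (3 : C) = 3 by rewrite -(rmorph_nat (real_complex R)) nr_real ger0_norm.
have gd (ab : 'I_3 * 'I_3) : exists n0, ab != (1, 1) -> forall n, (n0 <= n)%N ->
    nr (square_sum g (subsquare (centered v) v ab.1 ab.2) (v / 3) (3 ^ n)) <= e / 8.
  have [->|ab1] := eqVneq ab (1, 1); first by exists 0%N.
  have e8 : 0 < e / 8 / nr (v / 3) ^+ 2.
    by rewrite !divr_gt0// exprn_gt0// nrM nrV n3 divr_gt0.
  case: (@goursat _ g (subsquare (centered v) v ab.1 ab.2) (v / 3) _ e8).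
    move=> x y x01 y01.
    have -> : subsquare (centered v) v ab.1 ab.2 = subsquare (square_pt (centered v) v 0 0) (v
      / 3 ^+ 0) ab.1 ab.2.
      by rewrite /square_pt !mulr0 !addr0 expr0 divr1.
    rewrite subsquare_pt expr1 (_ : v / 3 = v * (3^-1)%:C); last first.
      by rewrite fmorphV rmorph_nat.
    rewrite square_pt_pt centered_pt !add0r ![3^-1 * _]mulrC -!mulrDl.
    set X := _ / _ - _; set Y := _ / _ - _.
    case: ab ab1 @X @Y => [a b] /= ab1.
    have le2 (c : 'I_3) : c%:R <= 2 :> R by rewrite ler_nat -ltnS.
    have ge0 (c : 'I_3) : 0 <= c%:R :> R by [].
    have hX : `|(a%:R + x) / 3 - 2^-1| <= 2^-1.
      by rewrite ler_norml; have := le2 a; have := ge0 a; lra.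
    have hY : `|(b%:R + y) / 3 - 2^-1| <= 2^-1.
      by rewrite ler_norml; have := le2 b; have := ge0 b; lra.
    apply: dg; last first.
      by rewrite (le_trans (nr_square_pt _ _ _))// ler_piMr//; lra.
    have -> (s t : R) : square_pt 0 v s t = v * (s%:C + 'i * t%:C).
      by rewrite /square_pt; ring.
    rewrite mulf_neq0// rect_complex eq_complex /=; apply: contra ab1.
    move=> /andP[/eqP a1 /eqP b1].
    (* Of the three thirds of the unit interval only the middle one contains [2^-1], so an outer
       piece cannot contain [0]. *)
    suff H (c : 'I_3) (t : R) : 0 <= t <= 1 -> (c%:R + t) / 3 - 2^-1 = 0 -> c = 1.
      by rewrite (H _ _ _ a1)// (H _ _ _ b1).
    case: c => -[|[|[|//]]] i /= t01; last 2 first.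
    - by move=> _; apply: val_inj.
    - by move=> tt; exfalso; lra.
    - by move=> tt; exfalso; lra.
  move=> n0 n0P; exists n0 => _ n /n0P.
  by rewrite divfK// expf_neq0// nr_eq0 mulf_neq0// invr_neq0.
have [N NP] := choice gd.
exists (\max_ab N ab) => n nN.
rewrite square_sum_split pair_big /= (bigD1 (1, 1))//= subsquare_centered.
rewrite addrAC subrr add0r (le_trans (nr_sum _ _ _))//.
have -> : e = \sum_(i : 'I_3 * 'I_3 | i != (1, 1)) e / 8.
  rewrite (eq_bigl [in predC1 (1, 1)]); last by move=> i; rewrite !inE.
  by rewrite sumr_const cardC1 card_prod card_ord -[LHS](divfK (x := 8)) ?pnatr_eq0// mulr_natr.
apply: ler_sum => ab ab1; apply: NP => //; apply: leq_trans nN.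
exact: (leq_bigmax ab).
Qed.

(** Up to a small error, the sum equals the one over the concentric square shrunk by [3 ^+ k], with
    [3 ^ k] times fewer nodes per side. There [nr (g z)] is at most a small multiple of the inverse
    of the side, so the singularity contributes nothing in the limit. *)
Lemma goursat_center g v : v != 0 ->
  (forall z, z != 0 -> nr z <= nr v -> exists a, has_deriv g z a) ->
  (forall e : R, 0 < e -> exists2 d : R, 0 < d &
     forall z, z != 0 -> nr z < d -> nr z * nr (g z) <= e) ->
  forall e : R, 0 < e -> exists n0, forall n, (n0 <= n)%N ->
    nr (square_sum g (centered v) v (3 ^ n)) <= e.
Proof.
move=> v0 dg g0 e e0.
have nv0 : 0 < nr v by rewrite lt_def nr_eq0 v0 nr_ge0.
have nvk k : nr (v / 3 ^+ k) = nr v / 3 ^+ k.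
  have -> : 3 ^+ k = (3 ^+ k)%:C :> C by rewrite rmorphXn /= rmorph_nat.
  by rewrite nrM nrV nr_real ger0_norm// exprn_ge0.
have shrink k : forall e, 0 < e -> exists n0, forall n, (n0 <= n)%N ->
    nr (square_sum g (centered v) v (3 ^ (n + k))
        - square_sum g (centered (v / 3 ^+ k)) (v / 3 ^+ k) (3 ^ n)) <= e.
  elim: k => [|k ih] e1 e10.
    by exists 0%N => n _; rewrite addn0 expr0 divr1 subrr nr0 ltW.
  have e12 : 0 < e1 / 2 by rewrite divr_gt0.
  have [n1 n1P] := ih _ e12.
  have vk0 : v / 3 ^+ k != 0 by rewrite mulf_neq0// invr_neq0// expf_neq0// pnatr_eq0.
  have dgk z : z != 0 -> nr z <= nr (v / 3 ^+ k) -> exists a, has_deriv g z a.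
    move=> z0 zv; apply: dg => //; rewrite (le_trans zv)// nvk ler_pdivrMr ?exprn_gt0//
      ler_peMr ?(ltW nv0)//.
    by rewrite exprn_ege1// ler1n.
  have [n2 n2P] := goursat_center_step vk0 dgk e12.
  exists (maxn n1 n2) => n; rewrite geq_max => /andP[nn1 nn2].
  have /n1P h1 : (n1 <= n.+1)%N by exact: leqW.
  have h2 := n2P _ nn2.
  rewrite addnS -addSn.
  apply: le_trans (ler_nr_tri _ (square_sum g (centered (v / 3 ^+ k)) (v / 3 ^+ k) (3 ^ n.+1))
    _) _.
  have -> : e1 = e1 / 2 + e1 / 2 by field.
  apply: lerD => //; rewrite expnS.
  have -> : v / 3 ^+ k.+1 = v / 3 ^+ k / 3 by rewrite exprSr invfM mulrA.
  exact: h2.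
(* On the small square of side [w], [nr z >= nr w / 2] turns [e / 16] into
   [nr (g z) <= e / 8 / nr w], and the four sides make [e / 2]. *)
have [d d0 dP] := g0 (e / 16) (divr_gt0 e0 (ltr0n _ 16)).
have [k kd] := exists_div_exp3_lt (nr v) d0.
have [n0 n0P] := shrink k (e / 2) (divr_gt0 e0 (ltr0n _ 2)).
exists (n0 + k)%N => n nk.
have kn : (k <= n)%N by rewrite (leq_trans _ nk)// leq_addl.
rewrite -(subnK kn).
have nn0 : (n0 <= n - k)%N by rewrite leq_subRL// addnC.
set w := v / 3 ^+ k.
have w0 : 0 < nr w by rewrite nvk divr_gt0// exprn_gt0.
have w00 : w != 0 by rewrite -nr_eq0 gt_eqF.
have := ler_nr_tri (square_sum g (centered v) v (3 ^ (n - k + k))) (square_sum g (centered w) w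
  (3 ^ (n - k))) 0.
rewrite !subr0 => /le_trans; apply.
have -> : e = e / 2 + e / 2 by field.
apply: lerD; first exact: n0P.
have -> : e / 2 = 4 * (e / 8 / nr w) * nr w by field; rewrite gt_eqF.
apply: square_sum_centered_le => [|z z1 z2]; first by rewrite !divr_ge0// ltW.
have zd : nr z < d by rewrite (le_lt_trans z2)// nvk.
have zn0 : z != 0 by rewrite -nr_eq0 gt_eqF//; lra.
have zg := dP z zn0 zd; rewrite ler_pdivlMr//.
have : nr w / 2 * nr (g z) <= nr z * nr (g z) by rewrite ler_wpM2r// nr_ge0.
lra.
Qed.

End Cauchy.

(** * Sums of [1 / z] and [1 / z ^ 2], and the estimate of the derivative *)

Section CauchyEstimate.
Context {R : realType}.
Local Notation C := R[i].
Implicit Types (g h f : C -> C) (p v z a w : C).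

Lemma mulCii : 'i * 'i = -1 :> C.
Proof. by rewrite -expr2 sqrCi. Qed.

(* The quarter turn permutes the sides of a centred square. *)
Lemma square_sum_centered g v m (c : C) : (forall z, g ('i * z) * 'i = c * g z) ->
  square_sum g (centered v) v m =
  (1 + c + c * c + c * (c * c)) * seg_sum g (centered v) v m.
Proof.
move=> gi.
have rot p u : seg_sum g ('i * p) ('i * u) m = c * seg_sum g p u m.
  rewrite /seg_sum mulr_sumr; apply: eq_bigr => k _.
  set X := (_ / m%:R); have -> : 'i * p + 'i * u * X = 'i * (p + u * X) by ring.
  have -> : 'i * u / m%:R = 'i * (u / m%:R) by rewrite mulrA.
  by rewrite [LHS]mulrA gi -[LHS]mulrA.
rewrite /square_sum.
have -> : centered v + v = 'i * centered v.
  have -> : 'i * centered v = - ('i + 'i * 'i) / 2 * v by rewrite /centered; ring.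
  by rewrite mulCii /centered; field.
rewrite rot.
have -> : 'i * centered v + 'i * v = 'i * ('i * centered v).
  rewrite -mulrDr; congr (_ * _).
  have -> : 'i * centered v = - ('i + 'i * 'i) / 2 * v by rewrite /centered; ring.
  by rewrite mulCii /centered; field.
have -> : - v = 'i * ('i * v) by rewrite mulrA mulCii mulN1r.
rewrite !rot.
have -> : centered v + 'i * v = 'i * ('i * ('i * centered v)).
  rewrite 2!mulrA mulCii /centered.
  have -> : -1 * 'i * (- (1 + 'i) / 2 * v) = ('i + 'i * 'i) / 2 * v by ring.
  by rewrite mulCii; field.
have -> : - ('i * v) = 'i * ('i * ('i * v)) by rewrite 2!mulrA mulCii; ring.
by rewrite !rot; ring.
Qed.

(** The quarter turn acts by [c = - 'i], and [1 + c + c ^ 2 + c ^ 3 = 0] for a fourth root of unity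
    other than [1]. *)
Lemma square_sum_invsqr v m : square_sum (fun z => z^-1 ^+ 2) (centered v) v m = 0.
Proof.
rewrite (@square_sum_centered _ _ _ (- 'i)); last first.
  by move=> z; rewrite invfM exprMn expr2 invCi; have := mulCii => E; rewrite mulrNN E; ring.
rewrite !mulrN !mulNr !opprK mulCii; ring.
Qed.

(* Here [4] replaces [2 pi]: each side contributes at least [1] to the imaginary part. *)
Lemma square_sum_inv v m : v != 0 -> (0 < m)%N ->
  4 <= nr (square_sum (fun z => z^-1) (centered v) v m).
Proof.
move=> v0 m0.
have mU : m%:R != 0 :> R by rewrite pnatr_eq0 -lt0n.
have mU0 : 0 < m%:R :> R by rewrite ltr0n.
rewrite (@square_sum_centered _ _ _ 1); last first.
  by move=> z; rewrite invfM mulrAC mulVf ?neq0Ci// mul1r.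
have -> : (1 + 1 + 1 * 1 + 1 * (1 * 1) : C) = (4 : R)%:C by rewrite rmorph_nat; ring.
rewrite nrM nr_real ger0_norm// -[leLHS]mulr1 ler_wpM2l//.
have -> : seg_sum (fun z => z^-1) (centered v) v m =
    seg_sum (fun z => z^-1) (- (1 + 'i) / 2) 1 m.
  apply: eq_bigr => k _; rewrite /centered.
  have -> : - (1 + 'i) / 2 * v + v * ((k%:R + 2^-1) / m%:R) =
    v * (- (1 + 'i) / 2 + 1 * ((k%:R + 2^-1) / m%:R)) by ring.
  by rewrite invfM mulrACA mulVf// !mul1r.
apply: le_trans (Im_le_nr _); rewrite /seg_sum raddf_sum.
rewrite ler_normr; apply/orP; left.
have -> : 1 = \sum_(0 <= k < m) m%:R^-1 :> R.
  by rewrite big_const_nat subn0 iter_addr addr0 -(mulr_natr m%:R^-1) mulVf.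
apply: ler_sum_nat => k /andP[_ km] /=.
(* A node of the lower side of the unit square is [s - 'i / 2]. The imaginary part of its inverse is
   [2^-1 / (s ^+ 2 + 4^-1)], at least [1] because [s ^+ 2 <= 4^-1]. *)
set s : R := (k%:R + 2^-1) / m%:R - 2^-1.
have s12 : - 2^-1 <= s <= 2^-1.
  have : 0 <= (k%:R + 2^-1) / m%:R :> R by rewrite divr_ge0 ?ltW// addr_ge0.
  have : (k%:R + 2^-1) / m%:R <= 1 :> R.
    rewrite ler_pdivrMr// mul1r.
    have : (k.+1%:R <= m%:R :> R) by rewrite ler_nat.
    by rewrite -natr1; lra.
  by rewrite /s; lra.
have -> : - (1 + 'i) / 2 + 1 * ((k%:R + 2^-1) / m%:R) = s%:C + 'i * (- 2^-1)%:C :> C.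
  by rewrite /s !(rmorphB, rmorphD, rmorphM, fmorphV, rmorphN, rmorph_nat) /=; field; rewrite
    pnatr_eq0 -lt0n.
have q0 : 0 < s ^+ 2 + 4^-1 by rewrite ltr_wpDl ?sqr_ge0.
have -> : (s%:C + 'i * (- 2^-1)%:C)^-1 * (1 / m%:R) =
    (s / (s ^+ 2 + 4^-1) / m%:R)%:C + 'i * (2^-1 / (s ^+ 2 + 4^-1) / m%:R)%:C :> C.
  have sn0 : s%:C + 'i * (- 2^-1)%:C != 0.
    by rewrite rect_complex eq_complex /= negb_and oppr_eq0 invr_eq0 (eqr_nat R 2 0) orbT.
  apply: (mulfI sn0); rewrite mulVKf//.
  have -> : (s%:C + 'i * (- 2^-1)%:C) * ((s / (s ^+ 2 + 4^-1) / m%:R)%:C + 'i * (2^-1 / (s ^+ 2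
    + 4^-1) / m%:R)%:C) =
     (s%:C * (s / (s ^+ 2 + 4^-1) / m%:R)%:C - 'i * 'i * (2^-1)%:C * (2^-1 / (s ^+ 2 + 4^-1) /
       m%:R)%:C)
     + 'i * (s%:C * (2^-1 / (s ^+ 2 + 4^-1) / m%:R)%:C - (2^-1)%:C * (s / (s ^+ 2 + 4^-1) /
       m%:R)%:C) :> C.
    by rewrite rmorphN; ring.
  rewrite mulCii -!rmorphM -rmorphB.
  have -> : s * (2^-1 / (s ^+ 2 + 4^-1) / m%:R) - 2^-1 * (s / (s ^+ 2 + 4^-1) / m%:R) = 0 by ring.
  rewrite rmorph0 mulr0 addr0 mulN1r mulNr opprK -rmorphM -rmorphD.
  have -> : s * (s / (s ^+ 2 + 4^-1) / m%:R) + 2^-1 * (2^-1 / (s ^+ 2 + 4^-1) / m%:R) = m%:R^-1.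
    by field; rewrite mU /=; apply/eqP; nra.
  by rewrite fmorphV rmorph_nat div1r.
rewrite rect_complex /= ler_peMl ?invr_ge0 ?(ltW mU0)//.
rewrite ler_pdivlMr// mul1r; nra.
Qed.

(** Up to an arbitrarily small error, [a] is the quotient of the sums of [f z / z ^ 2] and [1 / z]
    over a square of side [r / 2]. There [nr z >= r / 4], so the first sum is at most [4 * (16 * M /
    r ^ 2) * (r / 2) = 32 * M / r]; the second is at least [4]. *)
Lemma cauchy_estimate f (r M : R) a : 0 < r ->
  (forall z, nr z < r -> exists a, has_deriv f z a) ->
  (forall z, nr z < r -> nr (f z) <= M) -> has_deriv f 0 a ->
  nr a <= 8 * M / r.
Proof.
move=> r0 df fM f0.
have M0 : 0 <= M by rewrite (le_trans (nr_ge0 (f 0)))// fM// nr0.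
set v : C := (r / 2)%:C.
have nv : nr v = r / 2 by rewrite nr_real ger0_norm// divr_ge0// ltW.
have v0 : v != 0 by rewrite -nr_eq0 nv gt_eqF// divr_gt0.
(* [goursat_center] applies to [g], and [z^-2] has zero sum: what remains of
   the sum of [f z / z ^ 2] is [a] times the sum of [1 / z]. *)
pose g z := (f z - f 0 - a * z) / z / z.
(* At [z = 0] both sides are [0], by the convention [0^-1 = 0]. *)
have gE z : g z = f z * z^-1 ^+ 2 - f 0 * z^-1 ^+ 2 - a * z^-1.
  rewrite /g; have [->|z0] := eqVneq z 0; first by rewrite invr0 expr0n /= !mulr0 subrr subr0.
  by field.
suff H (e : R) : 0 < e -> 4 * nr a <= 32 * M / r + e.
  have : 4 * nr a <= 32 * M / r by apply/ler_addgt0Pr => e; exact: H.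
  by lra.
move=> e0.
have [||n0 /(_ n0 (leqnn _))] := @goursat_center _ g v v0 _ _ _ e0.
- move=> z z0 zv; have [|b fb] := df z; first by rewrite (le_lt_trans zv)// nv; lra.
  rewrite /g; eexists; apply: has_deriv_div => //; apply: has_deriv_div => //.
  exact: has_deriv_subaffine fb.
- move=> e1 e10; have [d d0 dP] := f0 _ e10; exists d => // z z0 zd.
  have := dP z; rewrite subr0 => /(_ zd).
  have nz0 : 0 < nr z by rewrite lt_def nr_eq0 z0 nr_ge0.
  rewrite /g 2!nrM nrV; set A := nr (_ - _ - _).
  have -> : nr z * (A / nr z / nr z) = A / nr z by field; rewrite gt_eqF.
  by rewrite ler_pdivrMr.
set m := (3 ^ n0)%N.
have m0 : (0 < m)%N by rewrite expn_gt0.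
have -> : g = fun z => f z * z^-1 ^+ 2 - f 0 * z^-1 ^+ 2 - a * z^-1 by apply/funext.
rewrite !square_sumB !square_sumZ square_sum_invsqr mulr0 subr0 => ge.
have h1 := square_sum_inv v0 m0.
set S1 := square_sum (fun z => f z * _) _ _ _ in ge.
set S2 := square_sum _ _ _ _ in ge h1.
have h2 : nr S1 <= 32 * M / r.
  have -> : 32 * M / r = 4 * (16 * M / r ^+ 2) * nr v.
    by rewrite nv; field; rewrite gt_eqF.
  apply: square_sum_centered_le => [|z]; first by rewrite divr_ge0 ?sqr_ge0// mulr_ge0.
  rewrite nv => z1 z2; rewrite nrM nrX nrV.
  have nz0 : 0 < nr z by lra.
  rewrite exprVn ler_pdivrMr ?exprn_gt0// (le_trans (fM _ _))//; first by lra.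
  rewrite mulrAC ler_pdivlMr ?exprn_gt0//.
  have : r ^+ 2 <= 16 * nr z ^+ 2 by nra.
  nra.
have : nr (a * S2) <= nr S1 + nr (S1 - a * S2).
  by have := ler_nrB S1 (S1 - a * S2); rewrite opprB addrC subrK.
rewrite nrM; have : nr a * 4 <= nr a * nr S2 by rewrite ler_wpM2l// nr_ge0.
lra.
Qed.

End CauchyEstimate.

(** * Bounded holomorphic maps *)

Section NormRow.
Context {R : realType}.
Implicit Types n m : nat.

Lemma nr_coord_le n (x : 'rV[R[i]]_n) j : nr (x 0 j) <= nr x.
Proof.
have : `|x 0 j| <= mx_norm x.
  by rewrite -[leLHS]nngE num_le; apply: (le_bigmax _ (fun ij => `|x ij.1 ij.2|%:nng) (0, j)).
by rewrite -[mx_norm x]/`|x| !nrE lecR.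
Qed.

Lemma nr_row_le n (x : 'rV[R[i]]_n) (M : R) : 0 <= M ->
  (forall j, nr (x 0 j) <= M) -> nr x <= M.
Proof.
move=> M0 xM; have [x0|] := eqVneq (mx_norm x) 0.
  by rewrite (_ : x = 0) ?nr0//; exact: mx_norm_eq0.
move=> /mx_norm_neq0[[i j] /=]; rewrite (ord1 i) => xij.
by rewrite /nr [`|x|]xij; exact: xM.
Qed.

Lemma nr_row_lt n (x : 'rV[R[i]]_n) (M : R) : 0 < M ->
  (forall j, nr (x 0 j) < M) -> nr x < M.
Proof.
move=> M0 xM; have [x0|] := eqVneq (mx_norm x) 0.
  by rewrite (_ : x = 0) ?nr0//; exact: mx_norm_eq0.
move=> /mx_norm_neq0[[i j] /=]; rewrite (ord1 i) => xij.
by rewrite /nr [`|x|]xij; exact: xM.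
Qed.

Lemma nr_pair (V W : normedModType R[i]) (x : V) (y : W) :
  nr ((x, y) : V * W) = Num.max (nr x) (nr y).
Proof.
rewrite /nr prod_normE /= !nrE; have [xy|yx] := leP (nr x) (nr y).
- by rewrite max_r ?lecR.
- by rewrite max_l// lecR ltW.
Qed.

Lemma nr_mulmx_le n m (A : 'M[R[i]]_(n, m)) : exists2 K : R, 0 < K &
  forall x : 'rV[R[i]]_n, nr (x *m A) <= K * nr x.
Proof.
exists (1 + \sum_i \sum_j nr (A i j)) => [|x].
  by rewrite ltr_pwDl// sumr_ge0// => i _; rewrite sumr_ge0// => j _; rewrite nr_ge0.
set S := \sum_i _.
have S0 : 0 <= S by rewrite sumr_ge0// => i _; rewrite sumr_ge0// => j _; rewrite nr_ge0.
apply: nr_row_le => [|j]; first by rewrite mulr_ge0 ?nr_ge0// addr_ge0.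
rewrite mxE (le_trans (nr_sum _ _ _))// mulrDl mul1r.
apply: (@le_trans _ _ (S * nr x)); last by rewrite lerDr nr_ge0.
rewrite mulr_suml; apply: ler_sum => i _; rewrite nrM mulrC.
rewrite ler_pM ?nr_ge0 ?nr_coord_le// (bigD1 j)//= lerDl sumr_ge0// => k _.
exact: nr_ge0.
Qed.

End NormRow.

(** * Derivatives along complex lines and the mean value inequality *)

Section Differentiability.
Context {R : realType}.

(* Of the linearity of [L], only homogeneity is needed to restrict [f] to lines. *)
Definition fderiv (V W : normedModType R[i]) (f : V -> W) z (L : V -> W) :=
  (forall t h, L (t *: h) = t *: L h) /\
  forall e : R, 0 < e -> exists2 d : R, 0 < d &
    forall h, nr h < d -> nr (f (z + h) - f z - L h) <= e * nr h.

Lemma differentiable_fderiv (V W : normedModType R[i]) (f : V -> W) z :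
  differentiable f z -> fderiv f z ('d f z).
Proof.
move=> df; split=> [t h|e e0]; first by rewrite linearZ.
have /eqaddoP H := diff_locally df.
have e0' : (0 : R[i]) < e%:C by rewrite ltcR.
have /nbhs_nr[d d0 dP] := H _ e0'.
exists d => // h hd; have := dP h; rewrite subr0 => /(_ hd) /=.
have -> : (f \o shift z - (cst (f z) + 'd f z)) h = f (z + h) - f z - 'd f z h.
  by rewrite [z + h]addrC -addrA -opprD.
by rewrite !nrE -rmorphM lecR.
Qed.

Lemma fderiv_differentiable (V W : normedModType R[i]) (f : V -> W) z
  (L : {linear V -> W}) : continuous L -> fderiv f z L -> differentiable f z.
Proof.
move=> cL [_ LP].
have E : f \o shift z = cst (f z) + L +o_ 0 id.
  apply/eqaddoE/eqaddoP => e e0.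
  have eE : e = (complex.Re e)%:C.
    by move: e0; rewrite ltcE; case: (e) => a b /= /andP[/eqP -> _].
  have [|d d0 dP] := LP (complex.Re e); first by rewrite -ltcR -eE.
  apply/nbhs_nr; exists d => // h; rewrite subr0 => /dP /=.
  have -> : (f \o shift z - (cst (f z) + L)) h = f (z + h) - f z - L h.
    by rewrite [z + h]addrC -addrA -opprD.
  by rewrite !nrE eE -rmorphM lecR.
by apply/diff_locallyP; rewrite (diff_unique cL E).
Qed.

Lemma mulmxr_continuous n m (A : 'M[R[i]]_(n, m)) :
  continuous (mulmxr A : 'rV[R[i]]_n -> 'rV[R[i]]_m).
Proof.
move=> x; apply/(@cvg_nr _ _ _ (nbhs x) (nbhs_filter x)) => e e0; have [K K0 KP] := nr_mulmx_le A.
apply/nbhs_nr; exists (e / K) => [|y]; first exact: divr_gt0.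
by rewrite ltr_pdivlMr// mulrC /= -mulmxBl; exact: le_lt_trans.
Qed.

Lemma differentiable_mulmxr n m (A : 'M[R[i]]_(n, m)) (x : 'rV[R[i]]_n) :
  differentiable (fun y : 'rV[R[i]]_n => y *m A) x.
Proof.
exact: (@linear_differentiable _ _ _ (mulmxr A) x (@mulmxr_continuous n m A)).
Qed.

Lemma fderiv_mulmx_differentiable n m (f : 'rV[R[i]]_n -> 'rV[R[i]]_m) z
  (A : 'M[R[i]]_(n, m)) : fderiv f z (mulmx^~ A) -> differentiable f z.
Proof.
exact: (@fderiv_differentiable _ _ _ _ (mulmxr A) (@mulmxr_continuous n m A)).
Qed.

Lemma differentiable_row_mx (V : normedModType R[i]) n m (f : V -> 'rV[R[i]]_n)
  (g : V -> 'rV[R[i]]_m) z : differentiable f z -> differentiable g z ->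
  differentiable (fun x => row_mx (f x) (g x)) z.
Proof.
move=> df dg.
have -> : (fun x => row_mx (f x) (g x)) =
    (fun x => f x *m row_mx 1%:M 0) + (fun x => g x *m row_mx 0 1%:M).
  apply/funext => x.
  have : f x *m row_mx 1%:M 0 + g x *m row_mx 0 1%:M = row_mx (f x) (g x).
    by rewrite !mul_mx_row !mulmx1 !mulmx0 add_row_mx addr0 add0r.
  by move/esym.
apply: differentiableD.
- exact: (differentiable_comp df (differentiable_mulmxr _ _)).
- exact: (differentiable_comp dg (differentiable_mulmxr _ _)).
Qed.

Lemma differentiable_row (V : normedModType R[i]) n (f : 'I_n -> V -> R[i]) z :
  (forall j, differentiable (f j) z) -> differentiable (fun x => \row_j f j x) z.
Proof.
move=> df.
have -> : (fun x => \row_j f j x) = \sum_j (fun x => f j x *: (delta_mx 0 j : 'rV[R[i]]_n)).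
  apply/funext => x; rewrite fct_sumE [LHS]row_sum_delta.
  by apply: eq_bigr => j _; rewrite mxE.
by apply: differentiable_sum => j; apply: differentiableZl.
Qed.

Lemma differentiable_coordf (V : normedModType R[i]) n (f : V -> 'rV[R[i]]_n) z j :
  differentiable f z -> differentiable (fun x => f x 0 j) z.
Proof.
move=> df.
exact: (differentiable_comp df (@differentiable_coord _ _ _ (f z) 0 j)).
Qed.

Lemma fderiv_coord (V : normedModType R[i]) n (f : V -> 'rV[R[i]]_n) z L j :
  fderiv f z L -> fderiv (fun x => f x 0 j) z (fun h => L h 0 j).
Proof.
move=> [Lh Le]; split=> [t h|e /Le[d d0 dP]]; first by rewrite Lh mxE.
exists d => // h /dP; apply: le_trans.
by have := nr_coord_le (f (z + h) - f z - L h) j; rewrite !mxE.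
Qed.

Lemma fderiv_line (V : normedModType R[i]) (f : V -> R[i]) z v (s : R[i]) L :
  fderiv f (z + s *: v) L -> has_deriv (fun t => f (z + t *: v)) s (L v).
Proof.
move=> [Lh Le] e e0; have [->|v0] := eqVneq v 0.
  have L0 : L 0 = 0 by rewrite -(scale0r (0 : V)) Lh [LHS]mul0r.
  exists 1 => // w _; rewrite !scaler0 subrr sub0r L0 mul0r oppr0 nr0.
  by rewrite mulr_ge0 ?nr_ge0// ltW.
have nv0 : 0 < nr v by rewrite lt_def nr_eq0 v0 nr_ge0.
have [d d0 dP] := Le (e / nr v) (divr_gt0 e0 nv0).
exists (d / nr v) => [|w]; first exact: divr_gt0.
rewrite ltr_pdivlMr// -nrZ => /dP; rewrite nrZ Lh.
have -> : z + s *: v + (w - s) *: v = z + w *: v by rewrite -addrA -scalerDl [s + _]addrCA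
  subrr addr0.
rewrite [(w - s) *: L v]mulrC => /le_trans; apply.
by rewrite mulrCA divfK ?gt_eqF// mulrC.
Qed.

(** Trisection as in Goursat's argument: an interval on which the bound with [M + e] fails has a
    third with the same defect. The nested bad intervals shrink to a point [t] that all of them
    contain, and the estimates at [t] towards both ends add up to the bound that was supposed to
    fail. *)
Lemma mean_value_le (W : normedModType R[i]) (G : R -> W) (M : R) :
  (forall t e, 0 <= t <= 1 -> 0 < e -> exists2 d : R, 0 < d & forall s, 0 <= s <= 1 ->
     `|s - t| < d -> nr (G s - G t) <= (M + e) * `|s - t|) ->
  nr (G 1 - G 0) <= M.
Proof.
move=> dG; apply/ler_addgt0Pr => e e0.
pose good x l := nr (G (x + l) - G x) <= (M + e) * l.
suff : good 0 1 by rewrite /good add0r mulr1.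
apply: contrapT => bad0.
have split3 x l : (forall a : 'I_3, good (x + a%:R * (l / 3)) (l / 3)) -> good x l.
  move=> gd; have := gd 0; have := gd 1; have := gd 2; rewrite /good.
  rewrite (_ : nat_of_ord 2 = 2%N)// (_ : nat_of_ord 1 = 1%N)// (_ : nat_of_ord 0 = 0%N)//.
  rewrite mul0r addr0 mul1r.
  have -> : x + 2 * (l / 3) + l / 3 = x + l by field.
  have -> : x + l / 3 + l / 3 = x + 2 * (l / 3) by field.
  move=> h2 h1 h0.
  have := ler_nr_tri (G (x + l)) (G (x + 2 * (l / 3))) (G x).
  have := ler_nr_tri (G (x + 2 * (l / 3))) (G (x + l / 3)) (G x).
  lra.
pose bad k (x : R) := ~ good x (3 ^+ k)^-1.
have step (kx : nat * R) : exists a : 'I_3, bad kx.1 kx.2 ->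
    bad kx.1.+1 (kx.2 + a%:R / 3 ^+ kx.1.+1).
  case: kx => k x /=; apply: contrapT => na.
  have bx : bad k x by apply: contrapT => nb; apply: na; exists 0 => /nb.
  apply: bx; apply: split3 => a.
  have -> : (3 ^+ k)^-1 / 3 = (3 ^+ k.+1)^-1 :> R by rewrite exprSr invfM mulrC.
  by apply: contrapT => ba; apply: na; exists a.
have [F FP] := choice step.
pose S := fix S k : R := if k is k'.+1 then S k' + (F (k', S k'))%:R / 3 ^+ k else 0.
have badS k : bad k (S k).
  elim: k => [|k /(FP (k, S k))//]; rewrite /bad /= expr0 invr1; exact: bad0.
have l0 k : 0 < (3 ^+ k)^-1 :> R by rewrite invr_gt0 exprn_gt0.
have l3 k : (3 ^+ k)^-1 = (3 ^+ k.+1)^-1 *+ 3 :> R.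
  by rewrite exprS -mulr_natr; field; rewrite expf_neq0.
have le2 (a : 'I_3) : a%:R <= 2 :> R by rewrite ler_nat -ltnS.
have [t tP] : exists t, forall k, S k <= t <= S k + (3 ^+ k)^-1.
  apply: nested_intervals => k; first exact: ltW.
    by rewrite /= lerDl divr_ge0// exprn_ge0.
  rewrite [leLHS]/= (l3 k) -addrA lerD2l (mulrSr (3 ^- k.+1) 2) lerD2r.
  by rewrite -(mulr_natl (3 ^- k.+1)) ler_wpM2r// ltW.
have S01 k : 0 <= S k /\ S k + (3 ^+ k)^-1 <= 1.
  elim: k => [|k [ih1 ih2]]; first by rewrite /= expr0 invr1 add0r !lexx.
  split; first by rewrite /= addr_ge0// divr_ge0// exprn_ge0.
  apply: le_trans ih2.
  rewrite [leLHS]/= (l3 k) -addrA lerD2l (mulrSr (3 ^- k.+1) 2) lerD2r.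
  by rewrite -(mulr_natl (3 ^- k.+1)) ler_wpM2r// ltW.
have t01 : 0 <= t <= 1.
  by have := tP 0%N; rewrite /= expr0 invr1 add0r.
have [d d0 dP] := dG t e t01 e0.
have [k kd] := exists_div_exp3_lt 1 d0.
apply: (badS k); rewrite /good.
have [S0 S1] := S01 k; have /andP[t1 t2] := tP k; have lk := l0 k.
move: kd; rewrite mul1r; set l := 3 ^- k in lk t2 S1 *.
move=> ld.
have E1 : `|S k + l - t| = S k + l - t by rewrite ger0_norm// subr_ge0.
have E2 : `|S k - t| = t - S k by rewrite ler0_norm ?opprB// subr_le0.
have := dP (S k + l); rewrite E1 => h1.
have := dP (S k); rewrite E2 => h2.
have {h1} : nr (G (S k + l) - G t) <= (M + e) * (S k + l - t) by apply: h1; lra.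
have {h2} : nr (G (S k) - G t) <= (M + e) * (t - S k) by apply: h2; lra.
rewrite nrB.
have := ler_nr_tri (G (S k + l)) (G t) (G (S k)).
lra.
Qed.

End Differentiability.

(** * Lipschitz and Taylor bounds with uniform constants *)

Section BoundedHolomorphic.
Context {R : realType}.

Definition bounded_hol (V W : normedModType R[i]) (f : V -> W) z0 (r M : R) :=
  forall z, nr (z - z0) < r -> differentiable f z /\ nr (f z) <= M.

Lemma nr_convex (V : normedModType R[i]) (x y z : V) (t r : R) :
  0 <= t <= 1 -> nr (x - z) < r -> nr (y - z) < r ->
  nr (y + t%:C *: (x - y) - z) < r.
Proof.
move=> /andP[t0 t1] xr yr.
have -> : y + t%:C *: (x - y) - z = t%:C *: (x - z) + (1 - t)%:C *: (y - z).
  rewrite rmorphB rmorph1 scalerBl scale1r [RHS]addrCA -scalerBr addrAC.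
  by rewrite (opprB y z) addrA subrK.
apply: le_lt_trans (ler_nrD _ _) _.
rewrite !nrZ !nr_real !ger0_norm ?subr_ge0//.
have [t00|t00] := eqVneq t 0; first by rewrite t00; lra.
have tp : 0 < t by rewrite lt_def t00.
have : t * nr (x - z) < t * r by rewrite ltr_pM2l.
have : (1 - t) * nr (y - z) <= (1 - t) * r by rewrite ler_wpM2l ?subr_ge0// ltW.
lra.
Qed.

Section Scalar.
Variable V : normedModType R[i].
Implicit Types (f : V -> R[i]) (z : V) (r M : R).

(** This is [cauchy_estimate] on the complex line through [z0] in the direction [v], which meets the
    ball in a disc of radius [r / nr v]. *)
Lemma fderiv_bound f z0 r M L v : 0 < r -> bounded_hol f z0 r M ->
  fderiv f z0 L -> nr (L v) <= 8 * M / r * nr v.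
Proof.
move=> r0 fM fL; have [v0|v0] := eqVneq v 0.
  have -> : L v = 0 by have [Lh _] := fL; rewrite v0 -(scale0r (0 : V)) Lh [LHS]mul0r.
  by rewrite v0 !nr0 mulr0.
have nv0 : 0 < nr v by rewrite lt_def nr_eq0 v0 nr_ge0.
have inball (t : R[i]) : nr t < r / nr v -> nr (z0 + t *: v - z0) < r.
  by rewrite addrAC subrr add0r nrZ ltr_pdivlMr.
have -> : 8 * M / r * nr v = 8 * M / (r / nr v) by field; rewrite !gt_eqF.
apply: (@cauchy_estimate _ (fun t => f (z0 + t *: v))).
- exact: divr_gt0.
- move=> t /inball /fM[df _]; eexists; apply: fderiv_line.
  exact: differentiable_fderiv.
- by move=> t /inball /fM[].
- by apply: fderiv_line; rewrite scale0r addr0.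
Qed.

Lemma mean_value_line f y v (M : R) : 0 <= M ->
  (forall t : R, 0 <= t <= 1 -> exists2 L, fderiv f (y + t%:C *: v) L & nr (L v) <= M) ->
  nr (f (y + v) - f y) <= M.
Proof.
move=> M0 dL.
have := @mean_value_le R _ (fun t => f (y + t%:C *: v)) M.
rewrite rmorph1 rmorph0 scale1r scale0r addr0; apply=> t e t01 e0.
have [L [Lh Le] LM] := dL t t01.
have nv1 : 0 < nr v + 1 by rewrite ltr_wpDl ?nr_ge0.
have [d d0 dP] := Le (e / (nr v + 1)) (divr_gt0 e0 nv1).
exists (d / (nr v + 1)) => [|s s01 st]; first exact: divr_gt0.
have nst : nr ((s - t)%:C *: v) = `|s - t| * nr v by rewrite nrZ nr_real.
have := dP ((s - t)%:C *: v); rewrite nst Lh.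
have -> : y + t%:C *: v + (s - t)%:C *: v = y + s%:C *: v.
  by rewrite -addrA -scalerDl -rmorphD addrCA subrr addr0.
have std : `|s - t| * nr v < d.
  move: st; rewrite ltr_pdivlMr//; apply: le_lt_trans.
  by rewrite ler_wpM2l// lerDl.
move=> /(_ std) h1.
have h2 : nr ((s - t)%:C *: L v) <= `|s - t| * M.
  by rewrite nrZ nr_real ler_wpM2l.
have h3 : e / (nr v + 1) * (`|s - t| * nr v) <= e * `|s - t|.
  have -> : e / (nr v + 1) * (`|s - t| * nr v) = e * `|s - t| * (nr v / (nr v + 1)).
    by field; rewrite gt_eqF.
  rewrite ler_piMr//; first by rewrite mulr_ge0// ltW.
  by rewrite ler_pdivrMr// mul1r lerDl.
have := ler_nrD (f (y + s%:C *: v) - f (y + t%:C *: v) - (s - t)%:C *: L v) ((s - t)%:C *: L v).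
rewrite subrK; lra.
Qed.

(** Every point of the half ball is the centre of a ball of radius [r / 2] inside the big one, which
    doubles the constant [8] of [fderiv_bound]. *)
Lemma lipschitz_bound f z0 r M x y : 0 < r -> bounded_hol f z0 r M ->
  nr (x - z0) < r / 2 -> nr (y - z0) < r / 2 ->
  nr (f x - f y) <= 16 * M / r * nr (x - y).
Proof.
move=> r0 fM xr yr.
have M0 : 0 <= M.
  by have [|_] := fM z0; [rewrite subrr nr0|exact: le_trans (nr_ge0 _)].
have {1}-> : x = y + (x - y) by rewrite addrC subrK.
apply: mean_value_line => // [|t t01].
  by rewrite mulr_ge0 ?nr_ge0// divr_ge0 ?mulr_ge0// ltW.
have pr := nr_convex t01 xr yr; set p := y + _ in pr *.
have [|df _] := fM p; first by lra.
exists ('d f p); first exact: differentiable_fderiv.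
have -> : 16 * M / r = 8 * M / (r / 2) by field; rewrite gt_eqF.
apply: (@fderiv_bound f p); [by rewrite divr_gt0| |exact: differentiable_fderiv].
move=> z zp; apply: fM; have := ler_nr_tri z p z0; lra.
Qed.

(* Two applications of [lipschitz_bound]: to [f], then to [f (z + u) - f z]. *)
Lemma second_difference_bound f z0 r M h u : 0 < r -> bounded_hol f z0 r M ->
  nr u <= r / 8 -> nr h < r / 8 ->
  nr (f (z0 + h + u) - f (z0 + h) - (f (z0 + u) - f z0)) <=
  1024 * M / r ^+ 2 * nr u * nr h.
Proof.
move=> r0 fM ur hr.
have sub z w : z + w - z0 = (z - z0) + w by rewrite addrAC.
have E1 : nr (z0 + h - z0) = nr h by rewrite addrAC subrr add0r.
have E2 : nr (z0 - z0) = 0 by rewrite subrr nr0.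
have E3 : nr (z0 + h - z0) < r / 8 by rewrite E1.
have dg : bounded_hol (fun z => f (z + u) - f z) z0 (r / 4) (16 * M / r * nr u).
  move=> z zr.
  have zu : nr (z + u - z0) < r / 2.
    by rewrite sub (le_lt_trans (ler_nrD _ _))//; lra.
  split.
  - apply: differentiableB; last by apply: (fM z _).1; lra.
    apply: (@differentiable_comp _ _ _ _ (fun z => z + u) f).
      exact: differentiableD.
    by apply: (fM _ _).1; lra.
  - have zr2 : nr (z - z0) < r / 2 by lra.
    by have := lipschitz_bound r0 fM zu zr2; rewrite [z + u - z]addrAC subrr add0r.
have -> : 1024 * M / r ^+ 2 * nr u * nr h = 16 * (16 * M / r * nr u) / (r / 4) * nr h.
  by field; rewrite gt_eqF.
have -> : nr h = nr (z0 + h - z0) by rewrite E1.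
by apply: (lipschitz_bound _ dg); lra.
Qed.

(** The mean value inequality is applied to [f (z0 + t h) - t L h] as a function of [t]. Its
    increments are second differences of [f], which are quadratically small, plus the remainder of
    [f] at [z0] for a vector tending to [0]; so no derivative other than the one at [z0] enters. *)
Lemma taylor_bound f z0 r M L h : 0 < r -> bounded_hol f z0 r M ->
  fderiv f z0 L -> nr h < r / 8 ->
  nr (f (z0 + h) - f z0 - L h) <= 1024 * M / r ^+ 2 * nr h ^+ 2.
Proof.
move=> r0 fM [Lh Le] hr.
have := @mean_value_le R R[i] (fun t => f (z0 + t%:C *: h) - t%:C *: L h)
  (1024 * M / r ^+ 2 * nr h ^+ 2).
rewrite rmorph1 rmorph0 !scale1r !scale0r addr0 subr0 [f _ - _ - _]addrAC; apply=> t e /andP[t0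
  t1] e0.
have M0 : 0 <= M.
  by have [|_] := fM z0; [rewrite subrr nr0|exact: le_trans (nr_ge0 _)].
have h1 u v : nr u <= r / 8 -> nr v < r / 8 -> _ := fun ur vr => second_difference_bound r0 fM
  ur vr.
have K0 : 0 <= 1024 * M / r ^+ 2 := divr_ge0 (mulr_ge0 (ler0n _ _) M0) (sqr_ge0 r).
move: K0 h1; move: (1024 * M / r ^+ 2) => K K0 sd.
have nv1 : 0 < nr h + 1 by rewrite ltr_wpDl ?nr_ge0.
have [d d0 dP] := Le (e / (nr h + 1)) (divr_gt0 e0 nv1).
exists (d / (nr h + 1)) => [|s /andP[s0 s1] st]; first exact: divr_gt0.
set u := (s - t)%:C *: h.
have nu : nr u = `|s - t| * nr h by rewrite nrZ nr_real.
have nt : nr (t%:C *: h) = t * nr h by rewrite nrZ nr_real ger0_norm.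
have st1 : `|s - t| <= 1 by rewrite ler_norml; lra.
have ur : nr u <= r / 8.
  by rewrite nu (le_trans _ (ltW hr))// ler_piMl// nr_ge0.
have tr : nr (t%:C *: h) < r / 8.
  by rewrite nt (le_lt_trans _ hr)// ler_piMl// nr_ge0.
have h1 := sd _ _ ur tr.
have h2 : nr (f (z0 + u) - f z0 - L u) <= e / (nr h + 1) * nr u.
  apply: dP; move: st; rewrite ltr_pdivlMr// nu; apply: le_lt_trans.
  by rewrite ler_wpM2l// lerDl.
have h3 : e / (nr h + 1) * nr u <= e * `|s - t|.
  have -> : e / (nr h + 1) * nr u = e * `|s - t| * (nr h / (nr h + 1)).
    by rewrite nu; field; rewrite gt_eqF.
  rewrite ler_piMr//; first by rewrite mulr_ge0// ltW.
  by rewrite ler_pdivrMr// mul1r lerDl.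
have h4 : K * nr u * nr (t%:C *: h) <= K * nr h ^+ 2 * `|s - t|.
  rewrite nu nt.
  have -> : K * (`|s - t| * nr h) * (t * nr h) = t * (K * nr h ^+ 2 * `|s - t|).
    by ring.
  by rewrite ler_piMl// mulr_ge0// mulr_ge0// sqr_ge0.
have -> : f (z0 + s%:C *: h) - s%:C *: L h - (f (z0 + t%:C *: h) - t%:C *: L h) =
  (f (z0 + t%:C *: h + u) - f (z0 + t%:C *: h) - (f (z0 + u) - f z0)) + (f (z0 + u) - f z0 - L u).
  have -> : z0 + t%:C *: h + u = z0 + s%:C *: h.
    by rewrite -addrA -scalerDl -rmorphD addrCA subrr addr0.
  have -> : L u = s%:C *: L h - t%:C *: L h by rewrite Lh rmorphB scalerBl.
  ring.
apply: le_trans (ler_nrD _ _) _; lra.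
Qed.

End Scalar.

Section Row.
Variables (V : normedModType R[i]) (n : nat).
Implicit Types (f : V -> 'rV[R[i]]_n) (z : V) (r M : R).

Lemma bounded_hol_coord f z0 r M j : bounded_hol f z0 r M ->
  bounded_hol (fun z => f z 0 j) z0 r M.
Proof.
move=> fM z /fM[df fz]; split; first exact: differentiable_coordf.
exact: le_trans (nr_coord_le _ _) fz.
Qed.

Lemma bounded_hol_ge0 f z0 r M : 0 < r -> bounded_hol f z0 r M -> 0 <= M.
Proof.
move=> r0 fM.
by have [|_] := fM z0; [rewrite subrr nr0|exact: le_trans (nr_ge0 _)].
Qed.

Lemma fderiv_bound_row f z0 r M L v : 0 < r -> bounded_hol f z0 r M ->
  fderiv f z0 L -> nr (L v) <= 8 * M / r * nr v.
Proof.
move=> r0 fM fL; have M0 := bounded_hol_ge0 r0 fM.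
apply: nr_row_le => [|j]; first by rewrite mulr_ge0 ?nr_ge0// divr_ge0 ?mulr_ge0// ltW.
exact: (fderiv_bound v r0 (bounded_hol_coord j fM) (fderiv_coord j fL)).
Qed.

Lemma lipschitz_bound_row f z0 r M x y : 0 < r -> bounded_hol f z0 r M ->
  nr (x - z0) < r / 2 -> nr (y - z0) < r / 2 ->
  nr (f x - f y) <= 16 * M / r * nr (x - y).
Proof.
move=> r0 fM xr yr; have M0 := bounded_hol_ge0 r0 fM.
apply: nr_row_le => [|j]; first by rewrite mulr_ge0 ?nr_ge0// divr_ge0 ?mulr_ge0// ltW.
by have := lipschitz_bound r0 (bounded_hol_coord j fM) xr yr; rewrite !mxE.
Qed.

Lemma taylor_bound_row f z0 r M L h : 0 < r -> bounded_hol f z0 r M ->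
  fderiv f z0 L -> nr h < r / 8 ->
  nr (f (z0 + h) - f z0 - L h) <= 1024 * M / r ^+ 2 * nr h ^+ 2.
Proof.
move=> r0 fM fL hr; have M0 := bounded_hol_ge0 r0 fM.
have K0 : 0 <= 1024 * M / r ^+ 2 := divr_ge0 (mulr_ge0 (ler0n _ _) M0) (sqr_ge0 r).
apply: nr_row_le => [|j]; first exact: mulr_ge0 K0 (sqr_ge0 _).
by have := taylor_bound r0 (bounded_hol_coord j fM) (fderiv_coord j fL) hr; rewrite !mxE.
Qed.

End Row.

End BoundedHolomorphic.

(** * Ultralimits of holomorphic maps *)

Section UltraLimit.
Context {R : realType} (U : set_system nat) {UU : UltraFilter U}.

(** The limit is the supremum of the numbers below [u] on a set of [U]. The ultrafilter must choose
    between [u k <= sup S + e] and the opposite, and the opposite would put [sup S + e] into [S]. *)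
Lemma ultra_cvg_real (u : nat -> R) (M : R) : U [set k | `|u k| <= M] ->
  exists l, forall e : R, 0 < e -> U [set k | `|u k - l| <= e].
Proof.
move=> uM; pose S := [set c | U [set k | c <= u k]].
have Sub c : S c -> c <= M.
  move=> Sc; have [k [/= ck]] := filter_ex (filterI Sc uM).
  by rewrite ler_norml => /andP[_]; exact: le_trans.
have SM : S (- M).
  by apply: filterS uM => k /=; rewrite ler_norml => /andP[].
exists (sup S) => e e0.
have h1 : U [set k | sup S - e <= u k].
  have [|c Sc lc] := @sup_adherent R S e e0.
    by split; [exists (- M)|exists M].
  by apply: filterS Sc => k /=; apply: le_trans; exact: ltW.
have h2 : U [set k | u k <= sup S + e].
  have [//|h] := in_ultra_setVsetC [set k | u k <= sup S + e] UU.
  suff : sup S + e <= sup S by rewrite gerDl leNgt e0.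
  apply: ub_le_sup; first by exists M.
  by apply: filterS h => k /= /negP; rewrite -ltNge => /ltW.
by apply: filterS (filterI h1 h2) => k /= [] a b; rewrite ler_norml; lra.
Qed.

Lemma ultra_cvg_complex (u : nat -> R[i]) (M : R) : U [set k | nr (u k) <= M] ->
  exists l, forall e : R, 0 < e -> U [set k | nr (u k - l) <= e].
Proof.
move=> uM.
have [|a aP] := @ultra_cvg_real (fun k => complex.Re (u k)) M.
  by apply: filterS uM => k /=; apply: le_trans; exact: Re_le_nr.
have [|b bP] := @ultra_cvg_real (fun k => complex.Im (u k)) M.
  by apply: filterS uM => k /=; apply: le_trans; exact: Im_le_nr.
exists (a +i* b) => e e0; have e2 : 0 < e / 2 by rewrite divr_gt0.
apply: filterS (filterI (aP _ e2) (bP _ e2)) => k /= [ka kb].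
apply: le_trans (nr_le_ReIm _) _.
by move: ka kb; case: (u k) => x y /= ka kb; lra.
Qed.

Lemma ultra_cvg_row n (u : nat -> 'rV[R[i]]_n) (M : R) : U [set k | nr (u k) <= M] ->
  exists l : 'rV[R[i]]_n, u @ U --> l.
Proof.
move=> uM.
have H j : exists l, forall e : R, 0 < e -> U [set k | nr (u k 0 j - l) <= e].
  apply: (@ultra_cvg_complex _ M); apply: filterS uM => k /=.
  by apply: le_trans; exact: nr_coord_le.
have [l lP] := choice H; exists (\row_j l j).
apply/cvg_nr => e e0; have e2 : 0 < e / 2 by rewrite divr_gt0.
have FU : Filter U by exact: filter_filter.
have Ul := @filter_forall _ _ (fun j => [set k | nr (u k 0 j - l j) <= e / 2]) U FU (fun j =>
  lP j _ e2).
apply: filterS Ul => k /= kP; apply: (@le_lt_trans _ _ (e / 2)); last by lra.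
by apply: nr_row_le => [|j]; [exact: ltW|rewrite !mxE].
Qed.

Lemma ultra_cvg_unique (V : normedModType R[i]) (u : nat -> V) (l l' : V) :
  u @ U --> l -> u @ U --> l' -> l = l'.
Proof.
move=> /cvg_nr ul /cvg_nr ul'; apply/eqP; rewrite -subr_eq0 -nr_eq0 eq_le nr_ge0 andbT.
apply/ler_addgt0Pr => e e0; rewrite add0r; have e2 : 0 < e / 2 by rewrite divr_gt0.
have [k [/= h1 h2]] := filter_ex (filterI (ul _ e2) (ul' _ e2)).
by rewrite (le_trans (ler_nr_tri l (u k) l'))// nrB; lra.
Qed.

Lemma ultra_cvg_le (V : normedModType R[i]) (u : nat -> V) (l : V) (M : R) :
  u @ U --> l -> U [set k | nr (u k) <= M] -> nr l <= M.
Proof.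
move=> /cvg_nr ul uM; apply/ler_addgt0Pr => e e0.
have [k [/= h1 h2]] := filter_ex (filterI (ul _ e0) uM).
have := ler_nr_tri l (u k) 0; rewrite !subr0 nrB; lra.
Qed.

Lemma ultra_cvg_closure (V : normedModType R[i]) (u : nat -> V) (l : V) (A : set V) :
  u @ U --> l -> U [set k | A (u k)] -> closure A l.
Proof.
move=> /cvg_nr ul uA; apply/closureP_nr => e e0.
by have [k [/= h1 h2]] := filter_ex (filterI (ul _ e0) uA); exists (u k).
Qed.

(* The bound of [taylor_bound_row] is uniform in [k], so it passes to the limit
   together with the differentials at [z0]; no uniform convergence is needed. *)
Lemma ultra_cvg_hol d m (f : nat -> 'rV[R[i]]_d -> 'rV[R[i]]_m)
    (g : 'rV[R[i]]_d -> 'rV[R[i]]_m) z0 (r M : R) :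
  0 < r -> U [set k | bounded_hol (f k) z0 r M] ->
  (forall z, nr (z - z0) < r -> f ^~ z @ U --> g z) -> differentiable g z0.
Proof.
move=> r0 fM fg; pose L k := 'd (f k) z0.
have fz k : bounded_hol (f k) z0 r M -> fderiv (f k) z0 (L k).
  by move=> /(_ z0); rewrite subrr nr0 => /(_ r0)[df _]; exact: differentiable_fderiv.
have M0 : 0 <= M by have [k /bounded_hol_ge0] := filter_ex fM; apply.
(* The differentials at [z0] are bounded by the Cauchy estimate, hence converge on each basis
   vector; [A] collects these limits by rows. *)
have H (i : 'I_d) : exists l : 'rV[R[i]]_m, (fun k => L k (delta_mx 0 i)) @ U --> l.
  apply: (@ultra_cvg_row _ _ (8 * M / r * nr (delta_mx 0 i : 'rV[R[i]]_d))).
  by apply: filterS fM => k bk /=; exact: fderiv_bound_row r0 bk (fz _ bk).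
have [l lP] := choice H; pose A := \matrix_i l i.
have LA h : (fun k => L k h) @ U --> h *m A.
  apply/cvg_nr => e e0; pose S := 1 + \sum_i nr (h 0 i).
  have S0 : 0 < S by rewrite ltr_pwDl// sumr_ge0// => i _; exact: nr_ge0.
  have eS : 0 < e / S by rewrite divr_gt0.
  have FU : Filter U by exact: filter_filter.
  have Ul := @filter_forall _ _ (fun j => [set k | nr (L k (delta_mx 0 j) - l j) < e / S]) U FU
    (fun j => (cvg_nr (FF := FU) _ _).1 (lP j) _ eS).
  apply: filterS Ul => k /= kP.
  have -> : L k h - h *m A = \sum_i h 0 i *: (L k (delta_mx 0 i) - l i).
    rewrite {1}(row_sum_delta h) linear_sum {1}(mulmx_sum_row h A) -sumrB.
    by apply: eq_bigr => i _; rewrite linearZ /= rowK -scalerBr.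
  apply: le_lt_trans (nr_sum _ _ _) _.
  apply: (@le_lt_trans _ _ (\sum_i nr (h 0 i) * (e / S))).
    by apply: ler_sum => i _; rewrite nrZ ler_wpM2l ?nr_ge0// ltW.
  rewrite -mulr_suml mulrCA gtr_pMr// ltr_pdivrMr// mul1r /S; lra.
apply: (@fderiv_mulmx_differentiable _ _ _ _ _ A); split => [t h|e e0]; first by rewrite
  scalemxAl.
have K0 : 0 <= 1024 * M / r ^+ 2 := divr_ge0 (mulr_ge0 (ler0n _ _) M0) (sqr_ge0 r).
have est h : nr h < r / 8 ->
    nr (g (z0 + h) - g z0 - h *m A) <= 1024 * M / r ^+ 2 * nr h ^+ 2.
  move=> hr; apply: (@ultra_cvg_le _ (fun k => f k (z0 + h) - f k z0 - L k h)).
    apply: cvgB; last exact: LA.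
    apply: cvgB; apply: fg; last by rewrite subrr nr0.
    by rewrite addrAC subrr add0r; lra.
  by apply: filterS fM => k bk /=; exact: taylor_bound_row r0 bk (fz _ bk) hr.
move: K0 est; move: (1024 * M / r ^+ 2) => K K0 est.
have K1 : 0 < K + 1 by rewrite ltr_wpDl.
exists (Num.min (r / 8) (e / (K + 1))) => [|h].
  by rewrite lt_min !divr_gt0.
rewrite lt_min => /andP[/est h1]; rewrite ltr_pdivlMr// => h2.
apply: le_trans h1 _; rewrite expr2 mulrA ler_wpM2r ?nr_ge0//.
have := nr_ge0 h; nra.
Qed.

End UltraLimit.

(** * Maximum principle *)

Section SchwarzPick.
Context {R : realType}.

Definition mobius (a w : R[i]) : R[i] := (w - a) / (1 - Num.conj a * w).

(** The right-hand side is positive for two points of the disc, which is why [mobius a] preserves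
    the disc. *)
Lemma nr_sqB_mobius (a w : R[i]) :
  nr (1 - Num.conj a * w) ^+ 2 - nr (w - a) ^+ 2 = (1 - nr a ^+ 2) * (1 - nr w ^+ 2).
Proof.
apply: complexI; rewrite rmorphB [RHS]rmorphM !(rmorphB _ 1 (_ ^+ 2)) rmorph1 /= -!nrMconj.
by rewrite !rmorphB rmorph1 rmorphM /= conjCK; ring.
Qed.

Lemma mobius_den_neq0 (a w : R[i]) : nr a < 1 -> nr w <= 1 -> 1 - Num.conj a * w != 0.
Proof.
move=> a1 w1; rewrite -nr_eq0 gt_eqF//.
have := ler_nr_tri (1 : R[i]) (Num.conj a * w) 0; rewrite !subr0 nr1 nrM nr_conj.
have : nr a * nr w <= nr a by rewrite ler_piMr// nr_ge0.
lra.
Qed.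

Lemma nr_mobius_le1 (a w : R[i]) : nr a < 1 -> nr w <= 1 -> nr (mobius a w) <= 1.
Proof.
move=> a1 w1; have n0 := mobius_den_neq0 a1 w1.
rewrite nrM nrV ler_pdivrMr ?mul1r; last by rewrite lt_def nr_eq0 n0 nr_ge0.
rewrite -(ler_pXn2r (n := 2))// ?nnegrE ?nr_ge0// -subr_ge0 nr_sqB_mobius.
by rewrite mulr_ge0// subr_ge0 expr_le1// ?nr_ge0// ltW.
Qed.

Lemma nr_mobius_lt1 (a w : R[i]) : nr a < 1 -> nr w < 1 -> nr (mobius a w) < 1.
Proof.
move=> a1 w1; have n0 := mobius_den_neq0 a1 (ltW w1).
rewrite nrM nrV ltr_pdivrMr ?mul1r; last by rewrite lt_def nr_eq0 n0 nr_ge0.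
rewrite -(ltr_pXn2r (n := 2))// ?nnegrE ?nr_ge0// -subr_gt0 nr_sqB_mobius.
by rewrite mulr_gt0// subr_gt0 expr_lt1// nr_ge0.
Qed.

Lemma mobiusK (a w : R[i]) : nr a < 1 -> nr w < 1 -> mobius a (mobius (- a) w) = w.
Proof.
move=> a1 w1.
have an1 : nr (- a) < 1 by rewrite nrN.
have n1 := mobius_den_neq0 an1 (ltW w1).
have n2 := mobius_den_neq0 a1 (nr_mobius_le1 an1 (ltW w1)).
rewrite /mobius in n2 *; rewrite rmorphN /= mulNr !opprK in n1 n2 *.
have n3 : 1 - Num.conj a * a != 0.
  apply: contra n2 => /eqP n3.
  have -> : 1 - Num.conj a * ((w + a) / (1 + Num.conj a * w)) =
    (1 - Num.conj a * a) / (1 + Num.conj a * w) by field.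
  by rewrite n3 mul0r.
field; rewrite n1 /=.
have -> : 1 + Num.conj a * w - Num.conj a * (w + a) = 1 - Num.conj a * a by ring.
exact: n3.
Qed.

Lemma differentiable_mobius (V : normedModType R[i]) (f : V -> R[i]) a z :
  differentiable f z -> 1 - Num.conj a * f z != 0 ->
  differentiable (fun x => mobius a (f x)) z.
Proof.
move=> df n0.
have d1 : differentiable (fun x => f x - a) z.
  by apply: differentiableB => //; exact: differentiable_cst.
have d2 : differentiable (fun x => 1 - Num.conj a * f x) z.
  apply: differentiableB; first exact: differentiable_cst.
  by apply: differentiableM => //; exact: differentiable_cst.
have d3 : differentiable (fun x => (1 - Num.conj a * f x)^-1) z.
  exact: differentiableV.
exact: differentiableM.
Qed.

(* Weak form of the Schwarz-Pick lemma: any constant smaller than [1] in place of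
   [2^-1] would do.  The factor [l < 1] in the proof allows [|g| = 1]. *)
Lemma schwarz_pick (V : normedModType R[i]) (g : V -> R[i]) z0 (r : R) z :
  0 < r -> bounded_hol g z0 r 1 -> nr (z - z0) < r / 32 ->
  nr (g z - g z0) <= 2^-1 * nr (1 - Num.conj (g z0) * g z).
Proof.
move=> r0 gM zr.
have z0r : nr (z0 - z0) < r by rewrite subrr nr0.
have zr' : nr (z - z0) < r by lra.
have [_ g01] := gM _ z0r; have [_ gz1] := gM _ zr'.
have key (l : R) : 0 < l < 1 -> l * nr (g z - g z0) <=
    2^-1 * (nr (1 - Num.conj (g z0) * g z) + (1 - l ^+ 2)).
  move=> /andP[l0 l1].
  have nl w : nr (l%:C * w) = l * nr w by rewrite nrM nr_real ger0_norm// ltW.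
  have l1' w : nr w <= 1 -> nr (l%:C * w) < 1.
    by move=> w1; rewrite nl (le_lt_trans _ l1)// ler_piMr// ltW.
  pose a := l%:C * g z0; pose h x := mobius a (l%:C * g x).
  have a1 : nr a < 1 by exact: l1'.
  have hM : bounded_hol h z0 r 1.
    move=> x /gM[dg gx]; split; last exact: nr_mobius_le1 (ltW (l1' _ gx)).
    apply: differentiable_mobius.
      by apply: differentiableM => //; exact: differentiable_cst.
    by apply: mobius_den_neq0 => //; rewrite ltW// l1'.
  have hz0 : h z0 = 0 by rewrite /h /mobius subrr mul0r.
  have zr2 : nr (z - z0) < r / 2 by lra.
  have z0r2 : nr (z0 - z0) < r / 2 by rewrite subrr nr0 divr_gt0.
  have := lipschitz_bound r0 hM zr2 z0r2; rewrite hz0 subr0 mulr1.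
  (* This fixes the radius [r / 32]: a map bounded by [1] has Lipschitz constant [16 / r]. *)
  have : 16 / r * nr (z - z0) <= 2^-1.
    rewrite mulrAC ler_pdivrMr//; lra.
  move=> h1 /le_trans /(_ h1) {h1}.
  have dn : 1 - Num.conj a * (l%:C * g z) != 0.
    by apply: mobius_den_neq0 => //; rewrite ltW// l1'.
  rewrite /h /mobius nrM nrV ler_pdivrMr; last by rewrite lt_def nr_eq0 dn nr_ge0.
  rewrite /a -mulrBr nl => /le_trans; apply; rewrite ler_wpM2l//.
  have -> : 1 - Num.conj (l%:C * g z0) * (l%:C * g z) =
      (1 - Num.conj (g z0) * g z) + (1 - l ^+ 2)%:C * (Num.conj (g z0) * g z).
    have lc : Num.conj (l%:C) = l%:C :> R[i] by apply: conj_Creal; rewrite complex_real.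
    by rewrite rmorphM /= lc rmorphB rmorph1 rmorphXn /=; ring.
  have l2 : 0 <= 1 - l ^+ 2 by rewrite subr_ge0 expr_le1 ?(ltW l0) ?(ltW l1).
  apply: le_trans (ler_nrD _ _) _; rewrite lerD2l nrM nr_real ger0_norm//.
  by rewrite ler_piMr// nrM nr_conj mulr_ile1// nr_ge0.
apply/ler_addgt0Pr => e e0.
have X2 : nr (g z - g z0) <= 2 by rewrite (le_trans (ler_nrB _ _))//; lra.
pose d := Num.min (2^-1) (e / 4).
have d0 : 0 < d by rewrite lt_min invr_gt0 ltr0n divr_gt0.
have d1 : d <= 2^-1 by rewrite ge_min lexx.
have d2 : d <= e / 4 by rewrite ge_min lexx orbT.
have d01 : 0 < 1 - d < 1 by lra.
have := key _ d01.
have : d * nr (g z - g z0) <= d * 2 by rewrite ler_wpM2l// ltW.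
nra.
Qed.

(** The hypothesis makes membership in [E] locally constant on [A], so [E] cuts out an open and
    closed part of [A]. This carries both the maximum principle and the spread of surjectivity along
    the face. *)
Lemma connected_sub (T : topologicalType) (A E : set T) :
  connected A -> A `&` E !=set0 ->
  (forall a, A a -> exists Q : set T, [/\ open Q, Q a &
     (exists e, [/\ A e, Q e & E e]) -> forall b, A b -> Q b -> E b]) ->
  A `<=` E.
Proof.
move=> cA AE loc; suff <- : A `&` E = A by move=> x [].
apply: cA => //.
- exists (\bigcup_(Q in [set Q | open Q /\ (forall b, A b -> Q b -> E b)]) Q).
    by apply: bigcup_open => Q [].
  apply/seteqP; split=> [x [Ax Ex]|x [Ax [Q [_ QE] Qx]]]; last by split => //; exact: QE.
  split=> //; have [Q [oQ Qx QE]] := loc _ Ax; exists Q => //; split => // b.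
  by apply: QE; exists x.
- exists (~` \bigcup_(Q in [set Q | open Q /\ (forall b, A b -> Q b -> ~ E b)]) Q).
    by apply: open_closedC; apply: bigcup_open => Q [].
  apply/seteqP; split=> [x [Ax Ex]|x [Ax nx]].
    by split=> // -[Q [_ QE] Qx]; exact: QE Ex.
  split=> //; apply: contrapT => nEx; apply: nx.
  have [Q [oQ Qx QE]] := loc _ Ax; exists Q => //; split=> // b Ab Qb Eb.
  by apply: nEx; apply: QE => //; exists b.
Qed.

Lemma open_ball_nr (V : normedModType R[i]) (a : V) (r : R) :
  open [set x | nr (x - a) < r].
Proof.
apply/openP_nr => x /= xr; exists (r - nr (x - a)) => [|y yx]; first by rewrite subr_gt0.
have := ler_nr_tri y x a; lra.
Qed.

(** As [g x] has modulus one, [1 - conj w * g x] and [w - g x] have the same modulus, so the weak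
    Schwarz-Pick inequality reads [X <= 2^-1 * X] and forces equality. It is applied first from a
    point with value [g x] to the centre of a ball, then from the centre to every point of the
    ball. *)
Lemma max_principle (V : normedModType R[i]) (Omega : set V) (g : V -> R[i]) x :
  open Omega -> connected Omega ->
  (forall z, Omega z -> differentiable g z /\ nr (g z) <= 1) ->
  Omega x -> nr (g x) = 1 -> forall z, Omega z -> g z = g x.
Proof.
move=> oO cO gO Ox gx1.
apply: (@connected_sub _ Omega [set z | g z = g x]) => //; first by exists x.
move=> a Oa; have [r r0 rO] := (openP_nr _).1 oO _ Oa.
exists [set z | nr (z - a) < r / 32]; split; first exact: open_ball_nr.
  by rewrite /= subrr nr0 divr_gt0.
have ga : bounded_hol g a r 1 by move=> z /rO /gO.
have conjE w : nr (1 - Num.conj w * g x) = nr (w - g x).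
  have -> : 1 - Num.conj w * g x = Num.conj (g x - w) * g x.
    by rewrite rmorphB mulrBl (mulrC (Num.conj (g x))) nrMconj gx1 expr1n.
  by rewrite nrM gx1 mulr1 nr_conj nrB.
have eq0 w : nr (g x - w) <= 2^-1 * nr (g x - w) -> w = g x.
  move=> h; apply/eqP; rewrite eq_sym -subr_eq0 -nr_eq0 eq_le nr_ge0 andbT; lra.
case=> e [_ er /= ge] b _ br; have gaE : g a = g x.
  apply: eq0; have := schwarz_pick r0 ga er.
  by rewrite ge conjE [nr (g a - _)]nrB.
apply: eq0; have := schwarz_pick r0 ga br; rewrite gaE.
rewrite -(nr_conj (1 - _)) rmorphB rmorph1 rmorphM /= conjCK [g x * _]mulrC conjE.
by rewrite nrB.
Qed.

End SchwarzPick.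

(** * Inverse function theorem *)

Lemma exists_ultrafilter_oo : exists U : set_system nat,
  UltraFilter U /\ forall n0, U [set k | (n0 <= k)%N].
Proof.
have [U [UU sU]] := @ultraFilterLemma nat \oo _.
by exists U; split => // n0; apply: sU; exists n0.
Qed.

Section InverseFunction.
Context {R : realType}.
Variables (d m : nat) (Psi : 'rV[R[i]]_d -> 'rV[R[i]]_m) (eta : 'rV[R[i]]_d).
Variables (J : 'M[R[i]]_(d, m)) (J' : 'M[R[i]]_(m, d)).

Let sub_cancel n (a b c e f h : 'rV[R[i]]_n) :
  a - (b - e) - f - (c - (h - e) - f) = a - c - (b - h).
Proof. by apply/rowP => j; rewrite !mxE; ring. Qed.

Let sub_add_cancel n (a b c e f h : 'rV[R[i]]_n) :
  a - (b + c - e) - f - (h - (b - e) - f) = a - h - c.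
Proof. by apply/rowP => j; rewrite !mxE; ring. Qed.

Let newton_cancel n (a b c e f : 'rV[R[i]]_n) :
  a - (b - e) - (c - (f - e)) = - (b - f - (a - c)).
Proof. by apply/rowP => j; rewrite !mxE; ring. Qed.

(** Once its affine part at [eta] is subtracted, [Psi] is bounded by [ep / 16 * (2 * r)] on the ball
    of radius [2 * r]. The Cauchy estimates turn this into a Lipschitz constant and a bound on the
    derivative, both equal to [ep]. *)
Lemma strict_differentiability (r0 ep : R) : 0 < r0 -> 0 < ep ->
  (forall z, nr (z - eta) < r0 -> differentiable Psi z) ->
  fderiv Psi eta (mulmx^~ J) -> exists2 r : R, 0 < r <= r0 &
  (forall z w, nr (z - eta) < r -> nr (w - eta) < r ->
     nr (Psi z - Psi w - (z - w) *m J) <= ep * nr (z - w)) /\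
  (forall z h, nr (z - eta) < r -> nr ('d Psi z h - h *m J) <= ep * nr h).
Proof.
move=> r00 ep0 dPsi [_ dJ].
have e16 : 0 < ep / 16 by rewrite divr_gt0.
have [d0 d00 dP] := dJ _ e16.
pose r := Num.min r0 d0 / 2; pose g z := Psi z - (z - eta) *m J - Psi eta.
have min0 : 0 < Num.min r0 d0 by rewrite lt_min r00.
have r_gt0 : 0 < r by rewrite divr_gt0.
have rr0 : 2 * r <= r0 by rewrite mulrC divfK// ge_min lexx.
have rd0 : 2 * r <= d0 by rewrite mulrC divfK// ge_min lexx orbT.
have gM : bounded_hol g eta (2 * r) (ep / 16 * (2 * r)).
  move=> z zr; split.
    apply: differentiableB; last exact: differentiable_cst.
    apply: differentiableB; first by apply: dPsi; lra.
    apply: (@differentiable_comp _ _ _ _ (fun z => z - eta) (mulmx^~ J)).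
      by apply: differentiableB => //; exact: differentiable_cst.
    exact: differentiable_mulmxr.
  have zE : eta + (z - eta) = z by rewrite addrC subrK.
  have := dP (z - eta); rewrite zE /g [_ - _ - Psi eta]addrAC => h.
  by rewrite (le_trans (h _)) ?ler_wpM2l ?(ltW zr) ?(ltW e16)//; lra.
exists r; first by rewrite r_gt0; lra.
split=> [z w zr wr|z h zr].
- have r2 : 0 < 2 * r by rewrite mulr_gt0.
  have zr2 : nr (z - eta) < 2 * r / 2 by lra.
  have wr2 : nr (w - eta) < 2 * r / 2 by lra.
  have := lipschitz_bound_row r2 gM zr2 wr2.
  have -> : 16 * (ep / 16 * (2 * r)) / (2 * r) = ep by field; rewrite gt_eqF.
  have -> // : g z - g w = Psi z - Psi w - (z - w) *m J.
  by rewrite /g !mulmxBl sub_cancel.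
- have gz : bounded_hol g z r (ep / 16 * (2 * r)).
    by move=> x xz; apply: gM; have := ler_nr_tri x z eta; lra.
  have dz : differentiable Psi z by apply: dPsi; lra.
  have gL : fderiv g z (fun h => 'd Psi z h - h *m J).
    have [_ Lz] := differentiable_fderiv dz.
    split=> [t k|e e0]; first by rewrite linearZ -scalemxAl scalerBr.
    have [d1 d10 d1P] := Lz _ e0; exists d1 => // k /d1P.
    congr (nr _ <= _); rewrite /g !mulmxBl mulmxDl sub_add_cancel.
    by rewrite opprB addrA subrK.
  have := fderiv_bound_row h r_gt0 gz gL.
  by have -> : 8 * (ep / 16 * (2 * r)) / r = ep by field; rewrite gt_eqF.
Qed.

Hypotheses (JJ' : J *m J' = 1%:M) (J'J : J' *m J = 1%:M).

(** The sizes [d] and [m] are kept apart because the application has [m = r + (d - r)], which is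
    equal but not convertible to [d]; hence also the two identities for [J']. *)
Lemma inverse_function (r0 : R) : 0 < r0 ->
  (forall z, nr (z - eta) < r0 -> differentiable Psi z) ->
  fderiv Psi eta (mulmx^~ J) ->
  exists (r rho : R) (Xi : 'rV[R[i]]_m -> 'rV[R[i]]_d),
  [/\ 0 < r <= r0, 0 < rho,
      forall y, nr (y - Psi eta) < rho ->
        [/\ nr (Xi y - eta) < r, Psi (Xi y) = y & differentiable Xi y] &
      forall z, nr (z - eta) < r -> nr (Psi z - Psi eta) < rho -> Xi (Psi z) = z].
Proof.
move=> r00 dPsi dJ.
have [K K0 KP] := nr_mulmx_le J'.
(* With this [ep], the error after multiplication by [J'] is at most a third of the distance. The
   factor serves three times: for injectivity on the ball, for the contraction, and for the
   invertibility of the derivative nearby. *)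
have ep0 : 0 < (3 * K)^-1 by rewrite invr_gt0 mulr_gt0.
have [r /andP[r_gt0 rr0] [strict dclose]] := strict_differentiability r00 ep0 dPsi dJ.
have inj z w : nr (z - eta) < r -> nr (w - eta) < r ->
    nr (z - w) <= 2 * K * nr (Psi z - Psi w).
  move=> zr wr; have h1 := strict _ _ zr wr.
  have E : z - w = (Psi z - Psi w) *m J' - (Psi z - Psi w - (z - w) *m J) *m J'.
    by rewrite [(_ - _ - _) *m _]mulmxBl opprB [RHS]addrC subrK -mulmxA JJ' mulmx1.
  have h2 := KP (Psi z - Psi w); have h3 := KP (Psi z - Psi w - (z - w) *m J).
  have h4 : K * nr (Psi z - Psi w - (z - w) *m J) <= 3^-1 * nr (z - w).
    apply: (@le_trans _ _ (K * ((3 * K)^-1 * nr (z - w)))); first by rewrite ler_wpM2l// ltW.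
    by rewrite invfM mulrA mulrCA mulfV ?gt_eqF// mulr1.
  have := ler_nrB ((Psi z - Psi w) *m J') ((Psi z - Psi w - (z - w) *m J) *m J').
  rewrite -E; have : 0 <= K * nr (Psi z - Psi w) by rewrite mulr_ge0 ?nr_ge0// ltW.
  move: h2 h3 h4; move: (nr (z - w)) (nr (Psi z - Psi w)) (nr (_ *m J'))
    (nr (_ - _ *m J)) (nr (_ *m J')) => *; lra.
(* The first Newton step is then at most [r / 4]; as the steps shrink by a factor [3], the iterates
   stay within [3 / 8 * r] of [eta]. *)
pose rho := r / (4 * K).
have rho0 : 0 < rho by rewrite divr_gt0// mulr_gt0.
have [U [UU Uoo]] := exists_ultrafilter_oo.
have surj y : exists z, nr (y - Psi eta) < rho -> nr (z - eta) < r /\ Psi z = y.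
  have [yr|] := boolP (nr (y - Psi eta) < rho); last by exists eta.
  (* [Nw] is the step of the simplified Newton method, with fixed inverse [J']. *)
  have [Nw NwE] : exists Nw : 'rV_d -> 'rV_d, forall z, Nw z = z - (Psi z - y) *m J'.
    by exists (fun z => z - (Psi z - y) *m J').
  have NwB z w : nr (z - eta) < r -> nr (w - eta) < r ->
      nr (Nw z - Nw w) <= 3^-1 * nr (z - w).
    move=> zr wr.
    have -> : Nw z - Nw w = - ((Psi z - Psi w - (z - w) *m J) *m J').
      rewrite [(_ - _ - _) *m _]mulmxBl -(mulmxA (z - w)) JJ' mulmx1 !NwE !mulmxBl.
      exact: newton_cancel.
    rewrite nrN (le_trans (KP _))//.
    apply: (@le_trans _ _ (K * ((3 * K)^-1 * nr (z - w)))).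
      by rewrite ler_wpM2l ?strict// ltW.
    by rewrite invfM mulrA mulrCA mulfV ?gt_eqF// mulr1.
  have [zs [zs0 zsS]] : exists zs : nat -> 'rV_d,
      zs 0%N = eta /\ forall k, zs k.+1 = Nw (zs k).
    by exists (fun k => iter k Nw eta).
  have inv k : nr (zs k - eta) <= 3 / 8 * r * (1 - (3 ^+ k)^-1) /\
      nr (zs k.+1 - zs k) <= r / 4 * (3 ^+ k)^-1.
    elim: k => [|k [ih1 ih2]].
      rewrite zsS zs0 expr0 invr1 mulr1; split; first by rewrite !subrr nr0 mulr0.
      rewrite NwE addrAC subrr add0r nrN (le_trans (KP _))//.
      apply: (@le_trans _ _ (K * rho)); first by rewrite ler_wpM2l ?(ltW K0)// nrB ltW.
      have -> : K * rho = r / 4 by rewrite /rho; field; rewrite gt_eqF.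
      by [].
    have E3 : (3 ^+ k)^-1 = 3 * (3 ^+ k.+1)^-1 :> R.
      by rewrite exprS; field; rewrite expf_neq0.
    have p0 : 0 < (3 ^+ k.+1)^-1 :> R by rewrite invr_gt0 exprn_gt0.
    rewrite E3 in ih1 ih2; move: p0 ih1 ih2; set a := (3 ^+ k.+1)^-1 => p0 ih1 ih2.
    have b1 : nr (zs k.+1 - eta) <= 3 / 8 * r * (1 - a).
      have := ler_nr_tri (zs k.+1) (zs k) eta; lra.
    split=> //; rewrite [zs k.+2]zsS {2}[zs k.+1]zsS.
    have zr1 : nr (zs k.+1 - eta) < r by nra.
    have zr0 : nr (zs k - eta) < r by nra.
    apply: le_trans (NwB _ _ zr1 zr0) _.
    have -> : r / 4 * a = 3^-1 * (r / 4 * (3 * a)) by field.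
    by rewrite ler_wpM2l.
  have zsr k : nr (zs k - eta) <= 3 / 8 * r.
    have [h _] := inv k; apply: le_trans h _.
    have : 0 <= r * (3 ^+ k)^-1 by rewrite mulr_ge0 ?invr_ge0 ?exprn_ge0// ltW.
    lra.
  (* Boundedness suffices for a limit along [U]; since the steps tend to [0], this limit is a fixed
     point of [Nw]. *)
  have [|l zl] := @ultra_cvg_row R U UU _ zs (nr eta + r).
    apply: filterS (Uoo 0%N) => k _ /=; have := ler_nr_tri (zs k) eta 0.
    by rewrite !subr0; have := zsr k; lra.
  have lr : nr (l - eta) < r.
    have := @ultra_cvg_closure R U UU _ zs l [set z | nr (z - eta) <= 3 / 8 * r] zl.
    move=> /(_ (filterS (fun k _ => zsr k) (Uoo 0%N)))/closureP_nr /(_ (r / 2)).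
    case=> [|w /= w1 w2]; first by rewrite divr_gt0.
    have := ler_nr_tri l w eta; rewrite nrB in w2; lra.
  exists l => _; split=> //.
  have fixl : (Psi l - y) *m J' = 0.
    apply/eqP; rewrite -nr_eq0 eq_le nr_ge0 andbT; apply/ler_addgt0Pr => e e0; rewrite add0r.
    have [k0 k0P] := @exists_div_exp3_lt R (r / 4) (e / 2) (divr_gt0 e0 (ltr0n _ 2)).
    have e4 : 0 < e / 4 by rewrite divr_gt0.
    have [k [/= kl kk0]] := filter_ex (filterI ((cvg_nr _ _).1 zl _ e4) (Uoo k0)).
    have [_ h1] := inv k.
    have zr : nr (zs k - eta) < r by have := zsr k; lra.
    have := NwB _ _ zr lr => h2.
    have h3 : r / 4 * (3 ^+ k)^-1 <= e / 2.
      apply: le_trans (ltW k0P); rewrite ler_wpM2l ?divr_ge0 ?(ltW r_gt0)//.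
      by rewrite lef_pV2 ?posrE ?exprn_gt0// ler_eXn2l// ltr1n.
    have -> : (Psi l - y) *m J' = l - Nw l by rewrite NwE opprB [RHS]addrC subrK.
    have := ler_nr_tri l (zs k) (Nw l); have := ler_nr_tri (zs k) (zs k.+1) (Nw l).
    rewrite [nr (l - zs k)]nrB [nr (zs k - zs k.+1)]nrB; rewrite -zsS in h2.
    move: h1 h2 h3 kl; move: (nr _) (nr _) (nr _) (nr _) => *; lra.
  apply/eqP; rewrite -subr_eq0; apply/eqP.
  by rewrite -[LHS]mulmx1 -J'J mulmxA fixl mul0mx.
have [Xi ThP] := choice surj.
exists r, rho, Xi; split => //; first by rewrite r_gt0.
  move=> y yr; have [zr Pz] := ThP y yr; split => //.
  have dz : differentiable Psi (Xi y) by apply: dPsi; lra.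
  pose A := lin1_mx ('d Psi (Xi y)).
  have AE h : 'd Psi (Xi y) h = h *m A by rewrite mul_rV_lin1.
  (* The type of [A] is not that of a square matrix, so the product [A *m J'], which is close to the
     identity, is inverted instead; this yields a right inverse of [A]. *)
  have uA : A *m J' \in unitmx.
    rewrite -row_free_unit; apply: inj_row_free => v vA.
    have E : v = - ((v *m A - v *m J) *m J').
      by rewrite mulmxBl -mulmxA vA -mulmxA JJ' mulmx1 sub0r opprK.
    apply/eqP; rewrite -nr_eq0 eq_le nr_ge0 andbT.
    have h1 := KP (v *m A - v *m J); have h2 := dclose (Xi y) v zr.
    rewrite AE in h2.
    have h3 : K * nr (v *m A - v *m J) <= 3^-1 * nr v.
      apply: (@le_trans _ _ (K * ((3 * K)^-1 * nr v))); first by rewrite ler_wpM2l// ltW.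
      by rewrite invfM mulrA mulrCA mulfV ?gt_eqF// mulr1.
    have : nr v = nr ((v *m A - v *m J) *m J') by rewrite {1}E nrN.
    lra.
  pose A' := J' *m invmx (A *m J').
  have AA' : A *m A' = 1%:M by rewrite mulmxA mulmxV.
  have [K1 K10 K1P] := nr_mulmx_le A'.
  apply: (@fderiv_mulmx_differentiable _ _ _ _ _ A'); split=> [t h|e e0].
    by rewrite scalemxAl.
  have [_ Le] := differentiable_fderiv dz.
  have e1 : 0 < e / (K1 * (2 * K)) by rewrite divr_gt0// !mulr_gt0.
  have [d1 d10 d1P] := Le _ e1.
  exists (Num.min (d1 / (2 * K)) (rho - nr (y - Psi eta))).
    by rewrite lt_min divr_gt0 ?mulr_gt0//= subr_gt0.
  move=> k; rewrite lt_min => /andP[k1 k2].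
  have ykr : nr (y + k - Psi eta) < rho.
    by rewrite addrAC (le_lt_trans (ler_nrD _ _))//; lra.
  have [zkr Pzk] := ThP _ ykr.
  set h := Xi (y + k) - Xi y.
  have hk : nr h <= 2 * K * nr k.
    by have := inj _ _ zkr zr; rewrite Pzk Pz [y + k - y]addrAC subrr add0r.
  have hd : nr h < d1.
    by rewrite (le_lt_trans hk)// mulrC -ltr_pdivlMr ?mulr_gt0.
  have := d1P h hd.
  have -> : Xi y + h = Xi (y + k) by rewrite addrC subrK.
  rewrite Pzk Pz [y + k - y]addrAC subrr add0r AE => Eh.
  have -> : h - k *m A' = - ((k - h *m A) *m A').
    by rewrite mulmxBl -mulmxA AA' mulmx1 opprB.
  rewrite nrN (le_trans (K1P _))//.
  apply: (@le_trans _ _ (K1 * (e / (K1 * (2 * K)) * (2 * K * nr k)))).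
    rewrite ler_wpM2l ?(ltW K10)// (le_trans Eh)// ler_wpM2l// ltW//.
  by rewrite le_eqVlt; apply/orP; left; apply/eqP; field; rewrite !gt_eqF.
move=> z zr Pzr; have [tr Pt] := ThP _ Pzr.
apply/eqP; rewrite -subr_eq0 -nr_eq0 eq_le nr_ge0 andbT.
by have := inj _ _ tr zr; rewrite Pt subrr nr0 mulr0.
Qed.

End InverseFunction.

Section Connectedness.
Context {R : realType}.

Lemma connected_image (V W : normedModType R[i]) (A : set V) (f : V -> W) :
  connected A -> (forall z, A z -> differentiable f z) -> connected (f @` A).
Proof.
move=> cA df; apply: connected_continuous_connected => //.
apply: continuous_in_subspaceT => z /set_mem /df.
exact: differentiable_continuous.
Qed.

Lemma connected_star (V : normedModType R[i]) (A : set V) (y0 : V) :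
  (forall y (t : R), A y -> 0 <= t <= 1 -> A (y0 + t%:C *: (y - y0))) -> connected A.
Proof.
move=> starA.
pose path (y : V) (t : R) : V := y0 + t%:C *: (y - y0).
have -> : A = \bigcup_(y in A) (path y @` `[0, 1]%classic).
  apply/seteqP; split=> [y Ay|z [y Ay [t /= t01 <-]]].
    exists y => //; exists 1; first by rewrite /= in_itv /= ler01 lexx.
    by rewrite /path rmorph1 scale1r addrC subrK.
  by apply: starA => //; move: t01; rewrite in_itv.
apply: bigcup_connected.
  have [[y Ay]|nA] := pselect (A !=set0).
    exists y0 => z Az; exists 0; first by rewrite /= in_itv /= ler01 lexx.
    by rewrite /path rmorph0 scale0r addr0.
  by exists y0 => z Az; exfalso; apply: nA; exists z.
move=> y Ay; apply: connected_continuous_connected; first exact: segment_connected.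
apply: continuous_subspaceT => t.
apply/(@cvg_nr _ _ _ (nbhs t) (nbhs_filter t)) => e e0.
apply/nbhs_ballP; exists (e / (nr (y - y0) + 1)).
  by rewrite /= divr_gt0// ltr_wpDl ?nr_ge0.
move=> s /=; rewrite -ball_normE /= distrC => st.
have -> : path y s - path y t = (s - t)%:C *: (y - y0).
  by rewrite /path opprD addrACA subrr add0r -scalerBl rmorphB.
rewrite nrZ nr_real; move: st.
rewrite ltr_pdivlMr ?ltr_wpDl ?nr_ge0//; apply: le_lt_trans.
by rewrite ler_wpM2l// lerDl.
Qed.

End Connectedness.

(** * Ultralimits of families of maps *)

Section UltraLimitMaps.
Context {R : realType} (U : set_system nat) {UU : UltraFilter U}.

Lemma ultra_cvg_comp (V W : normedModType R[i]) (u : nat -> V) (l : V) (g : V -> W) :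
  u @ U --> l -> differentiable g l -> (fun n => g (u n)) @ U --> g l.
Proof. by move=> ul /differentiable_continuous dg; apply: (cvg_comp u g ul dg). Qed.

Lemma ultra_cvg_row_mx m n (u : nat -> 'rV[R[i]]_m) (v : nat -> 'rV[R[i]]_n)
  (a : 'rV[R[i]]_m) (b : 'rV[R[i]]_n) :
  u @ U --> a -> v @ U --> b -> (fun k => row_mx (u k) (v k)) @ U --> row_mx a b.
Proof.
move=> /cvg_nr ua /cvg_nr vb; apply/cvg_nr => e e0.
apply: filterS (filterI (ua e e0) (vb e e0)) => k /= [h1 h2].
rewrite opp_row_mx add_row_mx; apply: nr_row_lt => // j.
rewrite -(splitK j); case: (fintype.split j) => i /=.
  by rewrite row_mxEl (le_lt_trans (nr_coord_le _ _)).
by rewrite row_mxEr (le_lt_trans (nr_coord_le _ _)).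
Qed.

(** Montel's theorem in pointwise form. Where the maps are unbounded along [U] the value of [G] is
    arbitrary; about a point of [D] the local bound gives convergence on a whole ball, as
    [ultra_cvg_hol] requires. *)
Lemma exists_ultra_limit d m (g : nat -> 'rV[R[i]]_d -> 'rV[R[i]]_m)
    (D : set 'rV[R[i]]_d) (M : R) :
  (forall p, D p -> exists2 s : R, 0 < s & U [set n | bounded_hol (g n) p s M]) ->
  exists G : 'rV[R[i]]_d -> 'rV[R[i]]_m, forall p, D p ->
    (fun n => g n p) @ U --> G p /\ differentiable G p.
Proof.
move=> gM.
have H p : exists l : 'rV[R[i]]_m, U [set n | nr (g n p) <= M] -> (fun n => g n p) @ U --> l.
  have [Up|nUp] := pselect (U [set n | nr (g n p) <= M]); last by exists 0.
  by have [l lP] := @ultra_cvg_row _ U _ _ (fun n => g n p) _ Up; exists l.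
have [G GP] := choice H; exists G => p Dp.
have [s s0 sP] := gM p Dp.
have lim q : nr (q - p) < s -> (fun n => g n q) @ U --> G q.
  by move=> qs; apply: GP; apply: filterS sP => n gn; have [] := gn q qs.
split; first by apply: lim; rewrite subrr nr0.
exact: ultra_cvg_hol s0 sP lim.
Qed.

(** The maps are uniformly Lipschitz near [p], so the argument may move along with [n]. *)
Lemma ultra_limit_seq d m (g : nat -> 'rV[R[i]]_d -> 'rV[R[i]]_m)
    (p : 'rV[R[i]]_d) (l : 'rV[R[i]]_m) (s M : R) (q : nat -> 'rV[R[i]]_d) :
  0 < s -> U [set n | bounded_hol (g n) p s M] -> q @ U --> p ->
  (fun n => g n p) @ U --> l -> (fun n => g n (q n)) @ U --> l.
Proof.
move=> s0 gM /cvg_nr qp /cvg_nr gl; apply/cvg_nr => e e0.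
have M0 : 0 <= M by have [k /bounded_hol_ge0] := filter_ex gM; apply.
pose K := 16 * M / s; have K0 : 0 <= K := divr_ge0 (mulr_ge0 (ler0n _ _) M0) (ltW s0).
have K1 : 0 < K + 1 by rewrite ltr_wpDl.
have e2 : 0 < e / 2 by rewrite divr_gt0.
have e3 : 0 < Num.min (s / 2) (e / 2 / (K + 1)) by rewrite lt_min !divr_gt0.
apply: filterS (filterI gM (filterI (qp _ e3) (gl _ e2))) => n /= [gn [qn ln]].
move: qn; rewrite lt_min => /andP[q1]; rewrite ltr_pdivlMr// => q2.
have p1 : nr (p - p) < s / 2 by rewrite subrr nr0 divr_gt0.
have := lipschitz_bound_row s0 gn q1 p1; rewrite -/K => h.
have := ler_nr_tri (g n (q n)) (g n p) l.
have := nr_ge0 (q n - p); nra.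
Qed.

End UltraLimitMaps.

Section RowBlocks.
Context {R : realType}.

Lemma nr_lsubmx_le m n (u : 'rV[R[i]]_(m + n)) : nr (lsubmx u) <= nr u.
Proof. by apply: nr_row_le => [|j]; rewrite ?nr_ge0// mxE nr_coord_le. Qed.

Lemma nr_rsubmx_le m n (u : 'rV[R[i]]_(m + n)) : nr (rsubmx u) <= nr u.
Proof. by apply: nr_row_le => [|j]; rewrite ?nr_ge0// mxE nr_coord_le. Qed.

End RowBlocks.

Section LocalDifferentiability.
Context {R : realType} (V W : normedModType R[i]).

Lemma differentiable_near_eq (f g : V -> W) p (e : R) : 0 < e ->
  (forall q, nr (q - p) < e -> f q = g q) -> differentiable g p -> differentiable f p.
Proof.
move=> e0 fg dg.
apply: (@fderiv_differentiable _ _ _ f p ('d g p)); first exact: diff_continuous.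
have [Lh Le] := differentiable_fderiv dg; split=> // e1 /Le[d d0 dP].
exists (Num.min d e) => [|h]; first by rewrite lt_min d0.
rewrite lt_min => /andP[hd he]; rewrite !fg ?subrr ?nr0//; first exact: dP.
by rewrite addrAC subrr add0r.
Qed.

Lemma differentiable_fst (p : V * W) : differentiable (fst : V * W -> V) p.
Proof.
apply: (@linear_differentiable _ _ _ (fst : {linear (V * W)%type -> V})) => q.
exact: cvg_fst.
Qed.

Lemma differentiable_snd (p : V * W) : differentiable (snd : V * W -> W) p.
Proof.
apply: (@linear_differentiable _ _ _ (snd : {linear (V * W)%type -> W})) => q.
exact: cvg_snd.
Qed.

Lemma open_preimage (A : set V) (B : set W) (f : V -> W) : open A -> open B ->
  (forall z, A z -> differentiable f z) -> open [set z | A z /\ B (f z)].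
Proof.
move=> oA oB df; apply/openP_nr => z [Az Bz].
have [e e0 eB] := (openP_nr _).1 oB _ Bz; have [e' e'0 eA] := (openP_nr _).1 oA _ Az.
have cf := differentiable_continuous (df z Az).
have /nbhs_nr[d d0 dP] := (@cvg_nr _ _ _ (nbhs z) (nbhs_filter z) _ _).1 cf e e0.
exists (Num.min d e') => [|w]; first by rewrite lt_min d0.
by rewrite lt_min => /andP[/dP wd /eA Aw]; split => //; exact: eB.
Qed.

End LocalDifferentiability.

Section RowComplement.
Context {R : realType}.

Lemma normr_lt1_nr (x : R[i]) : (`|x| < 1) = (nr x < 1).
Proof. by rewrite nrE -(rmorph1 (real_complex R)) ltcR. Qed.

Lemma normr_eq1_nr (x : R[i]) : (`|x| == 1) = (nr x == 1).
Proof. by rewrite nrE -(rmorph1 (real_complex R)) (inj_eq (@complexI R)). Qed.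

Lemma polydisc_nr n (w : 'rV[R[i]]_n) : polydisc R n w <-> nr w < 1.
Proof.
split=> [w1|w1 j]; last by rewrite normr_lt1_nr (le_lt_trans (nr_coord_le _ _)).
by apply: nr_row_lt => // j; rewrite -normr_lt1_nr.
Qed.

Lemma nr_row_mx_lt m n (u : 'rV[R[i]]_m) (v : 'rV[R[i]]_n) (e : R) : 0 < e ->
  nr (row_mx u v) < e <-> nr u < e /\ nr v < e.
Proof.
move=> e0; split=> [uv|[ue ve]].
  split; apply: nr_row_lt => // j; apply: le_lt_trans _ uv.
    by rewrite -(row_mxEl u v); exact: nr_coord_le.
  by rewrite -(row_mxEr u v); exact: nr_coord_le.
apply: nr_row_lt => // j; rewrite -(splitK j); case: (fintype.split j) => k /=.
  by rewrite row_mxEl (le_lt_trans (nr_coord_le _ _)).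
by rewrite row_mxEr (le_lt_trans (nr_coord_le _ _)).
Qed.

Lemma bounded_set_nr (V : normedModType R[i]) (A : set V) :
  bounded_set A -> exists M : R, forall z, A z -> nr z <= M.
Proof.
move=> [M [Mreal MA]]; exists (complex.Re (M + 1)) => z Az.
have M1 : M < M + 1 by rewrite ltrDl.
have : `|z| <= M + 1 := MA _ M1 z Az.
rewrite nrE.
have -> : M + 1 = (complex.Re (M + 1))%:C.
  have : M + 1 \is Num.real by rewrite realD.
  by move=> /Creal_ReP; rewrite -complexRe.
by rewrite lecR.
Qed.

(** The difference is [w * (1 - nr a ^ 2) / (1 + conj a * w)]: as [a] tends to the circle, the
    inverse disc automorphism becomes constant where [w] stays away from the circle. *)
Lemma mobiusN_sub (a w : R[i]) : nr a < 1 -> nr w < 1 ->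
  nr (mobius (- a) w - a) <= (1 - nr a ^+ 2) / (1 - nr w).
Proof.
move=> a1 w1; have an1 : nr (- a) < 1 by rewrite nrN.
have n0 := mobius_den_neq0 an1 (ltW w1).
have -> : mobius (- a) w - a = w * (1 - a * Num.conj a) / (1 - Num.conj (- a) * w).
  by rewrite /mobius opprK; rewrite rmorphN mulNr opprK in n0 *; field.
rewrite nrMconj -(rmorph1 (real_complex R)) -rmorphB !nrM nrV nr_real.
have a2 : 0 <= 1 - nr a ^+ 2 by rewrite subr_ge0 expr_le1 ?nr_ge0// ltW.
rewrite (ger0_norm a2) rmorph1.
have dw : 1 - nr w <= nr (1 - Num.conj (- a) * w).
  have := ler_nr_tri (1 : R[i]) (Num.conj (- a) * w) 0.
  rewrite !subr0 nr1 nrM nr_conj nrN.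
  have : nr a * nr w <= nr w by rewrite ler_piMl ?nr_ge0// ltW.
  lra.
have w2 : 0 < 1 - nr w by rewrite subr_gt0.
apply: ler_pM.
- by rewrite mulr_ge0 ?nr_ge0.
- by rewrite invr_ge0 nr_ge0.
- by rewrite ler_piMl// ltW.
- by rewrite lef_pV2 ?posrE//; apply: lt_le_trans dw.
Qed.

Lemma row_subE n (u v : 'rV[R[i]]_n) k : (u - v) 0 k = u 0 k - v 0 k.
Proof. by rewrite !mxE. Qed.

(** The columns of [P] are a basis of a complement of the span of those of [D]; they provide the
    linear coordinates [y] of the charts. Both identities are recorded because [d] and [r + (d - r)]
    are not convertible. *)
Lemma complement_inverse d r (D : 'M[R[i]]_(d, r)) : row_free D^T ->
  exists (P : 'M[R[i]]_(d, d - r)) (J' : 'M[R[i]]_(r + (d - r), d)),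
  row_mx D P *m J' = 1%:M /\ J' *m row_mx D P = 1%:M.
Proof.
move=> fD; pose B := (D^T^C)%MS.
have rD : \rank D^T = r by apply/eqP.
have rB : \rank B = (d - r)%N by rewrite mxrank_compl rD.
have rd : (r <= d)%N by rewrite -rD rank_leq_col.
pose PT := castmx (rB, erefl d) (row_base B).
have PTB : (PT :=: B)%MS.
  rewrite /PT; apply: (eqmx_trans (eqmx_cast _ _)); exact: eq_row_base.
have fullM : row_full (col_mx D^T PT).
  rewrite /row_full -addsmxE (adds_eqmx (eqmx_refl _) PTB).
  exact: addsmx_compl_full.
have freeM : row_free (col_mx D^T PT).
  by rewrite /row_free; move: fullM => /eqP ->; rewrite subnKC.
have [B1 B1P] := row_fullP fullM; have [B2 B2P] := row_freeP freeM.
have B12 : B1 = B2.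
  by rewrite -[B1]mulmx1 -B2P mulmxA B1P mul1mx.
exists PT^T, B1^T; have E : row_mx D PT^T = (col_mx D^T PT)^T by rewrite tr_col_mx trmxK.
by rewrite E -!trmx_mul B1P trmx1; split => //; rewrite B12 B2P trmx1.
Qed.

End RowComplement.

(** An open set is a submanifold of codimension [0]. The domain [D] may be smaller than [A], so that
    a chart can be shrunk until a given map sends it into a chart of the target. *)
Lemma exists_open_chart {R : realType} k (A D : set 'rV[R[i]]_k) :
  open D -> D `<=` A -> exists a : slice_chart k A,
  [/\ chart_dom a = D, forall z, chart_coord a z = z,
      forall x, chart_range a x -> D x & forall x, chart_param a x = x].
Proof.
move=> oD DA.
pose cod : set ('rV[R[i]]_k * 'rV[R[i]]_0)%type := [set p | D p.1].
pose to (z : 'rV[R[i]]_k) : ('rV[R[i]]_k * 'rV[R[i]]_0)%type := (z, 0).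
pose from (p : ('rV[R[i]]_k * 'rV[R[i]]_0)%type) : 'rV[R[i]]_k := p.1.
have bih : biholomorphism D cod to from.
  split.
  - split=> //; apply/openP_nr => p Dp; have [e e0 eD] := (openP_nr _).1 oD _ Dp.
    exists e => // q; rewrite [q - p]surjective_pairing nr_pair gt_max => /andP[+ _].
    exact: eD.
  - split=> [z _|p _]; last exact: differentiable_fst.
    by apply: differentiable_pair => //; exact: differentiable_cst.
  - by split.
  - by split=> // -[z e] _; rewrite /to /from /= (thinmx0 e).
have flat z : D z -> (A z <-> (to z).2 = 0) by move=> Dz; split=> // _; exact: DA.
by exists (SliceChart bih flat).
Qed.

(** * The limit maps of a generic polyhedron *)

Section Face.
Context {R : realType} {d N : nat}.
Local Notation V := 'rV[R[i]]_d.
Variables (Omega W : set V) (f : 'I_N -> V -> R[i]) (xi : V).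
Hypotheses (oW : open W) (clW : closure Omega `<=` W).
Hypothesis hW : forall i, holomorphic_on W (f i).
Hypothesis OmegaE : Omega = [set z | W z /\ forall i, `|f i z| < 1].
Hypothesis oO : open Omega.
Hypothesis generic : forall eta, boundary Omega eta ->
  forall s : seq 'I_N, uniq s -> (forall i, i \in s -> `|f i eta| = 1) ->
    free [seq gradient (f i) eta | i <- s].
Hypothesis bxi : boundary Omega xi.

Local Notation I := (active f xi).
Local Notation r := #|active f xi|.

Definition active_map (z : V) : 'rV[R[i]]_r := \row_k f (enum_val k) z.

Local Notation c := (active_map xi).

Lemma OmegaP z : Omega z <-> W z /\ forall i, nr (f i z) < 1.
Proof.
rewrite {1}OmegaE /=; split=> -[Wz fz]; split=> // i.
  by rewrite -normr_lt1_nr.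
by rewrite normr_lt1_nr.
Qed.

Lemma active_nr i : i \in I -> nr (f i xi) = 1.
Proof. by rewrite inE normr_eq1_nr => /eqP. Qed.

Lemma nr_active_xi k : nr (c 0 k) = 1.
Proof. by rewrite mxE active_nr// enum_valP. Qed.

Lemma active_mapP z : active_map z = c <-> forall i, i \in I -> f i z = f i xi.
Proof.
split=> [zc i iI|zc]; last by apply/rowP => k; rewrite !mxE zc// enum_valP.
have := congr1 (fun v : 'rV_r => v 0 (enum_rank_in iI i)) zc.
by rewrite !mxE enum_rankK_in.
Qed.

Lemma f_continuous i z : W z -> forall e : R, 0 < e ->
  exists2 e' : R, 0 < e' & forall w, nr (w - z) < e' -> nr (f i w - f i z) < e.
Proof.
move=> Wz e e0; have cf := differentiable_continuous (hW i Wz).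
have /nbhs_nr[e' e'0 e'P] := (@cvg_nr _ _ _ (nbhs z) (nbhs_filter z) _ _).1 cf e e0.
by exists e'.
Qed.

Lemma closure_nr_le1 z i : closure Omega z -> nr (f i z) <= 1.
Proof.
move=> cz; apply/ler_addgt0Pr => e e0.
have [e' e'0 e'P] := f_continuous i (clW cz) e0.
have [w /OmegaP[_ w1] wz] := (closureP_nr _ _).1 cz _ e'0.
have := w1 i; have := e'P _ wz; have := ler_nr_tri (f i z) (f i w) 0.
rewrite !subr0 nrB; lra.
Qed.

Lemma closure_Omega z : closure Omega z -> (forall i, nr (f i z) < 1) -> Omega z.
Proof. by move=> /clW Wz z1; apply/OmegaP. Qed.

Lemma closure_boundary z i : closure Omega z -> nr (f i z) = 1 -> boundary Omega z.
Proof.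
move=> cz z1; split=> // /interior_subset /OmegaP[_ /(_ i)].
by rewrite z1 ltxx.
Qed.

Lemma boundary_active : exists i, i \in I.
Proof.
apply: contrapT => nI; have [cxi] := bxi; apply.
suff Oxi : Omega xi by move: oO; rewrite openE; apply.
apply: closure_Omega => // i; rewrite lt_neqAle closure_nr_le1// andbT.
by apply/negP => /eqP i1; apply: nI; exists i; rewrite inE normr_eq1_nr i1.
Qed.

Definition stratum : set V :=
  [set eta | [/\ boundary Omega eta,
       forall i, i \in I -> f i eta = f i xi &
       forall i, i \notin I -> `|f i eta| < 1]].

Lemma faceE : face Omega f xi = connected_component stratum xi.
Proof. by []. Qed.

Lemma stratum_xi : stratum xi.
Proof.
split=> // i; rewrite inE normr_eq1_nr normr_lt1_nr => i1.
by rewrite lt_neqAle i1 closure_nr_le1//; case: bxi.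
Qed.

Lemma stratumP z : closure Omega z -> active_map z = c ->
  (forall i, i \notin I -> nr (f i z) < 1) -> stratum z.
Proof.
move=> cz /active_mapP zc z1; have [j jI] := boundary_active.
have bz : boundary Omega z.
  by apply: (closure_boundary cz (i := j)); rewrite (zc j jI) active_nr.
split; [exact: bz|exact: zc|move=> i iI].
by rewrite normr_lt1_nr; exact: z1.
Qed.

Definition chart_fun (P : 'M[R[i]]_(d, d - r)) (z : V) : 'rV[R[i]]_(r + (d - r)) :=
  row_mx (active_map z) (z *m P).

(* [Xi] is the inverse of the coordinates [chart_fun P], from the ball of radius
   [rho] about the image of [eta] into the ball of radius [s] about [eta].  As the
   norm is the sup norm, the former is a product of polydiscs. *)
Definition face_chart (eta : V) (P : 'M[R[i]]_(d, d - r)) (s rho : R)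
    (Xi : 'rV[R[i]]_(r + (d - r)) -> V) :=
  [/\ 0 < rho,
      forall z, nr (z - eta) < s -> [/\ W z, differentiable (chart_fun P) z &
        forall i, i \notin I -> nr (f i z) < 1],
      forall y, nr (y - chart_fun P eta) < rho ->
        [/\ nr (Xi y - eta) < s, chart_fun P (Xi y) = y & differentiable Xi y] &
      forall z, nr (z - eta) < s -> nr (chart_fun P z - chart_fun P eta) < rho ->
        Xi (chart_fun P z) = z].

Lemma differentiable_active_map z : W z -> differentiable active_map z.
Proof. by move=> Wz; apply: differentiable_row => k; exact: hW. Qed.

Lemma differentiable_chart_fun P z : W z -> differentiable (chart_fun P) z.
Proof.
move=> Wz; apply: differentiable_row_mx; first exact: differentiable_active_map.
exact: differentiable_mulmxr.
Qed.

(** The entries of gradients are conjugates of derivatives, so a linear relation between the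
    derivatives becomes, after conjugation of its coefficients, one between the gradients. Functions
    active at [xi] keep modulus one on the stratum, so genericity applies at [eta]. *)
Lemma row_free_gradients eta : stratum eta ->
  row_free (\matrix_(j < d, k < r) 'd (f (enum_val k)) eta (delta_mx 0 j))^T.
Proof.
move=> [beta etac _]; pose s : seq 'I_N := [seq enum_val k | k <- enum 'I_r].
have us : uniq s by rewrite map_inj_uniq ?enum_uniq//; exact: enum_val_inj.
have s1 i : i \in s -> `|f i eta| = 1.
  move=> /mapP[k _ ->]; apply/eqP; rewrite normr_eq1_nr etac ?enum_valP//.
  by rewrite active_nr// enum_valP.
have := generic beta us s1; rewrite -map_comp.
pose X := [tuple gradient (f (enum_val k)) eta | k < r].
have -> : map ((fun i => gradient (f i) eta) \o enum_val) (enum 'I_r) = X by [].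
have XE (k : 'I_r) : X`_k = gradient (f (enum_val k)) eta.
  by rewrite -(tnth_mktuple (fun k => gradient (f (enum_val k)) eta) k) (tnth_nth 0).
move=> /freeP fX; apply: inj_row_free => v v0; apply/rowP => k; rewrite mxE.
apply/eqP; rewrite -conjC_eq0; apply/eqP; apply: (fX (fun k => Num.conj (v 0 k))).
apply/rowP => j; rewrite summxE [RHS]mxE.
have := congr1 (fun w : 'rV_d => Num.conj (w 0 j)) v0.
rewrite /= !mxE rmorph0 rmorph_sum => {2}<-.
by apply: eq_bigr => i _; rewrite XE !mxE rmorphM.
Qed.

(** The derivative of [chart_fun P] at [eta] is [row_mx D P], which the choice of [P] makes
    invertible. The radius is also shrunk to keep the inactive functions below [1]. *)
Lemma exists_face_chart eta : stratum eta ->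
  exists P s rho Xi, face_chart eta P s rho Xi.
Proof.
move=> Se; have [[ceta _] etac eta1] := Se.
have Weta := clW ceta.
have [P [J' [JJ' J'J]]] := complement_inverse (row_free_gradients Se).
set D := \matrix_(j, k) _ in JJ' J'J.
have [s0 s00 s0W] := (openP_nr _).1 oW _ Weta.
have H i : exists e : R, 0 < e /\ forall w, nr (w - eta) < e -> i \notin I -> nr (f i w) < 1.
  have [iI|iI] := boolP (i \in I); first by exists 1.
  have := eta1 i iI; rewrite normr_lt1_nr -subr_gt0 => e0.
  have [e' e'0 e'P] := f_continuous i Weta e0.
  exists e'; split=> // w /e'P; have := ler_nr_tri (f i w) (f i eta) 0.
  rewrite !subr0; lra.
have [e eP] := choice H.
pose s1 := \big[Num.min/s0]_i e i.
have s10 : 0 < s1 by apply: lt_bigmin => // i _; have [] := eP i.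
have s1s0 : s1 <= s0 by exact: bigmin_le_id.
have s1e i : s1 <= e i by exact: bigmin_le_cond.
have good z : nr (z - eta) < s1 -> [/\ W z, differentiable (chart_fun P) z &
    forall i, i \notin I -> nr (f i z) < 1].
  move=> zs; have Wz : W z by apply: s0W; lra.
  split=> //; first exact: differentiable_chart_fun.
  move=> i iI; have [_] := eP i; apply=> //.
  by apply: lt_le_trans zs _.
have dPsi z : nr (z - eta) < s1 -> differentiable (chart_fun P) z by case/good.
have dJ : fderiv (chart_fun P) eta (mulmx^~ (row_mx D P)).
  split=> [t h|ep ep0]; first by rewrite scalemxAl.
  have Hk (k : 'I_r) : exists x : R, 0 < x /\ forall h, nr h < x ->
      nr (f (enum_val k) (eta + h) - f (enum_val k) eta - 'd (f (enum_val k)) eta h) <= ep * nr h.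
    have [x x0 xP] := (differentiable_fderiv (hW (enum_val k) Weta)).2 ep ep0.
    by exists x.
  have [dl dlP] := choice Hk.
  exists (\big[Num.min/1]_k dl k); first by apply: lt_bigmin => // k _; have [] := dlP k.
  move=> h hd.
  have -> : chart_fun P (eta + h) - chart_fun P eta - h *m row_mx D P =
      row_mx (active_map (eta + h) - active_map eta - h *m D) 0.
    rewrite /chart_fun mul_mx_row !opp_row_mx !add_row_mx; congr row_mx.
    by rewrite mulmxDl [_ *m P + _ *m P]addrC addrK subrr.
  apply: nr_row_le => [|j]; first by rewrite mulr_ge0 ?nr_ge0// ltW.
  rewrite -(splitK j); case: (fintype.split j) => k /=; last first.
    by rewrite row_mxEr mxE nr0 mulr_ge0 ?nr_ge0// ltW.
  rewrite row_mxEl !mxE.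
  have [_ /(_ h)] := dlP k.
  have -> : \sum_j0 h 0 j0 * D j0 k = 'd (f (enum_val k)) eta h.
    rewrite {2}(row_sum_delta h) linear_sum; apply: eq_bigr => i _.
    by rewrite linearZ /= mxE.
  apply; apply: lt_le_trans hd _; exact: bigmin_le_cond.
have [s [rho [Xi [/andP[s_gt0 ss1] rho0 XiP Xi2]]]] :=
  inverse_function JJ' J'J s10 dPsi dJ.
exists P, s, rho, Xi; split => // z zs; apply: good; exact: lt_le_trans zs ss1.
Qed.

(** * The limit maps of a sequence of automorphisms *)

Section Limits.
Context (U : set_system nat) {UU : UltraFilter U}.
Variable M : R.
Hypothesis bO : forall z, Omega z -> nr z <= M.
Hypothesis cO : connected Omega.
Variables (phi psi : nat -> V -> V) (x : V).
Hypothesis hphi : forall n, biholomorphism Omega Omega (phi n) (psi n).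
Hypotheses (Ox : Omega x) (phix : (fun n => phi n x) @ U --> xi).

Lemma phi_in n z : Omega z -> Omega (phi n z).
Proof. by case: (hphi n) => _ _ [h _] _; exact: h. Qed.

Lemma psi_in n z : Omega z -> Omega (psi n z).
Proof. by case: (hphi n) => _ _ [_ h] _; exact: h. Qed.

Lemma phiK n z : Omega z -> psi n (phi n z) = z.
Proof. by case: (hphi n) => _ _ _ [h _]; exact: h. Qed.

Lemma psiK n z : Omega z -> phi n (psi n z) = z.
Proof. by case: (hphi n) => _ _ _ [_ h]; exact: h. Qed.

Lemma differentiable_phi n z : Omega z -> differentiable (phi n) z.
Proof. by case: (hphi n) => _ [h _] _ _; exact: h. Qed.

Lemma differentiable_psi n z : Omega z -> differentiable (psi n) z.
Proof. by case: (hphi n) => _ [_ h] _ _; exact: h. Qed.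

Lemma Omega_W z : Omega z -> W z.
Proof. by move=> /OmegaP[]. Qed.

Lemma Omega_ball z : Omega z ->
  exists2 s : R, 0 < s & forall w, nr (w - z) < s -> Omega w.
Proof. exact: (openP_nr _).1 oO z. Qed.

Lemma active_map_lt1 z : Omega z -> forall k, nr (active_map z 0 k) < 1.
Proof. by move=> /OmegaP[_ h] k; rewrite mxE. Qed.

Definition active_seq n : 'rV[R[i]]_r := active_map (phi n x).

Lemma active_seq_lt1 n k : nr (active_seq n 0 k) < 1.
Proof. by apply: active_map_lt1; exact: phi_in. Qed.

Lemma active_seq_cvg : active_seq @ U --> c.
Proof.
apply: (ultra_cvg_comp phix); apply: differentiable_active_map.
by apply: clW; case: bxi.
Qed.

(* The disc automorphisms are normalised so that [rescaled n x = 0]. *)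
Definition rescaled n (z : V) : 'rV[R[i]]_r :=
  \row_k mobius (active_seq n 0 k) (active_map (phi n z) 0 k).

Lemma rescaled_hol n z : Omega z ->
  differentiable (rescaled n) z /\ nr (rescaled n z) <= 1.
Proof.
move=> Oz; have Op := phi_in n Oz; have a1 := active_seq_lt1 n; split.
  apply: differentiable_row => k; apply: differentiable_mobius.
    apply: (@differentiable_comp _ _ _ _ (phi n) (fun w => active_map w 0 k)).
      exact: differentiable_phi.
    by apply: differentiable_coordf; apply: differentiable_active_map; exact: Omega_W.
  by apply: mobius_den_neq0 => //; rewrite ltW// active_map_lt1.
apply: nr_row_le => // k; rewrite mxE nr_mobius_le1//.
by rewrite ltW// active_map_lt1.
Qed.

Lemma exists_limits : exists (Phi : V -> V) (F : V -> 'rV[R[i]]_r),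
  (forall z, Omega z -> (fun n => phi n z) @ U --> Phi z /\ differentiable Phi z) /\
  (forall z, Omega z -> (fun n => rescaled n z) @ U --> F z /\ differentiable F z).
Proof.
have [Phi PhiP] : exists Phi : V -> V, forall z, Omega z ->
    (fun n => phi n z) @ U --> Phi z /\ differentiable Phi z.
  apply: (@exists_ultra_limit R U UU d d phi Omega M) => z /Omega_ball[s s0 sO].
  exists s => //; apply: filterS (filterT : U setT) => n _ w /sO Ow.
  by split; [exact: differentiable_phi|apply: bO; exact: phi_in].
have [F FP] : exists F : V -> 'rV[R[i]]_r, forall z, Omega z ->
    (fun n => rescaled n z) @ U --> F z /\ differentiable F z.
  apply: (@exists_ultra_limit R U UU d _ rescaled Omega 1) => z /Omega_ball[s s0 sO].
  by exists s => //; apply: filterS (filterT : U setT) => n _ w /sO; exact: rescaled_hol.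
by exists Phi, F.
Qed.

Section LimitMaps.
Variables (Phi : V -> V) (F : V -> 'rV[R[i]]_r).
Hypothesis PhiP : forall z, Omega z ->
  (fun n => phi n z) @ U --> Phi z /\ differentiable Phi z.
Hypothesis FP : forall z, Omega z ->
  (fun n => rescaled n z) @ U --> F z /\ differentiable F z.

Lemma Phi_x : Phi x = xi.
Proof. by have [h _] := PhiP Ox; exact: (ultra_cvg_unique h phix). Qed.

Lemma F_x : F x = 0.
Proof.
have [h _] := FP Ox; apply: (ultra_cvg_unique h).
apply/cvg_nr => e e0; apply: filterS (filterT : U setT) => n _ /=.
suff -> : rescaled n x = 0 by rewrite subrr nr0.
by apply/rowP => k; rewrite !mxE /mobius subrr mul0r.
Qed.

Lemma Phi_closure z : Omega z -> closure Omega (Phi z).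
Proof.
move=> Oz; have [h _] := PhiP Oz; apply: (ultra_cvg_closure h).
by apply: filterS (filterT : U setT) => n _; exact: phi_in.
Qed.

Lemma f_Phi_hol i z : Omega z ->
  differentiable (fun w => f i (Phi w)) z /\ nr (f i (Phi z)) <= 1.
Proof.
move=> Oz; split; last by apply: closure_nr_le1; exact: Phi_closure.
apply: (@differentiable_comp _ _ _ _ Phi (f i)); first by have [] := PhiP Oz.
by apply: hW; apply: clW; exact: Phi_closure.
Qed.

Lemma Phi_active i z : i \in I -> Omega z -> f i (Phi z) = f i xi.
Proof.
move=> iI Oz; rewrite -[in RHS]Phi_x.
apply: (max_principle oO cO (f_Phi_hol i) Ox _ Oz).
by rewrite Phi_x active_nr.
Qed.

(** If an inactive [f i] reached modulus one along [Phi], it would be constant there and hence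
    active at [Phi x = xi]. *)
Lemma Phi_stratum z : Omega z -> stratum (Phi z).
Proof.
move=> Oz; apply: stratumP; first exact: Phi_closure.
  by apply/active_mapP => i iI; exact: Phi_active.
move=> i iI; rewrite lt_neqAle closure_nr_le1 ?andbT; last exact: Phi_closure.
apply/negP => /eqP i1; move/negP: iI; apply.
have := max_principle oO cO (f_Phi_hol i) Oz i1 Ox.
by rewrite Phi_x inE normr_eq1_nr => ->; rewrite i1.
Qed.

Lemma Phi_face z : Omega z -> face Omega f xi (Phi z).
Proof.
move=> Oz; rewrite faceE.
apply: (@connected_component_max _ stratum (Phi @` Omega)); last exact: (ex_intro2 _ _ z Oz
  erefl).
- exact: (ex_intro2 _ _ x Ox Phi_x).
- by move=> _ [w Ow <-]; exact: Phi_stratum.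
- by apply: (connected_image cO) => w /PhiP[].
Qed.

Lemma F_lt1 z : Omega z -> nr (F z) < 1.
Proof.
move=> Oz; apply: nr_row_lt => // k.
have FO w : Omega w -> differentiable (fun w => F w 0 k) w /\ nr (F w 0 k) <= 1.
  move=> Ow; have [h dF] := FP Ow; split; first exact: differentiable_coordf.
  apply: le_trans (nr_coord_le _ _) _; apply: (ultra_cvg_le h).
  by apply: filterS (filterT : U setT) => n _; have [] := rescaled_hol n Ow.
have [_] := FO z Oz; rewrite le_eqVlt => /orP[/eqP k1|//].
have := max_principle oO cO FO Oz k1 Ox.
by rewrite /= F_x mxE => k0; move: k1; rewrite -k0 nr0 => /esym/eqP; rewrite oner_eq0.
Qed.

(** * Pullbacks through one chart of the face *)

Section Chart.
Variables (eta : V) (P : 'M[R[i]]_(d, d - r)) (s rho : R)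
  (Xi : 'rV[R[i]]_(r + (d - r)) -> V).
Hypothesis ch : face_chart eta P s rho Xi.
Hypothesis feta : face Omega f xi eta.

Let rho0 : 0 < rho. Proof. by case: ch. Qed.

Lemma stratum_eta : stratum eta.
Proof. exact: (@connected_component_sub _ stratum xi). Qed.

Lemma active_eta : active_map eta = c.
Proof. by apply/active_mapP => i iI; have [_ h _] := stratum_eta; exact: h. Qed.

Lemma chart_ball (w : 'rV[R[i]]_r) (y : 'rV[R[i]]_(d - r)) :
  nr (row_mx w y - chart_fun P eta) < rho <->
  nr (w - c) < rho /\ nr (y - eta *m P) < rho.
Proof.
rewrite /chart_fun active_eta opp_row_mx add_row_mx.
exact: nr_row_mx_lt.
Qed.

Definition face_param (y : 'rV[R[i]]_(d - r)) : V := Xi (row_mx c y).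

Lemma chart_inv_active (w : 'rV[R[i]]_r) (y : 'rV[R[i]]_(d - r)) :
  nr (w - c) < rho -> nr (y - eta *m P) < rho ->
  [/\ W (Xi (row_mx w y)), active_map (Xi (row_mx w y)) = w,
      Xi (row_mx w y) *m P = y & forall i, i \notin I -> nr (f i (Xi (row_mx w y))) < 1].
Proof.
move=> wr yr; have [_ cW cX _] := ch.
have [zs E _] := cX _ ((chart_ball w y).2 (conj wr yr)).
have [Wz _ z1] := cW _ zs; have [E1 E2] := eq_row_mx E.
by split.
Qed.

Lemma chart_inv_Omega (w : 'rV[R[i]]_r) (y : 'rV[R[i]]_(d - r)) :
  nr (w - c) < rho -> nr (y - eta *m P) < rho -> nr w < 1 ->
  Omega (Xi (row_mx w y)).
Proof.
move=> wr yr w1; have [Wz E _ z1] := chart_inv_active wr yr.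
apply/OmegaP; split=> // i; have [iI|] := boolP (i \in I); last exact: z1.
have := congr1 (fun v : 'rV_r => v 0 (enum_rank_in iI i)) E.
rewrite mxE enum_rankK_in// => ->.
by rewrite (le_lt_trans (nr_coord_le _ _)).
Qed.

(** The point at stake is membership in the closure: moving [c] radially to [(1 - t) * c] makes all
    active values smaller than [1] in modulus, and so gives nearby points of [Omega]. *)
Lemma face_param_stratum y : nr (y - eta *m P) < rho -> stratum (face_param y).
Proof.
move=> yr; have cr : nr (c - c) < rho by rewrite subrr nr0.
have [Wz E _ z1] := chart_inv_active cr yr.
apply: stratumP; [|exact: E|exact: z1].
apply/closureP_nr => e e0.
have [_ _ cX _] := ch.
have [_ _ dX] := cX _ ((chart_ball c y).2 (conj cr yr)).
have cvX := differentiable_continuous dX.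
have /nbhs_nr[e' e'0 e'P] := (@cvg_nr _ _ _ (nbhs (row_mx c y)) (nbhs_filter _) _ _).1 cvX e e0.
pose t := Num.min (2^-1) (Num.min (e' / 2) (rho / 2)).
have t0 : 0 < t by rewrite !lt_min invr_gt0 ltr0n !divr_gt0.
have t1 : t <= 2^-1 by rewrite ge_min lexx.
have te : t <= e' / 2 by rewrite !ge_min lexx orbT.
have tr : t <= rho / 2 by rewrite !ge_min lexx !orbT.
have nc : nr c <= 1 by apply: nr_row_le => // k; rewrite nr_active_xi.
pose w := (1 - t)%:C *: c.
have wc : nr (w - c) <= t.
  rewrite /w rmorphB rmorph1 scalerBl scale1r addrAC subrr add0r nrN nrZ nr_real.
  by rewrite ger0_norm ?(ltW t0)// ler_piMr// ltW.
exists (Xi (row_mx w y)).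
  apply: chart_inv_Omega => //; first by lra.
  rewrite nrZ nr_real ger0_norm; last by lra.
  have : (1 - t) * nr c <= (1 - t) * 1 by rewrite ler_wpM2l//; lra.
  lra.
apply: e'P; rewrite opp_row_mx add_row_mx subrr nr_row_mx_lt// nr0; split => //.
lra.
Qed.

Lemma face_param_face y : nr (y - eta *m P) < rho -> face Omega f xi (face_param y).
Proof.
move=> yr; rewrite faceE.
have ex : face_param (eta *m P) = eta.
  have [_ cW _ cX] := ch; rewrite /face_param -active_eta; apply: cX.
    have [_ _ cX2 _] := ch; have [|h _ _] := cX2 (chart_fun P eta).
      by rewrite subrr nr0.
    by rewrite subrr nr0 (le_lt_trans (nr_ge0 _) h).
  by rewrite subrr nr0.
apply: (@connected_component_trans _ stratum eta); first exact: feta.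
apply: (@connected_component_max _ stratum (face_param @` [set y | nr (y - eta *m P) < rho])).
- by exists (eta *m P); [rewrite /= subrr nr0|exact: ex].
- by move=> _ [z /= zr <-]; exact: face_param_stratum.
- apply: connected_image => [|z /= zr].
    apply: (@connected_star _ _ _ (eta *m P)) => z t /= zr /andP[t0 t1].
    rewrite addrAC subrr add0r nrZ nr_real ger0_norm//.
    by rewrite (le_lt_trans _ zr)// ler_piMl// nr_ge0.
  have cr : nr (c - c) < rho by rewrite subrr nr0.
  have [_ _ cX _] := ch.
  have [_ _ dX] := cX _ ((chart_ball c z).2 (conj cr zr)).
  apply: (@differentiable_comp _ _ _ _ (fun y => row_mx c y) Xi); last exact: dX.
  by apply: differentiable_row_mx => //; exact: differentiable_cst.
- exact: (ex_intro2 _ _ y yr erefl).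
Qed.

Lemma face_paramK z : nr (z - eta) < s -> nr (chart_fun P z - chart_fun P eta) < rho ->
  active_map z = c -> nr (z *m P - eta *m P) < rho /\ face_param (z *m P) = z.
Proof.
move=> zs zr zc; have [_ _ _ cX] := ch; split; last by rewrite /face_param -zc; exact: cX.
by have [_] := (chart_ball _ _).1 zr.
Qed.

(** The first block fills the whole unit polydisc, not a small ball about [c]: it holds rescaled
    values, which [unrescale n] brings near [c] only for [U]-almost all [n]. *)
Definition patch : set 'rV[R[i]]_(r + (d - r)) :=
  [set p | nr (lsubmx p) < 1 /\ nr (rsubmx p - eta *m P) < rho].

Lemma patch_ball p : patch p -> exists (e t : R), [/\ 0 < e, t < 1 &
  forall q, nr (q - p) < e -> nr (lsubmx q) <= t /\ nr (rsubmx q - eta *m P) < rho].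
Proof.
move=> [p1 p2].
pose e := Num.min ((1 - nr (lsubmx p)) / 2) (rho - nr (rsubmx p - eta *m P)).
exists e, ((1 + nr (lsubmx p)) / 2); split; last 1 first.
- move=> q; rewrite lt_min => /andP[q1 q2]; split.
    have := ler_nr_tri (lsubmx q) (lsubmx p) 0; rewrite !subr0.
    have := nr_lsubmx_le (q - p); rewrite linearB /=; lra.
  have := ler_nr_tri (rsubmx q) (rsubmx p) (eta *m P).
  have := nr_rsubmx_le (q - p); rewrite linearB /=; lra.
- by rewrite lt_min subr_gt0 p2 andbT divr_gt0 ?subr_gt0.
- lra.
Qed.

Lemma patch_open : open patch.
Proof.
apply/openP_nr => p /patch_ball[e [t [e0 t1 et]]]; exists e => // q /et[q1 q2].
by split; [exact: le_lt_trans t1|].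
Qed.

Lemma patch_connected : connected patch.
Proof.
apply: (@connected_star _ _ _ (row_mx 0 (eta *m P))) => p t [p1 p2] /andP[t0 t1].
split; rewrite linearD linearZ linearB /=.
  rewrite row_mxKl add0r subr0 nrZ nr_real ger0_norm//.
  by rewrite (le_lt_trans _ p1)// ler_piMl// nr_ge0.
rewrite row_mxKr addrAC subrr add0r nrZ nr_real ger0_norm//.
by rewrite (le_lt_trans _ p2)// ler_piMl// nr_ge0.
Qed.

(* Inverse of the disc automorphisms of [rescaled]. *)
Definition unrescale n (w : 'rV[R[i]]_r) : 'rV[R[i]]_r :=
  \row_k mobius (- active_seq n 0 k) (w 0 k).

Lemma unrescale_lt1 n w : nr w < 1 -> nr (unrescale n w) < 1.
Proof.
move=> w1; apply: nr_row_lt => // k; rewrite mxE nr_mobius_lt1//.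
  by rewrite nrN active_seq_lt1.
exact: le_lt_trans (nr_coord_le _ _) w1.
Qed.

Lemma rescaleK n (w : 'rV[R[i]]_r) : nr w < 1 ->
  \row_k mobius (active_seq n 0 k) (unrescale n w 0 k) = w.
Proof.
move=> w1; apply/rowP => k; rewrite mxE [unrescale n w 0 k]mxE.
exact: mobiusK (active_seq_lt1 n k) (le_lt_trans (nr_coord_le _ _) w1).
Qed.

Lemma unrescaleK n z : Omega z -> unrescale n (rescaled n z) = active_map (phi n z).
Proof.
move=> Oz; apply/rowP => k; rewrite mxE [rescaled n z 0 k]mxE.
have a1 : nr (- active_seq n 0 k) < 1 by rewrite nrN active_seq_lt1.
have := mobiusK a1 (active_map_lt1 (phi_in n Oz) k).
by rewrite opprK.
Qed.

(* The orbit tends to the boundary, where the inverse disc automorphisms become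
   constant on compact subsets of the polydisc. *)
Lemma unrescale_cvg (t e : R) : t < 1 -> 0 < e ->
  U [set n | forall w, nr w <= t -> nr (unrescale n w - c) < e].
Proof.
move=> t1 e0; have t2 : 0 < 1 - t by rewrite subr_gt0.
(* For [a] an entry of [active_seq n], [1 - nr a ^ 2 <= 2 * (1 - nr a) <= 2 * del], so the second
   bound makes the distance in [mobiusN_sub] at most [e / 2]; the first leaves [e / 4] for the
   distance from [a] to the entry of [c]. *)
pose del := Num.min (e / 4) (e * (1 - t) / 4).
have del0 : 0 < del by rewrite lt_min !divr_gt0// mulr_gt0.
have /cvg_nr/(_ _ del0) := active_seq_cvg.
apply: filterS => n /= an w wt; apply: nr_row_lt => // k.
rewrite row_subE [unrescale n w 0 k]mxE.
have := le_lt_trans (nr_coord_le _ k) an; rewrite row_subE lt_min => /andP[d1 d2].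
have wk : nr (w 0 k) <= t by exact: le_trans (nr_coord_le _ _) wt.
have a1 := active_seq_lt1 n k.
have h := mobiusN_sub a1 (le_lt_trans wk t1).
have ck := nr_active_xi k.
have := ler_nr_tri (c 0 k) (active_seq n 0 k) 0; rewrite !subr0 ck [nr (c 0 k - _)]nrB => a2.
have XY := ler_nr_tri (mobius (- active_seq n 0 k) (w 0 k)) (active_seq n 0 k) (c 0 k).
apply: le_lt_trans XY _; move: h; set Y := nr (mobius _ _ - _) => h.
suff : Y <= e / 2 by lra.
apply: le_trans h _; rewrite ler_pdivrMr; last by lra.
move: wk d1 d2 a1 a2; have := nr_ge0 (active_seq n 0 k).
move: (nr (w 0 k)) (nr (active_seq n 0 k)) (nr (active_seq n 0 k - c 0 k)) => W0 a D.
move=> a0 wk d1 d2 a1 a2.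
have : e / 2 * (1 - t) <= e / 2 * (1 - W0) by rewrite ler_wpM2l ?divr_ge0 ?(ltW e0)//; lra.
nra.
Qed.

(** Meaningful only for the [n] that [unrescale_cvg] supplies, a set of [U] depending on [p]; for
    other [n], [Xi] may be evaluated outside its chart. *)
Definition pullback n (p : 'rV[R[i]]_(r + (d - r))) : V :=
  psi n (Xi (row_mx (unrescale n (lsubmx p)) (rsubmx p))).

Lemma chart_point_Omega n p : patch p -> nr (unrescale n (lsubmx p) - c) < rho ->
  Omega (Xi (row_mx (unrescale n (lsubmx p)) (rsubmx p))).
Proof.
by move=> [p1 p2] nc; apply: chart_inv_Omega => //; exact: unrescale_lt1.
Qed.

Lemma differentiable_pullback n p : patch p -> nr (unrescale n (lsubmx p) - c) < rho ->
  differentiable (pullback n) p.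
Proof.
move=> pp nc; have Op := chart_point_Omega pp nc; have [p1 p2] := pp.
apply: (@differentiable_comp _ _ _ _
  (fun p => Xi (row_mx (unrescale n (lsubmx p)) (rsubmx p))) (psi n)); last first.
  exact: differentiable_psi.
apply: (@differentiable_comp _ _ _ _
  (fun p => row_mx (unrescale n (lsubmx p)) (rsubmx p)) Xi); last first.
  have [_ _ cX _] := ch.
  by have [_ _ dX] := cX _ ((chart_ball _ _).2 (conj nc p2)).
apply: differentiable_row_mx; last exact: differentiable_rsubmx.
apply: differentiable_row => k; apply: differentiable_mobius.
  by apply: differentiable_coordf; exact: differentiable_lsubmx.
apply: mobius_den_neq0; first by rewrite nrN active_seq_lt1.
by apply: le_trans (nr_coord_le _ _) _; exact: ltW.
Qed.

Lemma pullback_bounded_hol p : patch p ->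
  exists2 e : R, 0 < e & U [set n | bounded_hol (pullback n) p e M].
Proof.
move=> /patch_ball[e [t [e0 t1 et]]]; exists e => //.
apply: filterS (unrescale_cvg t1 rho0) => n nw q /et[q1 q2].
have pq : patch q by split=> //; exact: le_lt_trans t1.
split; first by apply: differentiable_pullback => //; exact: nw.
apply: bO; apply: psi_in; apply: chart_point_Omega => //; exact: nw.
Qed.

Lemma eventually_chart_point p : patch p ->
  U [set n | Omega (Xi (row_mx (unrescale n (lsubmx p)) (rsubmx p)))].
Proof.
move=> pp; have [p1 p2] := pp.
apply: filterS (unrescale_cvg p1 rho0) => n nw.
by apply: chart_point_Omega => //; exact: nw.
Qed.

Lemma exists_pullback_limit : exists G : 'rV[R[i]]_(r + (d - r)) -> V,
  forall p, patch p -> (fun n => pullback n p) @ U --> G p /\ differentiable G p.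
Proof. exact: (exists_ultra_limit pullback_bounded_hol). Qed.

Section PullbackLimit.
Variable G : 'rV[R[i]]_(r + (d - r)) -> V.
Hypothesis GP : forall p, patch p ->
  (fun n => pullback n p) @ U --> G p /\ differentiable G p.

Lemma patch_mx z y : Omega z -> nr (y - eta *m P) < rho -> patch (row_mx (F z) y).
Proof. by move=> Oz yr; split; rewrite ?row_mxKl ?row_mxKr//; exact: F_lt1. Qed.

(** At the moving point [row_mx (rescaled n z) (phi n z *m P)] the pullback equals [z] exactly for
    [U]-almost all [n]. This point tends to [row_mx (F z) y], and [ultra_limit_seq] identifies the
    limit. *)
Lemma pullback_limit_left z y : Omega z -> nr (y - eta *m P) < rho ->
  Phi z = face_param y -> G (row_mx (F z) y) = z.
Proof.
move=> Oz yr Phiz; have pp := patch_mx Oz yr; have [Gp _] := GP pp.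
have [e e0 eM] := pullback_bounded_hol pp.
have [phiz _] := PhiP Oz; have [Fz _] := FP Oz.
have cr : nr (c - c) < rho by rewrite subrr nr0.
have [Wy Ay Py _] := chart_inv_active cr yr.
have phizP : (fun n => phi n z *m P) @ U --> y.
  rewrite -Py -[Xi _]/(face_param y) -Phiz.
  exact: (ultra_cvg_comp phiz (differentiable_mulmxr P (Phi z))).
have lim := ultra_limit_seq (UU := UU) e0 eM (ultra_cvg_row_mx (UU := UU) Fz phizP) Gp.
apply: (ultra_cvg_unique lim); apply/cvg_nr => e1 e10.
have [_ cW cX cX2] := ch.
have [zs Ey _] := cX _ ((chart_ball c y).2 (conj cr yr)).
have e20 : 0 < s - nr (Phi z - eta) by rewrite Phiz subr_gt0.
have cphiz : (fun n => chart_fun P (phi n z)) @ U --> chart_fun P (Phi z).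
  apply: (ultra_cvg_comp phiz); apply: differentiable_chart_fun.
  by apply: clW; exact: Phi_closure.
have e30 : 0 < rho - nr (chart_fun P (Phi z) - chart_fun P eta).
  by rewrite subr_gt0 Phiz /face_param Ey; apply/chart_ball.
move/cvg_nr: cphiz => /(_ _ e30) u2; move/cvg_nr: phiz => /(_ _ e20) u1.
apply: filterS (filterI u1 u2) => n /= [n1 n2].
suff -> : pullback n (row_mx (rescaled n z) (phi n z *m P)) = z by rewrite subrr nr0.
rewrite /pullback row_mxKl row_mxKr unrescaleK// -[row_mx _ _]/(chart_fun P (phi n z)).
rewrite cX2 ?phiK//.
- by rewrite (le_lt_trans (ler_nr_tri _ (Phi z) _))// -ltrBrDr.
- by rewrite (le_lt_trans (ler_nr_tri _ (chart_fun P (Phi z)) _))// -ltrBrDr.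
Qed.

(** The maps [rescaled n] and [phi n] are controlled uniformly near points of [Omega]; with [G p]
    there, they may be evaluated at the moving point [pullback n p]. *)
Lemma pullback_limit_right p : patch p -> Omega (G p) ->
  F (G p) = lsubmx p /\ Phi (G p) = face_param (rsubmx p).
Proof.
move=> pp OG; have [Gp _] := GP pp; have [p1 p2] := pp.
have [e e0 eO] := Omega_ball OG.
have eventO := eventually_chart_point pp.
have [phiG _] := PhiP OG; have [FG _] := FP OG.
have cr : nr (c - c) < rho by rewrite subrr nr0.
have FU : Filter U by exact: filter_filter.
split.
- have hol : U [set n | bounded_hol (rescaled n) (G p) e 1].
    by apply: filterS (filterT : U setT) => n _ w /eO; exact: rescaled_hol.
  apply: (ultra_cvg_unique (ultra_limit_seq (UU := UU) e0 hol Gp FG)).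
  apply/cvg_nr => e1 e10.
  apply: filterS (filterI eventO (unrescale_cvg p1 rho0)) => n /= [On nw].
  suff -> : rescaled n (pullback n p) = lsubmx p by rewrite subrr nr0.
  rewrite /rescaled /pullback psiK//.
  have [_ -> _ _] := chart_inv_active (nw _ (lexx _)) p2.
  exact: rescaleK.
- have hol : U [set n | bounded_hol (phi n) (G p) e M].
    apply: filterS (filterT : U setT) => n _ w /eO Ow.
    by split; [exact: differentiable_phi|apply: bO; exact: phi_in].
  apply: (ultra_cvg_unique (ultra_limit_seq (UU := UU) e0 hol Gp phiG)).
  have cv : (fun n => row_mx (unrescale n (lsubmx p)) (rsubmx p)) @ U --> row_mx c (rsubmx p).
    apply: ultra_cvg_row_mx; last exact: cvg_cst.
    apply/cvg_nr => e1 e10; apply: filterS (unrescale_cvg p1 e10) => n /= nw.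
    exact: nw.
  have [_ _ cX _] := ch; have [_ _ dX] := cX _ ((chart_ball _ _).2 (conj cr p2)).
  have := ultra_cvg_comp cv dX => /cvg_nr cvX; apply/cvg_nr => e1 e10.
  apply: filterS (filterI eventO (cvX _ e10)) => n /= [On nX].
  by rewrite /pullback psiK.
Qed.

Lemma pullback_limit_Omega p0 : patch p0 -> Omega (G p0) ->
  forall p, patch p -> Omega (G p).
Proof.
move=> pp0 OG0 p pp.
have clG q : patch q -> closure Omega (G q).
  move=> pq; have [Gq _] := GP pq; apply: (ultra_cvg_closure Gq).
  by apply: filterS (eventually_chart_point pq) => n; exact: psi_in.
have fG i q : patch q -> differentiable (fun q => f i (G q)) q /\ nr (f i (G q)) <= 1.
  move=> pq; split; last by apply: closure_nr_le1; exact: clG.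
  apply: (@differentiable_comp _ _ _ _ G (f i)); first by have [] := GP pq.
  by apply: hW; apply: clW; exact: clG.
apply: closure_Omega; first exact: clG.
move=> i; have [_] := fG i p pp; rewrite le_eqVlt => /orP[/eqP i1|//].
have := max_principle patch_open patch_connected (fG i) pp i1 pp0.
move: OG0 => /OmegaP[_ /(_ i)] h E.
by rewrite E i1 ltxx in h.
Qed.

End PullbackLimit.

End Chart.

(** * From single charts to the whole face *)

Definition chart_nbhd (eta : V) (P : 'M[R[i]]_(d, d - r)) (s rho : R) : set V :=
  [set z | nr (z - eta) < s /\ nr (chart_fun P z - chart_fun P eta) < rho].

Lemma chart_nbhd_open eta P s rho Xi :
  face_chart eta P s rho Xi -> open (chart_nbhd eta P s rho).
Proof.
move=> [_ cW _ _]; apply: open_preimage (open_ball_nr eta s)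
  (open_ball_nr (chart_fun P eta) rho) _ => z zs.
by have [_ dz _] := cW _ zs.
Qed.

Lemma chart_nbhd_eta eta P s rho Xi :
  face_chart eta P s rho Xi -> chart_nbhd eta P s rho eta.
Proof.
move=> [rho0 _ cX _]; rewrite /chart_nbhd /= !subrr !nr0; split=> //.
by have [|h _ _] := cX (chart_fun P eta); rewrite ?subrr ?nr0//; exact: le_lt_trans (nr_ge0 _) h.
Qed.

Lemma face_active eta : face Omega f xi eta -> active_map eta = c.
Proof.
by move=> /(@connected_component_sub _ stratum xi)[_ h _]; apply/active_mapP.
Qed.

(** A point [z0] with image in the chart is a value of [G] by [pullback_limit_left]; so all values
    of [G] lie in [Omega], and [G] is a right inverse over the whole patch. *)
Lemma chart_surjective eta P s rho Xi : face_chart eta P s rho Xi ->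
  face Omega f xi eta ->
  (exists z, Omega z /\ chart_nbhd eta P s rho (Phi z)) ->
  forall w b, nr w < 1 -> face Omega f xi b -> chart_nbhd eta P s rho b ->
  exists z, [/\ Omega z, F z = w & Phi z = b].
Proof.
move=> ch feta [z0 [Oz0 [z0s z0r]]] w b w1 fb [bs br].
have [G GP] := exists_pullback_limit ch feta.
have [y0r y0E] := face_paramK ch feta z0s z0r (face_active (Phi_face Oz0)).
have [yr yE] := face_paramK ch feta bs br (face_active fb).
have pp0 : patch eta P rho (row_mx (F z0) (Phi z0 *m P)) by exact: patch_mx.
have E0 := pullback_limit_left ch feta GP Oz0 y0r (esym y0E).
have pp : patch eta P rho (row_mx w (b *m P)) by split; rewrite ?row_mxKl ?row_mxKr.
have OG : Omega (G (row_mx w (b *m P))).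
  by apply: (pullback_limit_Omega ch feta GP pp0) => //; rewrite E0.
have [E1 E2] := pullback_limit_right ch feta GP pp OG.
exists (G (row_mx w (b *m P))); split=> //; first by rewrite E1 row_mxKl.
by rewrite E2 row_mxKr.
Qed.

(** Connectedness is applied to the image of [Phi] alone: as soon as [Phi] meets a chart,
    [chart_surjective] reaches every pair [(w, b)] over it. The start is [Phi x = xi]. *)
Lemma limit_surjective w eta : nr w < 1 -> face Omega f xi eta ->
  exists z, [/\ Omega z, F z = w & Phi z = eta].
Proof.
move=> w1; pose E := [set eta | exists z, Omega z /\ Phi z = eta].
have chart b : face Omega f xi b -> exists P s rho Xi, face_chart b P s rho Xi.
  by move=> /(@connected_component_sub _ stratum xi) /exists_face_chart.
have faceE' : face Omega f xi `<=` E.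
  apply: connected_sub; first exact: component_connected.
    exists xi; split; last by exists x; split => //; exact: Phi_x.
    exact: (@connected_component_refl _ stratum xi stratum_xi).
  move=> a fa; have [P [s [rho [Xi ch]]]] := chart a fa.
  exists (chart_nbhd a P s rho); split.
  - exact: chart_nbhd_open ch.
  - exact: chart_nbhd_eta ch.
  - move=> [e [fe ne [z0 [Oz0 Pz0]]]] b fb nb.
    have ez : exists z, Omega z /\ chart_nbhd a P s rho (Phi z) by exists z0; rewrite Pz0.
    have [z [Oz _ Pz]] := chart_surjective ch fa ez w1 fb nb.
    by exists z.
move=> feta; have [z0 [Oz0 Pz0]] := faceE' _ feta.
have [P [s [rho [Xi ch]]]] := chart eta feta.
have neta := chart_nbhd_eta ch.
have ez : exists z, Omega z /\ chart_nbhd eta P s rho (Phi z) by exists z0; rewrite Pz0.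
have [z [Oz Fz Pz]] := chart_surjective ch feta ez w1 feta neta.
by exists z; split.
Qed.

Lemma limit_injective z z' : Omega z -> Omega z' -> F z = F z' -> Phi z = Phi z' -> z = z'.
Proof.
move=> Oz Oz' EF EP; have fz := Phi_face Oz.
have [P [s [rho [Xi ch]]]] :=
  exists_face_chart (@connected_component_sub _ stratum xi _ fz).
have [zs zr] := chart_nbhd_eta ch.
have [G GP] := exists_pullback_limit ch fz.
have [yr yE] := face_paramK ch fz zs zr (face_active fz).
rewrite -(pullback_limit_left ch fz GP Oz yr (esym yE)) EF.
apply: (pullback_limit_left ch fz GP Oz' yr); by rewrite -EP.
Qed.

(** The map [h] will come from a choice and carries no regularity; since [G] is a left inverse of
    [(F, Phi)], the two coincide on the patch. *)
Lemma limit_inverse_hol eta P s rho Xi (h : 'rV[R[i]]_r -> V -> V) :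
  face_chart eta P s rho Xi -> face Omega f xi eta ->
  (forall w b, nr w < 1 -> face Omega f xi b ->
    [/\ Omega (h w b), F (h w b) = w & Phi (h w b) = b]) ->
  forall p, patch eta P rho p ->
    differentiable (fun p => h (lsubmx p) (face_param Xi (rsubmx p))) p.
Proof.
move=> ch feta hP p pp; have [G GP] := exists_pullback_limit ch feta.
have op : open (patch eta P rho) by exact: patch_open.
have [e e0 eP] := (openP_nr _).1 op _ pp.
have [_ dG] := GP _ pp.
apply: (differentiable_near_eq e0 _ dG) => q /eP[q1 q2].
have [Oh Fh Ph] := hP _ _ q1 (face_param_face ch feta q2).
have := pullback_limit_left ch feta GP Oh q2 Ph.
by rewrite Fh hsubmxK => ->.
Qed.
(** The normal coordinate is [active_map - c], of codimension [r], while the polydisc factor is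
    open. Chart points where it vanishes lie in the face, not merely in the stratum, because they
    are values of [face_param]. *)
Lemma exists_product_chart eta P s rho Xi : face_chart eta P s rho Xi ->
  face Omega f xi eta ->
  exists b : slice_chart (r + (d - r)) (polydisc R r `*` face Omega f xi),
  [/\ forall p, chart_dom b p <-> nr p.1 < 1 /\ chart_nbhd eta P s rho p.2,
      forall p, chart_coord b p = row_mx p.1 (p.2 *m P),
      forall x, chart_range b x -> patch eta P rho x &
      forall x, chart_param b x = (lsubmx x, face_param Xi (rsubmx x))].
Proof.
move=> ch feta; have [rho0 cW cX cX2] := ch.
pose dom : set ('rV[R[i]]_r * V)%type :=
  [set p | nr p.1 < 1 /\ chart_nbhd eta P s rho p.2].
pose cod : set ('rV[R[i]]_(r + (d - r)) * 'rV[R[i]]_r)%type :=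
  [set q | patch eta P rho q.1 /\ nr q.2 < rho].
pose to (p : ('rV[R[i]]_r * V)%type) : ('rV[R[i]]_(r + (d - r)) * 'rV[R[i]]_r)%type :=
  (row_mx p.1 (p.2 *m P), active_map p.2 - c).
pose from (q : ('rV[R[i]]_(r + (d - r)) * 'rV[R[i]]_r)%type) : ('rV[R[i]]_r * V)%type :=
  (lsubmx q.1, Xi (row_mx (c + q.2) (rsubmx q.1))).
have ball (q : ('rV[R[i]]_(r + (d - r)) * 'rV[R[i]]_r)%type) : cod q ->
    nr (row_mx (c + q.2) (rsubmx q.1) - chart_fun P eta) < rho.
  move=> [[q1 q2] q3]; apply/(chart_ball ch feta); split => //.
  by rewrite addrAC subrr add0r.
have bih : biholomorphism dom cod to from.
  split.
  - split; apply/openP_nr => p.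
      move=> [p1 p2].
      have [e e0 eN] := (openP_nr _).1 (chart_nbhd_open ch) _ p2.
      exists (Num.min (1 - nr p.1) e) => [|q]; first by rewrite lt_min e0 subr_gt0 p1.
      rewrite [q - p]surjective_pairing nr_pair gt_max !lt_min => /andP[/andP[h1 _] /andP[_ h2]].
      split; last exact: eN.
      have := ler_nr_tri q.1 p.1 0; rewrite !subr0 => h3.
      by rewrite (le_lt_trans h3)// -ltrBrDr.
    move=> [p1 p2].
    have op : open (patch eta P rho) by exact: patch_open.
    have [e e0 eN] := (openP_nr _).1 op _ p1.
    exists (Num.min e (rho - nr p.2)) => [|q]; first by rewrite lt_min e0 subr_gt0 p2.
    rewrite [q - p]surjective_pairing nr_pair gt_max !lt_min => /andP[/andP[h1 _] /andP[_ h2]].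
    split; first exact: eN.
    have := ler_nr_tri q.2 p.2 0; rewrite !subr0 => h3.
    by rewrite (le_lt_trans h3)// -ltrBrDr.
  - split=> [p [p1 [p2 p3]]|q qc].
      have [Wp _ _] := cW _ p2.
      apply: differentiable_pair.
        apply: differentiable_row_mx; first exact: differentiable_fst.
        apply: (@differentiable_comp _ _ _ _ snd (mulmx^~ P)); first exact: differentiable_snd.
        exact: differentiable_mulmxr.
      apply: differentiableB; last exact: differentiable_cst.
      apply: (@differentiable_comp _ _ _ _ snd active_map); first exact: differentiable_snd.
      exact: differentiable_active_map.
    apply: differentiable_pair.
      apply: (@differentiable_comp _ _ _ _ fst lsubmx); first exact: differentiable_fst.
      exact: differentiable_lsubmx.
    apply: (@differentiable_comp _ _ _ _
      (fun q => row_mx (c + q.2) (rsubmx q.1)) Xi); last first.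
      by have [_ _] := cX _ (ball q qc).
    apply: differentiable_row_mx.
      by apply: differentiableD; [exact: differentiable_cst|exact: differentiable_snd].
    apply: (@differentiable_comp _ _ _ _ fst rsubmx); first exact: differentiable_fst.
    exact: differentiable_rsubmx.
  - split=> [p [p1 [p2 p3]]|q qc].
      have [h1 h2] := (chart_ball ch feta _ _).1 p3.
      by split => //; split; rewrite /= ?row_mxKl ?row_mxKr.
    have [h1 h2 _] := cX _ (ball q qc); have [[q1 q2] q3] := qc.
    by split => //; split => //=; rewrite h2; exact: ball.
  - split=> [[w z] [p1 [p2 p3]]|[p e] qc].
      rewrite /from /to /= row_mxKl row_mxKr [c + _]addrC subrK.
      by rewrite -[row_mx _ _]/(chart_fun P z) cX2.
    have [_ h2 _] := cX _ (ball (p, e) qc); rewrite /to /from /=.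
    have [E1 E2] := eq_row_mx h2.
    by rewrite E1 E2 hsubmxK addrAC subrr add0r.
have flat p : dom p -> ((polydisc R r `*` face Omega f xi) p <-> (to p).2 = 0).
  move=> [p1 [p2 p3]]; split=> [[_ fp]|E].
    by rewrite /to /= face_active// subrr.
  have ac : active_map p.2 = c by apply/eqP; rewrite -subr_eq0; apply/eqP.
  split; first exact/polydisc_nr.
  have [yr E1] := face_paramK ch feta p2 p3 ac.
  by have := face_param_face ch feta yr; rewrite E1.
exists (SliceChart bih flat); split=> //; first by move=> q [].
by move=> q; rewrite /chart_param /= /from /= addr0.
Qed.

Lemma limit_biholomorphic :
  biholomorphic d (r + (d - r)) Omega (polydisc R r `*` face Omega f xi).
Proof.
have inv (q : ('rV[R[i]]_r * V)%type) : exists z, nr q.1 < 1 ->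
    face Omega f xi q.2 -> [/\ Omega z, F z = q.1 & Phi z = q.2].
  have [[q1 q2]|nq] := pselect (nr q.1 < 1 /\ face Omega f xi q.2).
    by have [z zP] := limit_surjective q1 q2; exists z.
  by exists x => q1 q2; exfalso; apply: nq.
have [h hP] := choice inv.
exists (fun z => (F z, Phi z)), h; split.
- split=> [z Oz|z Oz].
    by split; [apply/polydisc_nr; exact: F_lt1|exact: Phi_face].
  have fz := Phi_face Oz.
  have [P [s [rho [Xi ch]]]] :=
    exists_face_chart (@connected_component_sub _ stratum xi _ fz).
  have [b [bdom bcoord _ _]] := exists_product_chart ch fz.
  (* The inclusion between chart domains in [holomorphic_map] forces this restriction to points that
     [Phi] sends into the chart. *)
  pose D := [set w | Omega w /\ chart_nbhd (Phi z) P s rho (Phi w)].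
  have oD : open D.
    by apply: open_preimage oO (chart_nbhd_open ch) _ => w /PhiP[].
  have DO : D `<=` Omega by move=> w [].
  have [a [adom _ arange aparam]] := exists_open_chart oD DO.
  exists a, b; split.
  + by rewrite adom; split=> //; exact: chart_nbhd_eta ch.
  + move=> w Ow; rewrite adom => -[_ nw]; apply/bdom; split => //.
    exact: F_lt1.
  + move=> w /arange[Ow _].
    have -> : (fun x0 => chart_coord b (F (chart_param a x0), Phi (chart_param a x0))) =
        (fun x0 => row_mx (F x0) (Phi x0 *m P)).
      by apply/funext => x0; rewrite bcoord aparam.
    apply: differentiable_row_mx; first by have [] := FP Ow.
    apply: (@differentiable_comp _ _ _ _ Phi (mulmx^~ P)); first by have [] := PhiP Ow.
    exact: differentiable_mulmxr.
- split=> [[w eta] [/polydisc_nr w1 feta]|[w eta] [/polydisc_nr w1 feta]].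
    by have [] := hP _ w1 feta.
  have [P [s [rho [Xi ch]]]] :=
    exists_face_chart (@connected_component_sub _ stratum xi _ feta).
  have [b [bdom _ brange bparam]] := exists_product_chart ch feta.
  have [a [adom acoord _ _]] := exists_open_chart oO (@subset_refl _ Omega).
  exists b, a; split.
  + by apply/bdom; split=> //; exact: chart_nbhd_eta ch.
  + move=> [w' z'] [/polydisc_nr w'1 fz'] _; rewrite adom.
    by have [] := hP (w', z') w'1 fz'.
  + move=> p /brange pp.
    have -> : (fun x0 => chart_coord a (h (chart_param b x0))) =
        (fun x0 => h (lsubmx x0, face_param Xi (rsubmx x0))).
      by apply/funext => x0; rewrite acoord bparam.
    apply: (limit_inverse_hol ch feta (h := fun w z => h (w, z))) pp.
    by move=> w0 b0; exact: (hP (w0, b0)).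
- move=> z Oz; have [Oh Fh Ph] := hP (F z, Phi z) (F_lt1 Oz) (Phi_face Oz).
  exact: limit_injective.
- by move=> [w eta] [/polydisc_nr w1 feta]; have [_ -> ->] := hP (w, eta) w1 feta.
Qed.

End LimitMaps.
End Limits.

End Face.

Unset Implicit Arguments.
Local Close Scope complex_scope.

Theorem theorem1p9 (R : realType) (d N : nat) (Omega : set 'rV[R[i]]_d)
    (f : 'I_N -> 'rV[R[i]]_d -> R[i]) (xi : 'rV[R[i]]_d)
    (dom_Omega : domain Omega) (bounded_Omega : bounded_set Omega)
    (generic_f : generic_defining_functions Omega f)
    (limit_xi : limit_set Omega xi) :
  let r := #|active f xi| in
  biholomorphic d (r + (d - r)) Omega
    (polydisc R r `*` face Omega f xi).
Proof.
have [_ oO cO] := dom_Omega.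
have [M bO] := bounded_set_nr bounded_Omega.
have [[W [oW clW hW OE]] gen] := generic_f.
have [bxi [phi [x [Aphi Ox phix]]]] := limit_xi.
have [psi hphi] := choice Aphi.
have [U [UU Uoo]] := exists_ultrafilter_oo.
have phixU : (fun n => phi n x) @ U --> xi.
  by move=> A /phix[n0 _ n0A]; exact: (filterS n0A (Uoo n0)).
have [Phi [F [PhiP FP]]] :=
  exists_limits xi hW OE oO bO hphi Ox.
exact: (limit_biholomorphic oW clW hW OE oO gen bxi bO cO hphi Ox phixU PhiP FP).
Qed.
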